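(* Let $\boldsymbol{\mathcal X}_1,\boldsymbol{\mathcal X}_2,\ldots$ and $\boldsymbol{\mathcal X}$ be random pmm spaces with distributions $\mu_1,\mu_2,\ldots$ and $\mu$ respectively. The following are equivalent: (i) $\boldsymbol{\mathcal X}_n\Rightarrow\boldsymbol{\mathcal X}$ weakly, i.e. $d_P(\mu_n,\mu)\to0$, where $d_P$ is the Prokhorov metric on probability measures on $(\mathcal M_*,d_{GHP})$. (ii) For every continuity radius $r$ of $\mu$, $\overline B_r(\boldsymbol{\mathcal X}_n)\Rightarrow\overline B_r(\boldsymbol{\mathcal X})$ weakly as random elements of $\mathcal M^c_*$, i.e. $d^c_P(\mu_n^{(r)},\mu^{(r)})\to0$. (iii) There exists an unbounded set $I\subseteq[0,\infty)$ such that $\overline B_r(\boldsymbol{\mathcal X}_n)\Rightarrow\overline B_r(\boldsymbol{\mathcal X})$ weakly for every $r\in I$.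
   Context: A pointed measured metric (pmm) space is $\mathcal X=(X,o,\mu)$ with $X$ a metric space, $o\in X$, $\mu$ a nonnegative Borel measure; compact if $X$ compact and $\mu$ finite; boundedly compact if closed balls $\overline B_r(x)$ are compact and of finite measure. Open ball $B_r(x)=\{y:d(x,y)<r\}$. $\overline B_r(\mathcal X):=(\overline B_r(o),o,\mu|_{\overline B_r(o)})$. $\mathcal M_*$ ($\mathcal M^c_*$): GHP-isometry classes of boundedly compact (compact) pmm spaces, where a GHP-isometry is a surjective distance-preserving map preserving base points and mapping the measure to the other measure by push-forward. $d_H$ Hausdorff distance; Prokhorov distance of finite Borel measures on a metric space: $\inf\{\epsilon>0:\mu(A)\le\nu(A^\epsilon)+\epsilon,\ \nu(A)\le\mu(A^\epsilon)+\epsilon\ \forall A\text{ closed}\}$, $A^\epsilon$ closed $\epsilon$-neighborhood. $d^c_{GHP}(\mathcal X,\mathcal Y)=\inf\{d(f(o_X),g(o_Y))\vee d_H(f(X),g(Y))\vee d_P(f_*\mu_X,g_*\mu_Y)\}$ over metric spaces $Z$ and isometric embeddings $f,g$. $\mathcal X'\preceq\mathcal X$ means $X'\subseteq X$, same base point, $\mu'\le\mu$. For $r\ge\epsilon\ge0$, $a(\epsilon,r;\mathcal X,\mathcal Y):=\inf d^c_{GHP}(\overline B_r(\mathcal X),\mathcal Y')$ over compact pmm-subspaces $\mathcal Y'$ with $\overline B_{r-\epsilon}(\mathcal Y)\preceq\mathcal Y'\preceq\mathcal Y$; $a_\epsilon:=a(\epsilon,1/\epsilon;\cdot,\cdot)$;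 $d_{GHP}(\mathcal X,\mathcal Y):=\inf\{\epsilon\in(0,1]:a_\epsilon(\mathcal X,\mathcal Y)\vee a_\epsilon(\mathcal Y,\mathcal X)<\epsilon/2\}$, $\inf\emptyset:=1$. $(\mathcal M_*,d_{GHP})$ and $(\mathcal M^c_*,d^c_{GHP})$ are complete separable metric spaces. A random pmm space is a random element of $\mathcal M_*$ (Borel $\sigma$-field of $d_{GHP}$); its distribution is its law. For fixed $r$ the map $\mathcal X\mapsto\overline B_r(\mathcal X)$ from $\mathcal M_*$ to $\mathcal M^c_*$ is measurable; $\mu^{(r)}$ denotes the law of $\overline B_r(\boldsymbol{\mathcal X})$ when $\boldsymbol{\mathcal X}$ has law $\mu$. $d^c_P$ is the Prokhorov metric on probability measures on $(\mathcal M^c_*,d^c_{GHP})$. A number $r>0$ is a continuity radius of a pmm space $(X,o,\mu)$ if $\overline B_r(o)$ is the closure of $B_r(o)$ and $\mu(\overline B_r(o)\setminus B_r(o))=0$; $r$ is a continuity radius of the law $\mu$ if it is a continuity radius of $\boldsymbol{\mathcal X}$ almost surely. *)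

(* Defs.v *)
From HB Require Import structures.
From mathcomp Require Import all_boot all_order all_algebra.
From mathcomp Require Import all_classical all_reals.
From mathcomp Require Import ereal topology normedtype sequences measure.
From Stdlib Require List.
Set Implicit Arguments. Unset Strict Implicit. Unset Printing Implicit Defensive.
Import Order.TTheory GRing.Theory Num.Theory.
Local Open Scope classical_set_scope.
Local Open Scope ring_scope.

Section PMM.
Variable R : realType.
Local Open Scope ereal_scope.

Section Generic.
Variable T : Type.
Variable d : T -> T -> \bar R.

Definition d_open (U : set T) : Prop :=
  forall x, U x -> exists e : R, (0 < e)%R /\ forall y, d x y < e%:E -> U y.
Definition d_closed (A : set T) : Prop := d_open (~` A).
Definition d_borel : set (set T) := smallest (sigma_algebra setT) d_open.
(** closed eps-neighbourhood  {x | d(x,A) <= eps} *)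
Definition d_nbhd (A : set T) (e : R) : set T :=
  [set x | forall del : R, (0 < del)%R -> exists a, A a /\ d x a < (e + del)%:E].
Definition d_closure (A : set T) : set T :=
  [set x | forall e : R, (0 < e)%R -> exists a, A a /\ d x a < e%:E].
Definition d_compact (K : set T) : Prop :=
  forall (I : Type) (U : I -> set T), (forall i, d_open (U i)) ->
    K `<=` \bigcup_i U i ->
    exists s : list I, forall x, K x -> exists i, List.In i s /\ U i x.
Definition is_measure (m : set T -> \bar R) : Prop :=
  [/\ m set0 = 0,
      (forall A, d_borel A -> 0 <= m A) &
      (forall F : nat -> set T, (forall n, d_borel (F n)) -> trivIset setT F ->
         (fun n => \sum_(k < n) m (F k)) @ \oo --> m (\bigcup_n F n))].
Definition is_probability (m : set T -> \bar R) : Prop :=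
  is_measure m /\ m setT = 1.
Definition prokhorov (m1 m2 : set T -> \bar R) : \bar R :=
  ereal_inf [set e%:E | e in [set e : R | (0 < e)%R /\
     forall A, d_closed A ->
       m1 A <= m2 (d_nbhd A e) + e%:E /\ m2 A <= m1 (d_nbhd A e) + e%:E]].
Definition hausdorff (S1 S2 : set T) : \bar R :=
  ereal_inf [set e%:E | e in [set e : R | (0 < e)%R /\
     S1 `<=` d_nbhd S2 e /\ S2 `<=` d_nbhd S1 e]].
End Generic.

Definition is_metric (T : Type) (d : T -> T -> R) : Prop :=
  [/\ forall x y, (0 <= d x y)%R, forall x y, d x y = 0%R <-> x = y,
      forall x y, d x y = d y x & forall x y z, (d x z <= d x y + d y z)%R].
Definition edist (T : Type) (d : T -> T -> R) : T -> T -> \bar R :=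
  fun x y => (d x y)%:E.

(** ** Pointed measured metric spaces (raw data; well-formedness is a predicate) *)
Record pmm := PMM {
  pt : Type;
  pd : pt -> pt -> R;
  po : pt;
  pmu : set pt -> \bar R }.
Arguments pd : clear implicits.
Arguments pmu : clear implicits.

Definition cball (T : Type) (d : T -> T -> R) (x : T) (r : R) : set T :=
  [set y | (d x y <= r)%R].
Definition oball (T : Type) (d : T -> T -> R) (x : T) (r : R) : set T :=
  [set y | (d x y < r)%R].

Definition bc_pmm (X : pmm) : Prop :=
  [/\ is_metric (pd X), is_measure (edist (pd X)) (pmu X) &
      forall x r, d_compact (edist (pd X)) (cball (pd X) x r) /\
                  pmu X (cball (pd X) x r) < +oo].
Definition c_pmm (X : pmm) : Prop :=
  [/\ is_metric (pd X), is_measure (edist (pd X)) (pmu X),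
      d_compact (edist (pd X)) setT & pmu X setT < +oo].

Definition subpmm (X : pmm) (S : set (pt X)) (h : S (po X))
    (nu : set {x | S x} -> \bar R) : pmm :=
  @PMM {x | S x} (fun a b => pd X (proj1_sig a) (proj1_sig b))
       (exist _ (po X) h) nu.

(** carrier of the closed ball of radius r around the base point; the base point
    is added explicitly so that the subspace is well-defined as raw data
    (for r >= 0 and a metric, this is exactly the closed ball) *)
Definition ballset (X : pmm) (r : R) : set (pt X) :=
  [set x | x = po X \/ (pd X (po X) x <= r)%R].
Arguments ballset : clear implicits.
Lemma ballset_o (X : pmm) (r : R) : ballset X r (po X).
Proof. by left. Qed.
Definition ballpmm (r : R) (X : pmm) : pmm :=
  @subpmm X (ballset X r) (ballset_o X r)
     (fun A => pmu X [set proj1_sig a | a in A]).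

Definition isom_emb (A B : Type) (dA : A -> A -> R) (dB : B -> B -> R) (f : A -> B) :=
  forall x y, dB (f x) (f y) = dA x y.
Definition pushf (A B : Type) (f : A -> B) (m : set A -> \bar R) : set B -> \bar R :=
  fun S => m (f @^-1` S).

Definition dGHPc (X Y : pmm) : \bar R :=
  ereal_inf [set v | exists (Z : Type) (dZ : Z -> Z -> R) (f : pt X -> Z) (g : pt Y -> Z),
    [/\ is_metric dZ, isom_emb (pd X) dZ f, isom_emb (pd Y) dZ g &
      v = maxe (dZ (f (po X)) (g (po Y)))%:E
            (maxe (hausdorff (edist dZ) (range f) (range g))
                  (prokhorov (edist dZ) (pushf f (pmu X)) (pushf g (pmu Y))))]].

Definition aGHP (e r : R) (X Y : pmm) : \bar R :=
  ereal_inf [set v | exists (S : set (pt Y)) (h : S (po Y)) (nu : set {y | S y} -> \bar R),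
    [/\ c_pmm (subpmm h nu),
        (* \overline B_{r-e}(Y) <= Y' *)
        cball (pd Y) (po Y) (r - e) `<=` S,
        (forall A, d_borel (edist (fun a b : {y | S y} => pd Y (proj1_sig a) (proj1_sig b))) A ->
           pmu Y ([set proj1_sig a | a in A] `&` cball (pd Y) (po Y) (r - e)) <= nu A),
        (* Y' <= Y *)
        (forall A, d_borel (edist (fun a b : {y | S y} => pd Y (proj1_sig a) (proj1_sig b))) A ->
           nu A <= pmu Y [set proj1_sig a | a in A]) &
        v = dGHPc (ballpmm r X) (subpmm h nu)]].

(** GHP distance on boundedly compact pmm spaces; inf over the empty set is 1 *)
Definition dGHP (X Y : pmm) : R :=
  fine (mine 1 (ereal_inf [set e%:E | e in [set e : R | (0 < e <= 1)%R /\
     maxe (aGHP e e^-1 X Y) (aGHP e e^-1 Y X) < (e / 2)%:E]])).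

(** the spaces M_* and M^c_* (GHP-isometry classes are represented by their
    members; the (pseudo)metrics identify GHP-isometric spaces) *)
Definition Mstar := {X : pmm | bc_pmm X}.
Definition Mc := {X : pmm | c_pmm X}.
Definition dMstar : Mstar -> Mstar -> \bar R :=
  fun X Y => (dGHP (proj1_sig X) (proj1_sig Y))%:E.
Definition dMc : Mc -> Mc -> \bar R :=
  fun X Y => dGHPc (proj1_sig X) (proj1_sig Y).

(** laws of random pmm spaces = Borel probability measures on M_* *)
Definition law (m : set Mstar -> \bar R) : Prop := is_probability dMstar m.

Definition law_ball (r : R) (m : set Mstar -> \bar R) : set Mc -> \bar R :=
  fun A => m [set X : Mstar | exists Y : Mc, A Y /\ proj1_sig Y = ballpmm r (proj1_sig X)].

Definition cont_radius (r : R) (X : pmm) : Prop :=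
  [/\ (0 < r)%R,
      d_closure (edist (pd X)) (oball (pd X) (po X) r) = cball (pd X) (po X) r &
      pmu X (cball (pd X) (po X) r `\` oball (pd X) (po X) r) = 0].
Definition cont_radius_law (r : R) (m : set Mstar -> \bar R) : Prop :=
  (0 < r)%R /\ exists N, d_borel dMstar N /\ m N = 0 /\
     forall X : Mstar, ~ N X -> cont_radius r (proj1_sig X).

Definition wconv (mn : nat -> set Mstar -> \bar R) (m : set Mstar -> \bar R) : Prop :=
  (fun n => prokhorov dMstar (mn n) m) @ \oo --> 0.
Definition wconv_ball (r : R) (mn : nat -> set Mstar -> \bar R) (m : set Mstar -> \bar R) : Prop :=
  (fun n => prokhorov dMc (law_ball r (mn n)) (law_ball r m)) @ \oo --> 0.

End PMM.

(* Main.v *)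
(* (iii) => (i).  If the closed [r]-balls of [X] and [Y] are [e/2]-close and r >= 1/e, then
   d_GHP(X, Y) <= e; so a Prokhorov bound between the laws of the [r]-balls, applied to
   the closure of the set of [r]-balls of a closed set A, gives one between the laws.

   (i) => (ii).  X |-> ball_r(X) is continuous wherever [r] is a continuity radius.  The
   set of points where it oscillates by at least [e] at scale [delta] is open and its
   probability tends to 0 with [delta]; off that set the Prokhorov inequality pulls back.

   (ii) => (iii).  For fixed [h], a boundedly compact space has finitely many radii below
   a given bound where the balls jump by at least [h].  If the law had no continuity
   radius in an interval, then for some [h] there would be infinitely many radii at which
   the jump has probability > h, hence a space with infinitely many such jumps.

   Testing laws on sets requires X |-> ball_r(X) to be Borel, which follows from right
   continuity in [r], and neighbourhoods of closed sets to be closed, i.e. the triangle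
   inequality for d_GHP.  The latter rests on passing from a pair of close compact spaces
   to close subspaces, with fractional submeasures: after discretization this is a
   fractional version of Hall's marriage theorem. *)

Require Import Defs.
From mathcomp Require Import all_boot all_order all_algebra.
From mathcomp Require Import all_classical all_reals.
From mathcomp Require Import ereal topology normedtype sequences measure.
From mathcomp Require Import lebesgue_measure lra ring.
Import Order.TTheory GRing.Theory Num.Theory.
Import numFieldNormedType.Exports Defs.
Local Open Scope classical_set_scope.
Local Open Scope ring_scope.
Set Implicit Arguments. Unset Strict Implicit. Unset Printing Implicit Defensive.

(** * Fractional Hall theorem *)

Section Hall.
Variables (R : realFieldType) (I J : finType).

(** The infimum over all common metric spaces is awkward to compose, so closeness of compact spaces
    is carried by a single function [w] between the two carriers, the restriction of a pseudometric
    on their disjoint union; gluing becomes an infimal convolution. The obstacle is the clause of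
    [dGHP] on intermediate subspaces: balls of two close spaces need not be close, because a sphere
    may carry mass or a new cluster of points on one side only. Hence a radius can be lowered only
    by carrying an arbitrary submeasure across [w], which is what the matching supplies. Moving a
    point across a [w] with bound [c] changes its distance to the base point by at most [2 * c],
    once for the point and once for the base point; with [c < e / 2] this is below the slack [e] of
    [dGHP], which explains the threshold [e / 2]. Isometry classes are represented by members, so
    the topology is done for pseudometrics with values in [\bar R], and bounds are strict because
    infima need not be attained. *)

Definition neighbours (E : {set I * J}) (S : {set I}) : {set J} :=
  [set j | [exists i in S, (i, j) \in E]].

Lemma neighboursP (E : {set I * J}) (S : {set I}) j :
  reflect (exists2 i, i \in S & (i, j) \in E) (j \in neighbours E S).
Proof. by rewrite inE; exact: exists_inP. Qed.

Lemma sum_indic1 (K : finType) (k0 : K) : \sum_k (k == k0)%:R = 1 :> R.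
Proof. by rewrite (bigD1 k0)//= eqxx big1 ?addr0// => k /negbTE ->. Qed.

Lemma sum_delta (K : finType) (k0 : K) (t : R) (S : {set K}) (f : K -> R) :
  \sum_(k in S) (f k - t * (k == k0)%:R) = \sum_(k in S) f k - t * (k0 \in S)%:R.
Proof.
rewrite sumrB -mulr_sumr; congr (_ - t * _).
have [kS|kS] := boolP (k0 \in S).
  rewrite (bigD1 k0)//= eqxx big1 ?addr0// => k /andP[_ /negbTE ->//].
by rewrite big1// => k kk; case: eqP => // kE; rewrite -kE kk in kS.
Qed.

Lemma sum_setIU (K : finType) (S T : {set K}) (f : K -> R) :
  \sum_(k in S) f k + \sum_(k in T) f k =
  \sum_(k in S :|: T) f k + \sum_(k in S :&: T) f k.
Proof.
have mk (A : {set K}) : \sum_(k in A) f k = \sum_k (if k \in A then f k else 0).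
  exact: big_mkcond.
rewrite !mk -!big_split /=; apply: eq_bigr => k _; rewrite !inE.
by case: (k \in S); case: (k \in T) => /=; rewrite ?addr0 ?add0r.
Qed.

Lemma sum_subset (K : finType) (S T : {set K}) (f : K -> R) :
  (forall k, 0 <= f k) -> S \subset T -> \sum_(k in S) f k <= \sum_(k in T) f k.
Proof.
move=> f0 /fintype.subsetP ST; rewrite big_mkcond [leRHS]big_mkcond /=; apply: ler_sum => k _.
by case: ifPn => [/ST -> //|_]; case: ifP.
Qed.

(* Push the largest possible amount [t] along some edge; the edge can then be
   deleted, since it is either exhausted at one end, or some set of sources not
   containing [i0] is tight, in which case submodularity of [nu \o neighbours]
   preserves the Hall condition. *)
Lemma weighted_hall (E : {set I * J}) (mu : I -> R) (nu : J -> R) :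
  (forall i, 0 <= mu i) -> (forall j, 0 <= nu j) ->
  (forall S : {set I},
     \sum_(i in S) mu i <= \sum_(j in neighbours E S) nu j) ->
  exists a : I -> J -> R, [/\ forall i j, 0 <= a i j,
    forall i j, (i, j) \notin E -> a i j = 0,
    forall i, \sum_j a i j = mu i & forall j, \sum_i a i j <= nu j].
Proof.
have [n En] := ubnP #|E|; elim: n => // n IH in E mu nu En *.
move=> mu0 nu0 hall.
have [E0|[[i0 j0] ijE]] := set_0Vmem E.
  exists (fun _ _ => 0); split=> // [i|j]; last by rewrite big1.
  rewrite big1//; apply/eqP; rewrite eq_sym eq_le mu0 andbT.
  have := hall [set i]%SET; rewrite finset.big_set1 big_pred0// => j.
  by apply/neighboursP => -[k _]; rewrite E0 inE.
pose F (S : {set I}) := \sum_(i in S) mu i.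
pose G (T : {set J}) := \sum_(j in T) nu j.
(* Only for these [S] does lowering [mu i0] and [nu j0] by [t] weaken the Hall inequality: if [i0]
   lies in [S] both sides lose [t], and if [j0] is not a neighbour the right side loses nothing. *)
pose P (S : {set I}) := (i0 \notin S) && (j0 \in neighbours E S).
pose t := \big[Num.min/Num.min (mu i0) (nu j0)]_(S | P S)
            (G (neighbours E S) - F S).
have t_min : t <= Num.min (mu i0) (nu j0) by exact: bigmin_le_id.
have tmu : t <= mu i0 by apply: le_trans t_min _; rewrite ge_min lexx.
have tnu : t <= nu j0 by apply: le_trans t_min _; rewrite ge_min lexx orbT.
have tS S : P S -> t <= G (neighbours E S) - F S by move=> PS; exact: bigmin_le_cond.
have t0 : 0 <= t.
  by apply: le_bigmin => [|S _]; rewrite ?le_min ?mu0 ?nu0// subr_ge0 hall.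
have tE : [\/ t = mu i0, t = nu j0 |
    exists2 S, P S & t = G (neighbours E S) - F S].
  rewrite /t; elim/big_ind: _ => [|x y hx hy|S PS]; last by apply: Or33; exists S.
    by rewrite minEle; case: ifP => _; [apply: Or31|apply: Or32].
  by rewrite minEle; case: ifP.
pose mu' i := mu i - t * (i == i0)%:R.
pose nu' j := nu j - t * (j == j0)%:R.
have mu'0 i : 0 <= mu' i.
  rewrite /mu'; case: eqP => [->|_]; first by rewrite mulr1 subr_ge0.
  by rewrite mulr0 subr0.
have nu'0 j : 0 <= nu' j.
  rewrite /nu'; case: eqP => [->|_]; first by rewrite mulr1 subr_ge0.
  by rewrite mulr0 subr0.
have FE (S : {set I}) : \sum_(i in S) mu' i = F S - t * (i0 \in S)%:R by exact: sum_delta.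
have GE (T : {set J}) : \sum_(j in T) nu' j = G T - t * (j0 \in T)%:R by exact: sum_delta.
have hall' (S : {set I}) : \sum_(i in S) mu' i <= \sum_(j in neighbours E S) nu' j.
  rewrite FE GE; have := hall S; rewrite -/(F S) -/(G _) => hS.
  have [iS|iS] := boolP (i0 \in S).
    have -> : j0 \in neighbours E S by apply/neighboursP; exists i0.
    by rewrite lerD2r.
  have [jS|jS] := boolP (j0 \in neighbours E S); last by rewrite mulr0 !subr0.
  by have := tS S; rewrite /P iS jS => /(_ isT); rewrite /= mulr1 mulr0; lra.
pose E' := E :\ (i0, j0).
have nE (S : {set I}) : i0 \notin S -> neighbours E' S = neighbours E S.
  move=> iS; apply/setP => j; apply/neighboursP/neighboursP => -[i iiS].
    by rewrite !inE => /andP[_ ?]; exists i.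
  move=> ijE'; exists i => //; rewrite !inE ijE' andbT.
  by apply: contraNneq iS => -[<- _].
have nED (S : {set I}) : neighbours E S :\ j0 \subset neighbours E' S.
  apply/fintype.subsetP => j; rewrite !inE => /andP[jj0].
  move=> /exists_inP[i iS ijE']; apply/exists_inP; exists i => //.
  by rewrite !inE ijE' andbT; apply: contraNneq jj0 => -[_ ->].
have hallE' (S : {set I}) : \sum_(i in S) mu' i <= \sum_(j in neighbours E' S) nu' j.
  have [iS|iS] := boolP (i0 \in S); last by rewrite nE.
  have [jS|jS] := boolP (j0 \in neighbours E' S).
    apply: (le_trans (hall' S)); apply: sum_subset => //.
    apply/fintype.subsetP => j jS'; have [->//|jj0] := eqVneq j j0.
    by apply: (fintype.subsetP (nED S)); rewrite finset.in_setD1 jj0.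
  have GD : \sum_(j in neighbours E S) nu' j =
      nu' j0 + \sum_(j in neighbours E' S) nu' j.
    have jE : j0 \in neighbours E S by apply/neighboursP; exists i0.
    rewrite (bigD1 j0)//=; congr (_ + _); apply: eq_bigl => j.
    apply/andP/idP => [[jS' jj0]|jS'].
      by apply: (fintype.subsetP (nED S)); rewrite finset.in_setD1 jj0.
    split; last by apply: contraNneq jS => <-.
    have /neighboursP[i iiS] := jS'; rewrite finset.in_setD1 => /andP[_ ?].
    by apply/neighboursP; exists i.
  (* The deleted edge was the only one from [S] to [j0], so [j0] drops out of the neighbours. In the
     first case [S] may be replaced by [S] without [i0]; in the second [j0] carries no mass any
     more. *)
  case: tE => [tE|tE|[S0 /andP[iS0 jS0] tE]].
  - have mu'i : mu' i0 = 0 by rewrite /mu' eqxx mulr1 tE subrr.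
    rewrite (bigD1 i0)//= mu'i add0r.
    rewrite (eq_bigl (fun i => i \in S :\ i0)); last first.
      by move=> i; rewrite !inE andbC.
    apply: (le_trans (hall' _)); rewrite -nE ?inE ?eqxx//.
    apply: sum_subset => //; apply/fintype.subsetP => j /neighboursP[i].
    by rewrite finset.in_setD1 => /andP[_ iS'] ?; apply/neighboursP; exists i.
  - have nu'j : nu' j0 = 0 by rewrite /nu' eqxx mulr1 tE subrr.
    by have := hall' S; rewrite GD nu'j add0r.
  - have tight : \sum_(i in S0) mu' i = \sum_(j in neighbours E S0) nu' j.
      by rewrite FE GE (negbTE iS0) jS0 tE mulr0 mulr1; lra.
    (* Add the Hall inequalities of the union and the intersection and cancel the tight one. The
       intersection avoids [i0], so the deleted edge does not affect it; the union keeps [j0] as a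
       neighbour through [S0]. *)
    have := hall' (S :|: S0); have := hall' (S :&: S0).
    have := sum_setIU S S0 mu'.
    have := sum_setIU (neighbours E' S) (neighbours E S0) nu'.
    have : \sum_(j in neighbours E (S :&: S0)) nu' j <=
       \sum_(j in neighbours E' S :&: neighbours E S0) nu' j.
      apply: sum_subset => //; rewrite -nE; last by rewrite finset.in_setI (negbTE iS0) andbF.
      rewrite -(nE S0)//; apply/fintype.subsetP => j /neighboursP[i].
      rewrite finset.in_setI => /andP[iS' iS0'] ijE'; rewrite finset.in_setI.
      by apply/andP; split; apply/neighboursP; exists i.
    have : \sum_(j in neighbours E (S :|: S0)) nu' j <=
       \sum_(j in neighbours E' S :|: neighbours E S0) nu' j.
      apply: sum_subset => //; apply/fintype.subsetP => j /neighboursP[i].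
      rewrite finset.in_setU => /orP[iS'|iS'] ijE'; rewrite finset.in_setU; last first.
        by apply/orP; right; apply/neighboursP; exists i.
      have [->|jj0] := eqVneq j j0; first by rewrite jS0 orbT.
      apply/orP; left; apply: (fintype.subsetP (nED S)); rewrite finset.in_setD1 jj0.
      by apply/neighboursP; exists i.
    by rewrite tight; lra.
have En' : (#|E'| < n)%N by move: En; rewrite (cardsD1 (i0, j0)) ijE.
have [a [a0 aE am an]] := IH E' mu' nu' En' mu'0 nu'0 hallE'.
exists (fun i j => a i j + t * (i == i0)%:R * (j == j0)%:R); split.
- by move=> i j; rewrite addr_ge0// !mulr_ge0// ler0n.
- move=> i j ijE'; rewrite aE; last by rewrite !inE negb_and ijE' orbT.
  rewrite add0r; case: eqP => [ii|_]; last by rewrite mulr0 mul0r.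
  case: eqP => [jj|_]; last by rewrite mulr0.
  by rewrite ii jj ijE in ijE'.
- move=> i; rewrite big_split /= am -mulr_sumr sum_indic1 mulr1.
  by rewrite /mu' subrK.
- move=> j; rewrite big_split /= -mulr_suml -mulr_sumr sum_indic1 mulr1.
  by rewrite -lerBrDr an.
Qed.

End Hall.

(** * Matchings with a deficit and transport of submeasures *)

Section Transport.
Variable R : realFieldType.

Definition rset (I J : finType) (r : I -> J -> bool) : {set I * J} :=
  [set p | r p.1 p.2].

Definition nbrs (I J : finType) (r : I -> J -> bool) (S : {set I}) : {set J} :=
  [set j | [exists i in S, r i j]].

Lemma nbrsP (I J : finType) (r : I -> J -> bool) (S : {set I}) j :
  reflect (exists2 i, i \in S & r i j) (j \in nbrs r S).
Proof. by rewrite finset.inE; exact: exists_inP. Qed.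

Lemma sum_option (J : finType) (f : option J -> R) :
  \sum_j f j = f None + \sum_j f (Some j).
Proof.
rewrite (bigD1 None)//=; congr (_ + _).
rewrite (reindex_omap Some id)//=; last by case.
by apply: eq_bigl => j; rewrite eqxx.
Qed.

(** An extra sink [None] of capacity [e], joined to every source, absorbs the deficit; the mass sent
    to it is the unmatched mass. *)
Lemma deficient_hall (I J : finType) (r : I -> J -> bool) (mu : I -> R)
    (nu : J -> R) (e : R) :
  (forall i, 0 <= mu i) -> (forall j, 0 <= nu j) -> 0 <= e ->
  (forall S : {set I},
     \sum_(i in S) mu i <= \sum_(j in nbrs r S) nu j + e) ->
  exists a : I -> J -> R, [/\ forall i j, 0 <= a i j,
    forall i j, ~~ r i j -> a i j = 0,
    forall i, \sum_j a i j <= mu i, forall j, \sum_i a i j <= nu j &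
    \sum_i mu i - \sum_i \sum_j a i j <= e].
Proof.
move=> mu0 nu0 e0 hall.
pose r' i (j : option J) := if j is Some j then r i j else true.
pose nu' (j : option J) := if j is Some j then nu j else e.
have [||S|a [a0 aE am an]] := @weighted_hall R _ _ (rset r') mu nu' => //.
- by case.
- have [->|[i iS]] := set_0Vmem S.
    by rewrite finset.big_set0; apply: sumr_ge0 => -[j|] _ /=.
  apply: (le_trans (hall S)); rewrite [leRHS](bigD1 None)/=; last first.
    by apply/neighboursP; exists i => //; rewrite finset.inE.
  rewrite [leLHS]addrC lerD2l big_mkcond /= [leRHS]big_mkcond sum_option /= andbF add0r.
  apply: ler_sum => j _; rewrite andbT.
  have [/nbrsP[k kS rkj]|_] := boolP (j \in nbrs r S); last by case: ifP.
  by rewrite ifT//; apply/neighboursP; exists k => //; rewrite finset.inE.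
- exists (fun i j => a i (Some j)); split=> // [i j rij|i|].
  + by rewrite aE// finset.inE.
  + by rewrite -am sum_option lerDr.
  + rewrite -sumrB; apply: le_trans (an None) => /=.
    by apply: ler_sum => i _; rewrite -am sum_option addrK.
Qed.

(** One matching serves both sides if it almost exhausts the side of larger total mass: the other
    side then has even less left over. *)
Lemma near_matching (I J : finType) (r : I -> J -> bool) (mu : I -> R)
    (nu : J -> R) (e : R) :
  (forall i, 0 <= mu i) -> (forall j, 0 <= nu j) -> 0 <= e ->
  (forall S : {set I}, \sum_(i in S) mu i <= \sum_(j in nbrs r S) nu j + e) ->
  (forall T : {set J},
     \sum_(j in T) nu j <= \sum_(i in nbrs (fun j i => r i j) T) mu i + e) ->
  exists a : I -> J -> R, [/\ forall i j, 0 <= a i j /\ (~~ r i j -> a i j = 0),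
    forall i, \sum_j a i j <= mu i, forall j, \sum_i a i j <= nu j,
    \sum_i mu i - \sum_i \sum_j a i j <= e &
    \sum_j nu j - \sum_i \sum_j a i j <= e].
Proof.
move=> mu0 nu0 e0 hall1 hall2.
have [le|/ltW le] := leP (\sum_j nu j) (\sum_i mu i).
  have [a [a0 ar am an ae]] := deficient_hall mu0 nu0 e0 hall1.
  exists a; split=> // [i j|]; first by split=> //; exact: ar.
  by apply: le_trans ae; rewrite lerD2r.
have [a [a0 ar an am ae]] := deficient_hall nu0 mu0 e0 hall2.
rewrite exchange_big /= in ae.
exists (fun i j => a j i); split=> // [i j|]; first by split=> //; exact: ar.
by apply: le_trans ae; rewrite lerD2r.
Qed.

(* Given an almost complete matching [a] of [mu] with [nu], the submeasure [n]
   of [mu] is transported along [a]; the mass of [nu] that is not matched by the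
   removed part of [mu] is kept. *)
Lemma sub_transport (I J : finType) (r : I -> J -> bool) (mu n : I -> R)
    (nu : J -> R) (e : R) :
  (forall j, 0 <= nu j) -> 0 <= e ->
  (forall i, 0 <= n i <= mu i) ->
  (forall S : {set I}, \sum_(i in S) mu i <= \sum_(j in nbrs r S) nu j + e) ->
  (forall T : {set J},
     \sum_(j in T) nu j <= \sum_(i in nbrs (fun j i => r i j) T) mu i + e) ->
  exists c : J -> R, [/\ forall j, 0 <= c j <= 1,
    forall S : {set I}, \sum_(i in S) n i <= \sum_(j in nbrs r S) c j * nu j + e,
    forall T : {set J}, \sum_(j in T) c j * nu j <=
      \sum_(i in nbrs (fun j i => r i j) T) n i + e &
    forall j, (forall i, r i j -> n i = mu i) -> c j = 1].
Proof.
move=> nu0 e0 nmu hall1 hall2.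
have n0 i : 0 <= n i by case/andP: (nmu i).
have mu0 i : 0 <= mu i by case/andP: (nmu i); exact: le_trans.
have [a [ar am an aem aen]] := near_matching mu0 nu0 e0 hall1 hall2.
have a0 i j : 0 <= a i j by case: (ar i j).
(* The density of [n] with respect to [mu]; where [mu i = 0] it is 0 by the convention for division,
   and [n i] vanishes too. *)
pose q i := n i / mu i.
have q0 i : 0 <= q i by rewrite divr_ge0.
have q1 i : q i <= 1.
  have [m0|m0] := eqVneq (mu i) 0; first by rewrite /q m0 invr0 mulr0 ler01.
  by rewrite ler_pdivrMr ?mul1r ?lt_neqAle ?mu0 1?eq_sym ?m0//; case/andP: (nmu i).
have qmu i : q i * mu i = n i.
  have [m0|m0] := eqVneq (mu i) 0; last by rewrite /q mulrVK// unitfE.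
  by rewrite m0 mulr0; apply/eqP; rewrite eq_le n0 -m0; case/andP: (nmu i).
pose b j := \sum_i q i * a i j.
(* What is left of [nu j] once the part matched with the removed mass [mu - n] is taken away; by
   [kE] it is the matched part of [n] plus the unmatched part of [nu]. *)
pose k j := nu j - \sum_i (1 - q i) * a i j.
have kE j : k j = b j + (nu j - \sum_i a i j).
  rewrite /k /b; under eq_bigr do rewrite mulrBl mul1r.
  by rewrite sumrB; ring.
have b0 j : 0 <= b j by apply: sumr_ge0 => i _; rewrite mulr_ge0.
have bk j : b j <= k j by rewrite kE lerDl subr_ge0 an.
have knu j : k j <= nu j.
  by rewrite /k gerBl sumr_ge0// => i _; rewrite mulr_ge0// subr_ge0.
(* The default 1 at a null [j] agrees with the last conclusion, which asks for density 1. *)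
pose c j := if nu j == 0 then 1 else k j / nu j.
have cnu j : c j * nu j = k j.
  rewrite /c; case: eqP => [z|/eqP z]; last by rewrite mulrVK// unitfE.
  by apply/eqP; rewrite z mulr0 eq_le (le_trans (b0 j))// -z knu.
have bsum (S : {set I}) : \sum_(i in S) \sum_j q i * a i j <=
    \sum_(j in nbrs r S) b j.
  rewrite exchange_big /= [leRHS]big_mkcond /=; apply: ler_sum => j _.
  case: ifPn => [_|jS].
    rewrite big_mkcond; apply: ler_sum => i _.
    by case: ifP => _ //; rewrite mulr_ge0.
  rewrite big1// => i iS; have [_ ->] := ar i j; first by rewrite mulr0.
  by apply: contra jS => rij; apply/nbrsP; exists i.
have bsum' (T : {set J}) : \sum_(j in T) b j <=
    \sum_(i in nbrs (fun j i => r i j) T) n i.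
  rewrite exchange_big /= [leRHS]big_mkcond /=; apply: ler_sum => i _.
  case: ifPn => [_|iT].
    rewrite -mulr_sumr -qmu ler_wpM2l// (le_trans _ (am i))// big_mkcond.
    by apply: ler_sum => j _; case: ifP.
  rewrite big1// => j jT; have [_ ->] := ar i j; first by rewrite mulr0.
  by apply: contra iT => rij; apply/nbrsP; exists j.
exists c; split.
- move=> j; rewrite /c; case: eqP => [_|/eqP z]; first by rewrite ler01 lexx.
  have nuj : 0 < nu j by rewrite lt_neqAle eq_sym z nu0.
  rewrite ler_pdivrMr// mul1r knu andbT divr_ge0//.
  exact: le_trans (b0 j) (bk j).
- move=> S; under [X in _ <= X + _]eq_bigr do rewrite cnu.
  have h1 : \sum_(j in nbrs r S) b j <= \sum_(j in nbrs r S) k j.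
    by apply: ler_sum => j _.
  (* At each source the deficit of [n] is the fraction [q] of the deficit of [mu]. *)
  have h2 : \sum_(i in S) n i - \sum_(i in S) \sum_j q i * a i j <=
      \sum_i mu i - \sum_i \sum_j a i j.
    rewrite -!sumrB big_mkcond; apply: ler_sum => i _.
    have ami : 0 <= mu i - \sum_j a i j by rewrite subr_ge0 am.
    by case: ifP => _ //; rewrite -mulr_sumr -qmu -mulrBr ler_piMl.
  by have := bsum S; lra.
- move=> T; under eq_bigr do rewrite cnu.
  have : \sum_(j in T) k j - \sum_(j in T) b j <= \sum_j nu j - \sum_i \sum_j a i j.
    rewrite [X in _ <= _ - X]exchange_big /= -!sumrB big_mkcond; apply: ler_sum => j _.
    by case: ifP => _; rewrite ?kE ?subr_ge0 ?an//; lra.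
  by have := bsum' T; lra.
- move=> j nj; rewrite /c; case: eqP => // /eqP z; rewrite /k big1 ?subr0 ?divff//.
  move=> i _; have [rij|rij] := boolP (r i j); last first.
    by have [_ ->] := ar i j; rewrite ?mulr0.
  have [m0|m0] := eqVneq (mu i) 0; last by rewrite /q nj// divff// subrr mul0r.
  have : a i j <= 0.
    by rewrite -m0 (le_trans _ (am i))// (bigD1 j)//= lerDl sumr_ge0.
  move=> aij; suff -> : a i j = 0 by rewrite mulr0.
  by apply/eqP; rewrite eq_le a0 aij.
Qed.

End Transport.

(** * Borel sets and finite measures *)

Section Spaces.
Variable R : realType.

Lemma lte_EFin_between (x : \bar R) (a : R) :
  (x < a%:E)%E -> exists2 b, b < a & (x < b%:E)%E.
Proof.
case: x => [r|//|_]; last by exists (a - 1); [rewrite ltrBlDr ltrDl|exact: ltNyr].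
rewrite lte_fin => ra; exists ((r + a) / 2); first by lra.
by rewrite lte_fin; lra.
Qed.

Section Pseudo.
Variables (T : Type) (d : T -> T -> \bar R).

(** A possibly infinite pseudometric, described by strict real upper bounds: these are what an
    infimum such as [dGHPc] provides, and sums in [\bar R] are avoided. *)
Definition pseudo := [/\ forall x (e : R), 0 < e -> (d x x < e%:E)%E,
  forall x y, d x y = d y x &
  forall x y z (a b : R), (d x y < a%:E)%E -> (d y z < b%:E)%E ->
    (d x z < (a + b)%:E)%E].

Lemma d_open_bigcup (I : Type) (U : I -> set T) :
  (forall i, d_open d (U i)) -> d_open d (\bigcup_i U i).
Proof.
move=> oU x [i _ /oU[e [e0 eU]]]; exists e; split=> // y /eU ?; by exists i.
Qed.

Lemma d_openT : d_open d setT.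
Proof. by move=> x _; exists 1; split. Qed.

Lemma d_openI U V : d_open d U -> d_open d V -> d_open d (U `&` V).
Proof.
move=> oU oV x [/oU[a [a0 aU]] /oV[b [b0 bV]]].
exists (Num.min a b); split; first by rewrite lt_min a0.
move=> y xy; split; [apply: aU|apply: bV]; apply: (lt_le_trans xy);
  by rewrite lee_fin ge_min lexx ?orbT.
Qed.

Lemma d_closedI U V : d_closed d U -> d_closed d V -> d_closed d (U `&` V).
Proof.
move=> cU cV; rewrite /d_closed setCI => x [/cU|/cV] [e [e0 he]]; exists e; split=> // y /he;
 by [left|right].
Qed.

Lemma d_closedU U V : d_closed d U -> d_closed d V -> d_closed d (U `|` V).
Proof. by move=> cU cV; rewrite /d_closed setCU; exact: d_openI. Qed.

Lemma d_openC U : d_open d U -> d_closed d (~` U).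
Proof. by rewrite /d_closed setCK. Qed.

Hypothesis pd : pseudo.

Lemma pseudoxx x (e : R) : 0 < e -> (d x x < e%:E)%E.
Proof. by case: pd => + _ _; apply. Qed.

Lemma pseudo_sym x y : d x y = d y x.
Proof. by case: pd. Qed.

Lemma pseudo_trans x y z (a b : R) : (d x y < a%:E)%E -> (d y z < b%:E)%E ->
  (d x z < (a + b)%:E)%E.
Proof. by case: pd => _ _; apply. Qed.

Lemma d_open_thick A (e : R) : d_open d [set x | exists a, A a /\ (d x a < e%:E)%E].
Proof.
move=> x [a [Aa xa]]; have [b be xab] := lte_EFin_between xa.
exists (e - b); split; first by lra.
move=> y xy; exists a; split=> //.
have -> : e = (e - b) + b by lra.
by apply: pseudo_trans xab; rewrite pseudo_sym.
Qed.

Lemma d_nbhd_lt A (e e' : R) x : e < e' -> d_nbhd d A e x ->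
  exists a, A a /\ (d x a < e'%:E)%E.
Proof.
move=> ee' /(_ (e' - e)); rewrite subr_gt0 => /(_ ee')[a [Aa h]].
by exists a; split=> //; move: h; rewrite addrC subrK.
Qed.

Lemma d_nbhd_mem A (e : R) a x : A a -> (d x a <= e%:E)%E -> d_nbhd d A e x.
Proof.
move=> Aa xa del del0; exists a; split=> //; apply: (le_lt_trans xa).
by rewrite lte_fin ltrDl.
Qed.

Lemma sub_d_nbhd A (e : R) : 0 <= e -> A `<=` d_nbhd d A e.
Proof.
move=> e0 x Ax del del0; exists x; split=> //; apply: pseudoxx.
by rewrite ltr_wpDl.
Qed.

Lemma d_closed_nbhd A (e : R) : d_closed d (d_nbhd d A e).
Proof.
move=> x /existsNP[del /not_implyP[del0 xA]].
exists (del / 2); split; first by lra.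
move=> y xy; apply/existsNP; exists (del / 2); apply/not_implyP; split; first by lra.
move=> -[a [Aa ya]]; apply: xA; exists a; split=> //.
have -> : e + del = del / 2 + (e + del / 2) by lra.
exact: pseudo_trans xy ya.
Qed.

Lemma d_closure_nbhd A : d_closure d A = d_nbhd d A 0.
Proof.
by apply/seteqP; split=> x h e /h[a [Aa xa]]; exists a; split=> //; move: xa;
  rewrite add0r.
Qed.

Lemma d_closed_closure A : d_closed d (d_closure d A).
Proof. by rewrite d_closure_nbhd; exact: d_closed_nbhd. Qed.

Lemma sub_d_closure A : A `<=` d_closure d A.
Proof. by rewrite d_closure_nbhd; exact: sub_d_nbhd. Qed.

Lemma d_closed_adherent A x : d_closed d A ->
  (forall e : R, 0 < e -> exists a, A a /\ (d x a < e%:E)%E) -> A x.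
Proof.
move=> cA h; apply: contrapT => /cA[e [e0 eA]].
by have [a [Aa xa]] := h _ e0; apply: (eA a).
Qed.

End Pseudo.

Section Borel.
Variables (T : Type) (d : T -> T -> \bar R).
Local Notation B := (d_borel d).

Lemma d_borel_open U : d_open d U -> B U.
Proof. by move=> oU M [_]; apply. Qed.

Lemma d_borelC A : B A -> B (~` A).
Proof.
by move=> BA M MM; have [[_ MC _] _] := MM; rewrite -setTD; apply: MC; exact: (BA M MM).
Qed.

Lemma d_borel_closed A : d_closed d A -> B A.
Proof. by move=> cA; rewrite -(setCK A); apply: d_borelC; apply: d_borel_open; exact: cA. Qed.

Lemma d_borel_bigcup (F : nat -> set T) : (forall n, B (F n)) -> B (\bigcup_n F n).
Proof.
by move=> BF M MM; have [[_ _ Mc] _] := MM; apply: Mc => n; exact: (BF n M MM).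
Qed.

Lemma d_borelT : B setT.
Proof. by apply: d_borel_open; exact: d_openT. Qed.

Lemma d_borel0 : B set0.
Proof. by rewrite -setCT; apply: d_borelC; exact: d_borelT. Qed.

Lemma d_borel_bigcap (F : nat -> set T) : (forall n, B (F n)) -> B (\bigcap_n F n).
Proof.
move=> BF; rewrite -[X in B X]setCK setC_bigcap; apply: d_borelC; apply: d_borel_bigcup => n.
exact: d_borelC.
Qed.

Lemma d_borelU A A' : B A -> B A' -> B (A `|` A').
Proof.
move=> BA BA'; rewrite -bigcup2E; apply: d_borel_bigcup => -[|[|n]]//=.
exact: d_borel0.
Qed.

Lemma d_borelI A A' : B A -> B A' -> B (A `&` A').
Proof.
move=> BA BA'; rewrite -[X in B X]setCK setCI.
by apply: d_borelC; apply: d_borelU; exact: d_borelC.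
Qed.

Lemma d_borelD A A' : B A -> B A' -> B (A `\` A').
Proof. by move=> BA BA'; rewrite setDE; apply: d_borelI => //; exact: d_borelC. Qed.

Lemma d_borel_fin (I : finType) (S : {set I}) (P : I -> set T) :
  (forall i, B (P i)) -> B [set x | exists2 i, i \in S & P i x].
Proof.
move=> BP; have [n Sn] := ubnP #|S|; elim: n => // n IH in S Sn *.
have [->|[i iS]] := set_0Vmem S.
  rewrite (_ : [set _ | _] = set0); first exact: d_borel0.
  by apply/seteqP; split=> x //= -[i]; rewrite finset.inE.
have Sin : (#|S :\ i| < n)%N by move: Sn; rewrite (cardsD1 i) iS.
rewrite (_ : [set _ | _] = P i `|` [set x | exists2 j, j \in S :\ i & P j x]).
  by apply: d_borelU => //; exact: IH.
apply/seteqP; split=> x /=.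
  move=> [j jS Pj]; have [->|ji] := eqVneq i j; first by left.
  by right; exists j => //; rewrite finset.in_setD1 eq_sym ji.
move=> [Pi|[j]]; first by exists i.
by rewrite finset.in_setD1 => /andP[_ jS] Pj; exists j.
Qed.

End Borel.

Lemma d_borel_preimage (T T' : Type) (d : T -> T -> \bar R) (d' : T' -> T' -> \bar R)
    (f : T -> T') :
  (forall U, d_open d' U -> d_open d (f @^-1` U)) ->
  forall A, d_borel d' A -> d_borel d (f @^-1` A).
Proof.
move=> fU A BA; apply: (BA [set A | d_borel d (f @^-1` A)]); split.
  split=> [|C BC|F BF] /=.
  - by rewrite preimage_set0; exact: d_borel0.
  - by rewrite setTD preimage_setC; exact: d_borelC.
  - by rewrite preimage_bigcup; exact: d_borel_bigcup.
by move=> U /fU /d_borel_open.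
Qed.

Section FMeas.
Variables (T : Type) (d : T -> T -> \bar R).
Local Notation B := (d_borel d).

(** Finite Borel measures with values in [R], so that mass inequalities become linear arithmetic;
    nothing is assumed outside the Borel sets. *)
Definition fmeas (m : set T -> R) := [/\ m set0 = 0, forall A, B A -> 0 <= m A &
  forall F : nat -> set T, (forall n, B (F n)) -> trivIset setT F ->
    (fun n => \sum_(k < n) m (F k)) @ \oo --> m (\bigcup_n F n)].

Section Theory.
Variable m : set T -> R.
Hypothesis fm : fmeas m.

Lemma fm0 : m set0 = 0. Proof. by case: fm. Qed.
Lemma fm_ge0 A : B A -> 0 <= m A. Proof. by case: fm => _ + _; apply. Qed.

Lemma fm_add A A' : B A -> B A' -> A `&` A' = set0 -> m (A `|` A') = m A + m A'.
Proof.
move=> BA BA' AA'; have [_ _ sadd] := fm.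
have c1 : (fun n => \sum_(k < n) m (bigcup2 A A' k)) @ \oo --> m (A `|` A').
  rewrite -bigcup2E; apply: sadd; last by rewrite -trivIset_bigcup2.
  by move=> [|[|n]]//=; exact: d_borel0.
have c2 : (fun n => \sum_(k < n) m (bigcup2 A A' k)) @ \oo --> m A + m A'.
  apply: cvg_near_cst; exists 2%N => // n /= n2; rewrite -(subnKC n2).
  rewrite big_split_ord /= !big_ord_recl big_ord0 /= addr0 big1 ?addr0// => i _.
  exact: fm0.
exact: (cvg_unique _ c1 c2).
Qed.

Lemma fm_D A A' : B A -> B A' -> A `<=` A' -> m (A' `\` A) = m A' - m A.
Proof.
move=> BA BA' AA'; rewrite -[in RHS](setDKU AA') fm_add ?addrK//.
- exact: d_borelD.
- by rewrite setDKI.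
Qed.

Lemma fm_mono A A' : B A -> B A' -> A `<=` A' -> m A <= m A'.
Proof.
move=> BA BA' AA'; rewrite -subr_ge0 -fm_D//; by apply: fm_ge0; exact: d_borelD.
Qed.

Lemma fm_subadd A A' : B A -> B A' -> m (A `|` A') <= m A + m A'.
Proof.
move=> BA BA'; have -> : A `|` A' = A `|` (A' `\` A).
  by rewrite setUDr setDv setD0.
have BD : B (A' `\` A) by exact: d_borelD.
rewrite fm_add ?lerD2l ?fm_mono ?setDIK//; exact: subDsetl.
Qed.

Lemma fm_bigcup_fin (I : finType) (P : I -> set T) (S : {set I}) :
  (forall i, B (P i)) -> (forall i j x, P i x -> P j x -> i = j) ->
  m [set x | exists2 i, i \in S & P i x] = \sum_(i in S) m (P i).
Proof.
move=> BP tP; have [n Sn] := ubnP #|S|; elim: n => // n IH in S Sn *.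
have [->|[i iS]] := set_0Vmem S.
  rewrite finset.big_set0 (_ : [set _ | _] = set0) ?fm0//.
  by apply/seteqP; split=> x //= -[i]; rewrite finset.inE.
have Sin : (#|S :\ i| < n)%N by move: Sn; rewrite (cardsD1 i) iS.
rewrite (_ : [set _ | _] = P i `|` [set x | exists2 j, j \in S :\ i & P j x]).
  rewrite fm_add; [|exact: BP|exact: d_borel_fin|].
    by rewrite (IH _ Sin) [in RHS](finset.big_setD1 i).
  apply/seteqP; split=> x //= -[Pi [j]]; rewrite finset.in_setD1 => /andP[ji _] Pj.
  by move: ji; rewrite (tP _ _ _ Pi Pj) eqxx.
apply/seteqP; split=> x /=.
  move=> [j jS Pj]; have [->|ji] := eqVneq i j; first by left.
  by right; exists j => //; rewrite finset.in_setD1 eq_sym ji.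
move=> [Pi|[j]]; first by exists i.
by rewrite finset.in_setD1 => /andP[_ jS] Pj; exists j.
Qed.

Lemma fm_sum_split (I : finType) (P : I -> set T) A :
  B A -> (forall i, B (P i)) -> (forall i j x, P i x -> P j x -> i = j) ->
  (forall x, A x -> exists i, P i x) -> m A = \sum_i m (A `&` P i).
Proof.
move=> BA BP tP cP.
transitivity (m [set x | exists2 i, i \in [set: I]%SET & (A `&` P i) x]).
  congr m; apply/seteqP; split=> x /=; last by case=> i _ [].
  by move=> Ax; have [i Pi] := cP _ Ax; exists i; rewrite ?finset.in_setT.
rewrite fm_bigcup_fin; first by apply: eq_bigl => i; rewrite finset.in_setT.
- by move=> i; exact: d_borelI.
- by move=> i j x [_ Pi] [_ Pj]; apply: tP Pi Pj.
Qed.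

(** The successive differences partition [F 0] minus the intersection, and their partial sums
    telescope. *)
Lemma fm_dec (F : nat -> set T) : (forall n, B (F n)) ->
  (forall n, F n.+1 `<=` F n) -> forall e, 0 < e ->
  exists n, m (F n) < m (\bigcap_n F n) + e.
Proof.
move=> BF dF e e0; have [_ _ sadd] := fm.
have dF' n k : (n <= k)%N -> F k `<=` F n.
  elim: k => [|k IH]; first by rewrite leqn0 => /eqP ->.
  rewrite leq_eqVlt => /predU1P[->//|/IH]; exact: subset_trans.
pose D n := F n `\` F n.+1.
have BD n : B (D n) by exact: d_borelD.
have tD : trivIset setT D.
  apply/trivIsetP => i j _ _; wlog ij : i j / (i < j)%N => [h|_].
    by rewrite neq_ltn => /orP[ij|ij]; [|rewrite setIC]; apply: h; rewrite ?lt_eqF.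
  by apply/seteqP; split=> x //= -[[_ nFi] [Fj _]]; apply/nFi/(dF' _ _ ij).
have sD n : \sum_(k < n) m (D k) = m (F 0%N) - m (F n).
  elim: n => [|n IH]; first by rewrite big_ord0 subrr.
  by rewrite big_ord_recr /= IH fm_D//; ring.
have BI : B (\bigcap_n F n) by exact: d_borel_bigcap.
have UD : \bigcup_n D n = F 0%N `\` \bigcap_n F n.
  apply/seteqP; split=> [x [n _ [Fn nFn]]|x [F0 nF]].
    by split; [exact: dF' Fn|move=> /(_ n.+1 I)].
  apply: contrapT => nD; apply: nF => n _; elim: n => // n Fn.
  by apply: contrapT => nFn; apply: nD; exists n.
have := sadd D BD tD; rewrite UD fm_D//; last by move=> x; apply.
move=> /cvgrPdist_lt /(_ e e0) [N _ /(_ N (leqnn N))] /=; rewrite sD => h.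
by exists N; move: h => /ltr_normlP[]; lra.
Qed.

Lemma fm_inc (F : nat -> set T) : (forall n, B (F n)) ->
  (forall n, F n `<=` F n.+1) -> forall e, 0 < e ->
  exists n, m (\bigcup_n F n) < m (F n) + e.
Proof.
move=> BF dF e e0.
have mC A : B A -> m (~` A) = m setT - m A.
  by move=> BA; rewrite -setTD fm_D//; exact: d_borelT.
have [|n|n] := @fm_dec (fun n => ~` F n) _ _ e e0.
- by move=> n; exact: d_borelC.
- by apply: subsetC; exact: dF.
- rewrite -setC_bigcup !mC//; first by exists n; lra.
  exact: d_borel_bigcup.
Qed.

(** Finite unions are null by subadditivity, and [fm_inc] passes to the limit. *)
Lemma fm_null_bigcup (F : nat -> set T) : (forall n, B (F n)) ->
  (forall n, m (F n) = 0) -> m (\bigcup_n F n) = 0.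
Proof.
move=> BF F0; pose G n := [set x | exists2 i : 'I_n, i \in [set: 'I_n]%SET & F i x].
have BG n : B (G n) by exact: d_borel_fin.
have G0 n : m (G n) = 0.
  elim: n => [|n IH].
    rewrite (_ : G 0%N = set0) ?fm0//.
    by apply/seteqP; split=> x //= -[[]].
  apply/eqP; rewrite eq_le fm_ge0// andbT -(addr0 0) -{1}IH -(F0 n).
  rewrite addrC; apply: le_trans (fm_subadd _ _) => //.
  apply: fm_mono => //; first exact: d_borelU.
  move=> x [i _ Fi]; have [ni|] := ltnP i n; last first.
    by move=> ni; left; rewrite (_ : n = i)//; apply/eqP; rewrite eqn_leq ni -ltnS ltn_ord.
  by right; exists (Ordinal ni); rewrite ?finset.in_setT.
have UG : \bigcup_n F n = \bigcup_n G n.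
  apply/seteqP; split=> [x [n _ Fn]|x [n _ [i _ Fi]]]; last by exists i.
  by exists n.+1 => //; exists ord_max; rewrite ?finset.in_setT.
apply/eqP; rewrite eq_le fm_ge0 ?andbT; last exact: d_borel_bigcup.
apply/ler_addgt0Pr => e e0; have [|n] := @fm_inc G BG _ e e0.
  move=> n x [i _ Fi]; exists (widen_ord (leqnSn n) i); by rewrite ?finset.in_setT.
by rewrite UG G0 => /ltW.
Qed.

End Theory.
End FMeas.
End Spaces.

(** * Passing between real-valued and extended measures *)

Section MeasureConversions.
Variable R : realType.

Lemma fm_ext (T : Type) (d : T -> T -> \bar R) (m m' : set T -> R) :
  fmeas d m -> (forall A, d_borel d A -> m' A = m A) -> fmeas d m'.
Proof.
move=> [m0 mp ms] mm; split=> [|A BA|F BF tF].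
- by rewrite mm//; exact: d_borel0.
- by rewrite mm// mp.
- rewrite mm; last exact: d_borel_bigcup.
  rewrite (_ : (fun n => _) = (fun n => \sum_(k < n) m (F k))); first exact: ms.
  by apply/funext => n; apply: eq_bigr => k _; rewrite mm.
Qed.

Lemma is_measure_ext (T : Type) (d : T -> T -> \bar R) (m m' : set T -> \bar R) :
  is_measure d m -> (forall A, d_borel d A -> m' A = m A) -> is_measure d m'.
Proof.
move=> [m0 mp ms] mm; split=> [|A BA|F BF tF].
- by rewrite mm//; exact: d_borel0.
- by rewrite mm// mp.
- rewrite mm; last exact: d_borel_bigcup.
  rewrite (_ : (fun n => _) = (fun n => \sum_(k < n) m (F k))%E); first exact: ms.
  by apply/funext => n; apply: eq_bigr => k _; rewrite mm.
Qed.

Lemma fm_restrict (T : Type) (d : T -> T -> \bar R) (m : set T -> R) C :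
  fmeas d m -> d_borel d C -> fmeas d (fun A => m (A `&` C)).
Proof.
move=> [m0 mp ms] BC; split=> [|A BA|F BF tF].
- by rewrite set0I.
- by apply: mp; exact: d_borelI.
- rewrite setI_bigcupl; apply: ms; first by move=> n; exact: d_borelI.
  exact: trivIset_setIr.
Qed.

Lemma fm_lincomb (T : Type) (d : T -> T -> \bar R) (I : finType) (c : I -> R)
    (m : I -> set T -> R) : (forall i, 0 <= c i) -> (forall i, fmeas d (m i)) ->
  fmeas d (fun A => \sum_i c i * m i A).
Proof.
move=> c0 fm; split=> [|A BA|F BF tF].
- by rewrite big1// => i _; rewrite (fm0 (fm i)) mulr0.
- by apply: sumr_ge0 => i _; rewrite mulr_ge0// (fm_ge0 (fm i)).
- rewrite (_ : (fun n => _) = (fun n => \sum_i c i * \sum_(k < n) m i (F k))).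
    apply: cvg_big => [|i _]; first exact: add_continuous.
    by apply: cvgM; [exact: cvg_cst|case: (fm i) => _ _; apply].
  by apply/funext => n; rewrite exchange_big /=; apply: eq_bigr => i _; rewrite mulr_sumr.
Qed.

Lemma fm_preimage (T T' : Type) (d : T -> T -> \bar R) (d' : T' -> T' -> \bar R)
    (f : T -> T') (m : set T -> R) :
  (forall A, d_borel d' A -> d_borel d (f @^-1` A)) ->
  fmeas d m -> fmeas d' (fun A => m (f @^-1` A)).
Proof.
move=> Bf [m0 mp ms]; split=> [|A BA|F BF tF].
- by rewrite preimage_set0.
- by apply: mp; exact: Bf.
- rewrite preimage_bigcup; apply: ms; first by move=> n; exact: Bf.
  apply/trivIsetP => i j _ _ ij; rewrite -preimage_setI.
  by move/trivIsetP: tF => ->//; rewrite preimage_set0.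
Qed.

Section Ereal.
Variables (T : Type) (d : T -> T -> \bar R).
Local Notation B := (d_borel d).

Lemma measure_of_fm (m : set T -> R) : fmeas d m -> is_measure d (fun A => (m A)%:E).
Proof.
move=> [m0 mp ms]; split=> [|A BA|F BF tF].
- by rewrite m0.
- by rewrite lee_fin mp.
- rewrite (_ : (fun n => _) = EFin \o (fun n => \sum_(k < n) m (F k))).
    by apply/cvg_EFin; [exact: nearW|exact: ms].
  by apply/funext => n; rewrite /= sumEFin.
Qed.

Lemma measure_add (m : set T -> \bar R) A A' : is_measure d m -> B A -> B A' ->
  A `&` A' = set0 -> m (A `|` A') = (m A + m A')%E.
Proof.
move=> [m0 mp sadd] BA BA' AA'.
have c1 : ((fun n => \sum_(k < n) m (bigcup2 A A' k))%E @ \oo --> m (A `|` A')).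
  rewrite -bigcup2E; apply: sadd; last by rewrite -trivIset_bigcup2.
  by move=> [|[|n]]//=; exact: d_borel0.
have c2 : ((fun n => \sum_(k < n) m (bigcup2 A A' k))%E @ \oo --> (m A + m A')%E).
  apply: cvg_near_cst; exists 2%N => // n /= n2; rewrite -(subnKC n2).
  by rewrite big_split_ord /= !big_ord_recl big_ord0 /= adde0 big1 ?adde0.
exact: (cvg_unique _ c1 c2).
Qed.

Lemma measure_mono (m : set T -> \bar R) A A' : is_measure d m -> B A -> B A' ->
  A `<=` A' -> (m A <= m A')%E.
Proof.
move=> mm BA BA' AA'; rewrite -(setDUK AA') measure_add//.
- by rewrite leeDl//; case: mm => _ + _; apply; exact: d_borelD.
- exact: d_borelD.
- by rewrite setDIK.
Qed.

Lemma fm_of_measure (m : set T -> \bar R) C : is_measure d m -> B C ->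
  (m C < +oo)%E -> fmeas d (fun A => fine (m (A `&` C))).
Proof.
move=> mm BC mC; have [m0 mp sadd] := mm.
have mfin A : B A -> m (A `&` C) \is a fin_num.
  move=> BA; have BAC : B (A `&` C) by exact: d_borelI.
  rewrite ge0_fin_numE ?mp//; apply: le_lt_trans mC.
  by apply: measure_mono => //; exact: subIsetr.
split=> [|A BA|F BF tF].
- by rewrite set0I m0.
- by rewrite fine_ge0// mp//; exact: d_borelI.
- have -> : (fun n => \sum_(k < n) fine (m (F k `&` C))) =
      fine \o (fun n => \sum_(k < n) m (F k `&` C))%E.
    apply/funext => n /=; rewrite -sum_fine//; first by move=> i _; exact: mfin.
  apply: fine_cvg; rewrite fineK; last by apply: mfin; exact: d_borel_bigcup.
  rewrite setI_bigcupl; apply: sadd; first by move=> n; exact: d_borelI.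
  exact: trivIset_setIr.
Qed.

Lemma fine_measure_EFin (m : set T -> \bar R) A : is_measure d m -> B A ->
  (m A < +oo)%E -> m A = (fine (m A))%:E.
Proof. by move=> [_ mp _] BA mA; rewrite fineK// ge0_fin_numE ?mp. Qed.

Lemma fm_of_finite_measure (m : set T -> \bar R) : is_measure d m ->
  (m setT < +oo)%E -> fmeas d (fun A => fine (m A)).
Proof.
move=> mm mT; apply: fm_ext (fm_of_measure mm _ mT) _; first exact: d_borelT.
by move=> A _; rewrite setIT.
Qed.

End Ereal.
End MeasureConversions.

(** * Compactness in pseudometric terms *)

Section Compact.
Variable R : realType.

Lemma edist_pseudo (T : Type) (d : T -> T -> R) : is_metric d -> pseudo (edist d).
Proof.
move=> [d0 dE dC dD]; split=> [x e e0|x y|x y z a b].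
- by rewrite lte_fin (_ : d x x = 0)//; apply/dE.
- by rewrite /edist dC.
- rewrite /edist !lte_fin => xy yz; apply: le_lt_trans (dD _ y _) _; exact: ltrD.
Qed.

Lemma closed_cball (T : Type) (d : T -> T -> R) x r : is_metric d ->
  d_closed (edist d) (cball d x r).
Proof.
move=> [_ _ dC dT] y /negP; rewrite -ltNge => ry.
exists (d x y - r); split=> [|z]; first by rewrite subr_gt0.
rewrite lte_fin /cball /= => yz; apply/negP; rewrite -ltNge.
by have := dT x z y; rewrite (dC z y); lra.
Qed.

Lemma In_finite_range (T : Type) (s : list T) :
  exists n (c : 'I_n -> T), (forall x, List.In x s -> exists i, c i = x) /\
    forall i, List.In (c i) s.
Proof.
elim: s => [|a s [n [c [cs sc]]]].
  have c : 'I_0 -> T by case.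
  by exists 0%N, c; split=> // -[].
exists n.+1, (fun i => if unlift ord0 i is Some j then c j else a); split.
  move=> x [<-|/cs[i <-]]; first by exists ord0; rewrite unlift_none.
  by exists (lift ord0 i); rewrite liftK.
by move=> i; case: unliftP => [j _|_]; [right|left].
Qed.

Section Pseudo.
Variables (T : Type) (d : T -> T -> \bar R).
Hypothesis pd : pseudo d.

Lemma d_compact_finite (K : set T) (I : Type) (U : I -> set T) : d_compact d K ->
  (forall i, d_open d (U i)) -> (forall x, K x -> exists i, U i x) ->
  exists n (c : 'I_n -> I), forall x, K x -> exists k, U (c k) x.
Proof.
move=> cK oU KU; have [|s sK] := cK I U oU.
  by move=> x /KU[i Ui]; exists i.
have [n [c [cs _]]] := In_finite_range s.
by exists n, c => x /sK[i [/cs[k <-] Ui]]; exists k.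
Qed.

Lemma d_compact_net (K : set T) (e : R) : d_compact d K -> 0 < e ->
  exists n (c : 'I_n -> T), forall x, K x -> exists k, (d (c k) x < e%:E)%E.
Proof.
move=> cK e0.
have [c x|x _|n [c cP]] := @d_compact_finite K T (fun c => [set x | (d x c < e%:E)%E]) cK.
- move=> xc; have [b be xb] := lte_EFin_between xc.
  exists (e - b); split; first by lra.
  move=> y xy; have -> : e = (e - b) + b by lra.
  by apply: (pseudo_trans pd) xb; rewrite (pseudo_sym pd).
- by exists x; exact: (pseudoxx pd).
- by exists n, c => x /cP[k xk]; exists k; rewrite (pseudo_sym pd).
Qed.

(** A Lebesgue number argument: finitely many neighbourhoods, each with its own scale, cover [K],
    and monotonicity of [Q] allows the minimum of the scales. *)
Lemma d_compact_uniform (K : set T) (Q : R -> T -> Prop) : d_compact d K ->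
  (forall e e' x, e' <= e -> Q e x -> Q e' x) ->
  (forall x, K x -> exists e, 0 < e /\ forall y, (d x y < e%:E)%E -> Q e y) ->
  exists e, 0 < e /\ forall x, K x -> Q e x.
Proof.
move=> cK Qm QK.
pose J := {p : T * R | 0 < p.2 /\ forall y, (d p.1 y < p.2%:E)%E -> Q p.2 y}.
pose U (p : J) := [set y | exists a, [set (sval p).1] a /\ (d y a < (sval p).2%:E)%E].
have [p|x /QK[e eQ]|n [c cP]] := @d_compact_finite K J U cK.
- exact: (d_open_thick pd).
- exists (exist _ (x, e) eQ), x; split=> //=; apply: (pseudoxx pd); by case: eQ.
- exists (\big[Num.min/1]_(k < n) (sval (c k)).2); split.
    by apply: lt_bigmin => // k _; case: (svalP (c k)).
  move=> x /cP[k [_ [-> xk]]].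
  apply: Qm (proj2 (svalP (c k)) x _); first exact: bigmin_le.
  by rewrite (pseudo_sym pd).
Qed.

(** Pigeonhole: of [n.+1] points, two fall into the same of [n] balls of radius [e / 2]. *)
Lemma d_compact_no_separated (K : set T) (e : R) (x : nat -> T) : d_compact d K ->
  0 < e -> (forall n, K (x n)) ->
  (forall i j, i != j -> (e%:E <= d (x i) (x j))%E) -> False.
Proof.
move=> cK e0 xK xs; have e2 : 0 < e / 2 by lra.
have [n [c cP]] := d_compact_net cK e2.
have [f fP] := choice (fun i => cP _ (xK i)).
have /injectivePn[i [j ij fij]] : ~~ injectiveb (fun i : 'I_n.+1 => f i).
  apply/negP => /injectiveP /leq_card; by rewrite !card_ord ltnn.
have := xs i j ij; rewrite leNgt => /negP; apply.
have -> : e = e / 2 + e / 2 by lra.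
apply: (pseudo_trans pd) (fP j); rewrite (pseudo_sym pd) -fij; exact: fP.
Qed.

Lemma d_compact_closedI (K A : set T) : d_compact d K -> d_closed d A ->
  d_compact d (A `&` K).
Proof.
move=> cK cA I U oU KU.
have [] := cK (option I) (fun i => if i is Some i then U i else ~` A).
- by case.
- move=> x Kx; have [Ax|nAx] := pselect (A x); last by exists None.
  by have [i _ Ui] := KU x (conj Ax Kx); exists (Some i).
- move=> s sP; exists (List.flat_map (fun i => if i is Some i then [:: i] else [::]) s).
  move=> x [Ax /sP[[i|] [ins Ui]]] //; exists i; split=> //.
  by apply/List.in_flat_map; exists (Some i); split=> //; left.
Qed.

End Pseudo.

Lemma d_compact_isometric (T T' : Type) (d : T -> T -> \bar R) (d' : T' -> T' -> \bar R)
    (f : T -> T') (S : set T') : pseudo d -> pseudo d' ->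
  (forall x y, d' (f x) (f y) = d x y) -> (forall x, S (f x)) ->
  (forall y, S y -> exists x, f x = y) ->
  d_compact d' S <-> d_compact d setT.
Proof.
move=> pd pd' fd fS Sf; split=> cS I U oU KU.
(* Open sets of [T] are extended to [T'] by balls of the same radii around the images; as [f] is
   isometric, this adds no point of the image. *)
- pose V i := [set y | exists x e, [/\ 0 < e, forall z, (d x z < e%:E)%E -> U i z &
    (d' y (f x) < e%:E)%E]].
  have [i|y /Sf[x <-]|s sP] := cS I V.
  + move=> y [x [e [e0 eU yx]]]; have [b be yb] := lte_EFin_between yx.
    exists (e - b); split; first by lra.
    move=> z yz; exists x, e; split=> //.
    have -> : e = (e - b) + b by lra.
    by apply: (pseudo_trans pd') yb; rewrite (pseudo_sym pd').
  + have [i _ Uix] := KU x Logic.I; have [e [e0 eU]] := oU i x Uix.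
    by exists i => //; exists x, e; split=> //; rewrite fd; exact: (pseudoxx pd).
  + exists s => x _; have [i [ins [z [e [e0 eU xz]]]]] := sP _ (fS x).
    by exists i; split=> //; apply: eU; rewrite (pseudo_sym pd) -fd.
- have [i x Ui|x _|s sP] := cS I (fun i => f @^-1` U i).
  + have [e [e0 eU]] := oU i _ Ui; exists e; split=> // y xy.
    by apply: eU; rewrite fd.
  + by have [i _ Ui] := KU (f x) (fS x); exists i.
  + by exists s => y /Sf[x <-]; exact: sP.
Qed.

End Compact.

(** * Cross metrics and closeness *)

Section AmbientSpaces.
Variable R : realType.

(* A compact pmm space embedded in a metric space: [supp] is its image and [mass] its
   measure pushed forward to the ambient space, made real-valued. *)
Record ambient := Ambient {
  car : Type;
  dist : car -> car -> R;
  org : car;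
  supp : set car;
  mass : set car -> R }.

Definition org_ball (X : ambient) (r : R) : set (car X) := [set x | dist (org X) x <= r].

Definition good (X : ambient) := [/\ is_metric (@dist X),
  fmeas (edist (@dist X)) (@mass X), @supp X (org X),
  d_compact (edist (@dist X)) (@supp X) &
  forall A, d_borel (edist (@dist X)) A -> A `&` @supp X = set0 -> mass A = 0].

Section Cross.
Variables (E F : Type) (dE : E -> E -> R) (dF : F -> F -> R).

(* Such a [w] is the restriction to E x F of a pseudometric on the disjoint union. *)
Definition cross (w : E -> F -> R) := [/\ forall x x' y, w x y <= dE x x' + w x' y,
  forall x y y', w x y <= w x y' + dF y' y,
  forall x x' y, dE x x' <= w x y + w x' y &
  forall x y y', dF y y' <= w x y + w x y'].

(** The closed [c]-neighbourhood of [A] across [w]; the slack [del] makes it closed although the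
    infimum of [w] over [A] may not be attained. *)
Definition thick (w : E -> F -> R) (A : set E) (c : R) : set F :=
  [set y | forall del, 0 < del -> exists a, A a /\ w a y < c + del].

End Cross.

Definition flip (E F : Type) (w : E -> F -> R) := fun y x => w x y.

Lemma cross_flip (E F : Type) (dE : E -> E -> R) (dF : F -> F -> R) w :
  is_metric dE -> is_metric dF -> cross dE dF w -> cross dF dE (flip w).
Proof.
move=> [_ _ dEC _] [_ _ dFC _] [w1 w2 w3 w4]; split; rewrite /flip => x y z.
- by rewrite addrC dFC; exact: w2.
- by rewrite addrC dEC; exact: w1.
- exact: w4.
- exact: w3.
Qed.

Lemma cross_ge0 (E F : Type) (dE : E -> E -> R) (dF : F -> F -> R) w x y :
  is_metric dE -> cross dE dF w -> 0 <= w x y.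
Proof.
move=> [d0 _ _ _] [_ _ w3 _].
by have := w3 x x y; have := d0 x x; lra.
Qed.

(** The base point, Hausdorff and Prokhorov conditions in one direction; the other direction is the
    same for [flip w], so most arguments are made once. *)
Definition half_close (c : R) (X Y : ambient) (w : car X -> car Y -> R) :=
  [/\ w (org X) (org Y) < c,
   forall x, @supp X x -> exists y, @supp Y y /\ w x y < c &
   forall A, d_closed (edist (@dist X)) A -> mass A <= mass (thick w A c) + c].

Definition ghp_close (c : R) (X Y : ambient) (w : car X -> car Y -> R) :=
  [/\ cross (@dist X) (@dist Y) w, half_close c w & half_close c (flip w)].

Lemma closed_thick (E F : Type) (dE : E -> E -> R) (dF : F -> F -> R) w A c :
  is_metric dF -> cross dE dF w -> d_closed (edist dF) (thick w A c).
Proof.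
move=> [_ _ dFC _] [_ w2 _ _] y /existsNP[del /not_implyP[del0 yA]].
exists (del / 2); split; first by lra.
move=> z; rewrite lte_fin => yz; apply/existsNP; exists (del / 2).
apply/not_implyP; split; first by lra.
move=> [a [Aa az]]; apply: yA; exists a; split=> //.
by have := w2 a y z; rewrite dFC; lra.
Qed.

Lemma borel_thick (E F : Type) (dE : E -> E -> R) (dF : F -> F -> R) w A c :
  is_metric dF -> cross dE dF w -> d_borel (edist dF) (thick w A c).
Proof. by move=> dM cw; apply: d_borel_closed; exact: closed_thick cw. Qed.

Lemma ghp_close_flip c (X Y : ambient) (w : car X -> car Y -> R) : good X -> good Y ->
  ghp_close c w -> ghp_close c (flip w).
Proof.
move=> [dX _ _ _ _] [dY _ _ _ _] [cw h1 h2]; split=> //.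
exact: cross_flip.
Qed.

Section Inf.
Variables (T : Type) (f : T -> R) (t0 : T).
Hypothesis f0 : forall t, 0 <= f t.

Let has_inf_range : has_inf (range f).
Proof.
split; first by exists (f t0), t0.
by exists 0 => _ [t _ <-].
Qed.

Lemma inf_range_le t : inf (range f) <= f t.
Proof. by apply: ge_inf; [case: has_inf_range|exists t]. Qed.

Lemma le_inf_range b : (forall t, b <= f t) -> b <= inf (range f).
Proof.
by move=> h; apply: lb_le_inf; [case: has_inf_range|move=> _ [t _ <-]].
Qed.

End Inf.

(** Gluing along the middle space: the infimal length of a path from [x] to [z] through one of its
    points. *)
Definition cross_comp (E F G : Type) (w1 : E -> F -> R) (w2 : F -> G -> R) x z :=
  inf (range (fun y => w1 x y + w2 y z)).

Lemma flip_cross_comp (E F G : Type) (w1 : E -> F -> R) (w2 : F -> G -> R) :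
  flip (cross_comp w1 w2) = cross_comp (flip w2) (flip w1).
Proof.
apply/funext => z; apply/funext => x; rewrite /flip /cross_comp.
rewrite (_ : (fun y => w1 x y + _) = (fun y => w2 y z + w1 x y))//.
by apply/funext => y; rewrite addrC.
Qed.

Section Compose.
Variables (X Y Z : ambient) (w1 : car X -> car Y -> R) (w2 : car Y -> car Z -> R).
Hypotheses (gX : good X) (gY : good Y) (gZ : good Z).
Hypotheses (cw1 : cross (@dist X) (@dist Y) w1) (cw2 : cross (@dist Y) (@dist Z) w2).

Let w10 x y : 0 <= w1 x y.
Proof. by have [dX _ _ _ _] := gX; exact: cross_ge0 cw1. Qed.

Let w20 y z : 0 <= w2 y z.
Proof. by have [dY _ _ _ _] := gY; exact: cross_ge0 cw2. Qed.

Let w120 x z y : 0 <= w1 x y + w2 y z.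
Proof. exact: addr_ge0. Qed.

Lemma cross_comp_le x y z : cross_comp w1 w2 x z <= w1 x y + w2 y z.
Proof. exact: (@inf_range_le _ (fun y => w1 x y + w2 y z)). Qed.

Lemma cross_cross_comp : cross (@dist X) (@dist Z) (cross_comp w1 w2).
Proof.
have [a1 a2 a3 a4] := cw1; have [b1 b2 b3 b4] := cw2.
have [[_ _ dYC _] _ _ _ _] := gY.
split.
- move=> x x' z; rewrite -lerBlDl; apply: (le_inf_range (org Y)) => [y|y]; first exact: w120.
  by have := cross_comp_le x y z; have := a1 x x' y; lra.
- move=> x z z'; rewrite -lerBlDr; apply: (le_inf_range (org Y)) => [y|y]; first exact: w120.
  by have := cross_comp_le x y z; have := b2 y z z'; lra.
- move=> x x' z; rewrite -lerBlDr; apply: (le_inf_range (org Y)) => [y|y]; first exact: w120.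
  rewrite lerBlDr -lerBlDl; apply: (le_inf_range (org Y)) => [y'|y']; first exact: w120.
  by have := a3 x x' y; have := a2 x' y y'; have := b3 y' y z; lra.
- move=> x z z'; rewrite -lerBlDr; apply: (le_inf_range (org Y)) => [y|y]; first exact: w120.
  rewrite lerBlDr -lerBlDl; apply: (le_inf_range (org Y)) => [y'|y']; first exact: w120.
  by have := b4 y z z'; have := b1 y y' z'; have := a4 x y y'; lra.
Qed.

(** A [c2]-neighbourhood of a [c1]-neighbourhood lies in the [c1 + c2]-neighbourhood, and the inner
    one is closed, so the two mass conditions can be chained. *)
Lemma half_close_comp c1 c2 : half_close c1 w1 -> half_close c2 w2 ->
  half_close (c1 + c2) (cross_comp w1 w2).
Proof.
move=> [o1 s1 m1] [o2 s2 m2]; split=> [|x /s1[y [/s2[z [Sz yz]] xy]]|A cA].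
- by apply: le_lt_trans (cross_comp_le _ (org Y) _) _; exact: ltrD.
- by exists z; split=> //; apply: le_lt_trans (cross_comp_le _ y _) _; exact: ltrD.
- have [dY _ _ _ _] := gY; have [dZ mZ _ _ _] := gZ.
  have h1 := m1 A cA; have h2 := m2 _ (@closed_thick _ _ _ _ w1 A c1 dY cw1).
  suff h3 : mass (thick w2 (thick w1 A c1) c2) <= mass (thick (cross_comp w1 w2) A (c1 + c2)).
    by apply: (le_trans h1); move: h2 h3; lra.
  apply: (fm_mono mZ).
  + exact: borel_thick cw2.
  + exact: borel_thick cross_cross_comp.
  + move=> z zA del del0; have del2 : 0 < del / 2 by lra.
    have [y [yA yz]] := zA _ del2; have [a [Aa ay]] := yA _ del2.
    by exists a; split=> //; have := cross_comp_le a y z; lra.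
Qed.

End Compose.

Lemma ghp_close_comp (X Y Z : ambient) c1 c2 (w1 : car X -> car Y -> R)
    (w2 : car Y -> car Z -> R) : good X -> good Y -> good Z ->
  ghp_close c1 w1 -> ghp_close c2 w2 -> ghp_close (c1 + c2) (cross_comp w1 w2).
Proof.
move=> gX gY gZ [cw1 h1 h1'] [cw2 h2 h2'].
have [dX _ _ _ _] := gX; have [dY _ _ _ _] := gY; have [dZ _ _ _ _] := gZ.
split; [exact: cross_cross_comp|exact: half_close_comp|].
by rewrite flip_cross_comp addrC; apply: half_close_comp => //; exact: cross_flip.
Qed.

Lemma cross_dist (E : Type) (d : E -> E -> R) : is_metric d -> cross d d d.
Proof.
move=> [_ _ dC dT]; split=> x y z; [exact: dT|exact: dT|..].
- by rewrite (dC y z); exact: dT.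
- by rewrite (dC x y); exact: dT.
Qed.

(** Subspaces of one metric space are compared through its own metric; a set lies in its
    neighbourhood, so it suffices to compare masses on the set itself. *)
Lemma ghp_close_same (E : Type) (d : E -> E -> R) o S1 S2 m1 m2 c :
  good (Ambient d o S1 m1) -> good (Ambient d o S2 m2) -> 0 < c ->
  (forall x, S1 x -> exists y, S2 y /\ d x y < c) ->
  (forall x, S2 x -> exists y, S1 y /\ d x y < c) ->
  (forall A, d_closed (edist d) A -> m1 A <= m2 A + c) ->
  (forall A, d_closed (edist d) A -> m2 A <= m1 A + c) ->
  @ghp_close c (Ambient d o S1 m1) (Ambient d o S2 m2) d.
Proof.
move=> [+ mm1 _ _ _] [_ mm2 _ _ _] c0 h12 h21 k12 k21; rewrite /= => dM.
have [d0 dE dC dT] := dM.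
have d00 x : d x x = 0 by apply/dE.
have cd := cross_dist dM; have cd' := cross_flip dM dM cd.
have sub A : A `<=` thick d A c.
  by move=> a Aa del del0; exists a; split=> //; rewrite d00; lra.
have sub' A : A `<=` thick (flip d) A c.
  by move=> a Aa del del0; exists a; split=> //; rewrite /flip d00; lra.
split=> //; split=> /=.
- by rewrite d00.
- exact: h12.
- move=> A cA; apply: le_trans (k12 A cA) _; rewrite lerD2r.
  by apply: (fm_mono mm2) => //; [exact: d_borel_closed|exact: borel_thick cd].
- by rewrite /flip /= d00.
- by move=> x /h21[y [Sy xy]]; exists y; split=> //; rewrite /flip /= dC.
- move=> A cA; apply: le_trans (k21 A cA) _; rewrite lerD2r.
  by apply: (fm_mono mm1) => //; [exact: d_borel_closed|exact: borel_thick cd'].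
Qed.

End AmbientSpaces.
Arguments org_ball {R} X r _.

(** * Carrying subspaces between close compact spaces *)

Section SubTransport.
Variable R : realType.

Lemma d_compact_closed (T : Type) (d : T -> T -> R) (K : set T) : is_metric d ->
  d_compact (edist d) K -> d_closed (edist d) K.
Proof.
move=> dM cK x nKx; have [d0 dE dC dT] := dM.
have [e e' y ee' /=|y Ky|e [e0 eP]] :=
    d_compact_uniform (edist_pseudo dM) (Q := fun e y => e <= d x y) cK.
- exact: le_trans.
- have dxy : 0 < d x y.
    by rewrite lt_neqAle d0 andbT eq_sym; apply/eqP => /dE xy; apply: nKx; rewrite xy.
  exists (d x y / 2); split; first by lra.
  by move=> z; rewrite lte_fin => yz; have := dT x z y; rewrite (dC z y); lra.
- exists e; split=> // y; rewrite lte_fin => xy Ky.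
  by have := eP _ Ky; rewrite leNgt xy.
Qed.

Lemma good_closed (X : ambient R) : good X -> d_closed (edist (@dist _ X)) (@supp _ X).
Proof. by move=> [dM _ _ cS _]; exact: d_compact_closed. Qed.

Lemma borel_supp (X : ambient R) : good X -> d_borel (edist (@dist _ X)) (@supp _ X).
Proof. by move=> gX; apply: d_borel_closed; exact: good_closed. Qed.

Lemma mass_supp (X : ambient R) A : good X -> d_borel (edist (@dist _ X)) A ->
  mass (A `&` @supp _ X) = mass A.
Proof.
move=> gX BA; have [dM mX _ cS conc] := gX.
have BS := borel_supp gX.
have BAS : d_borel (edist (@dist _ X)) (A `&` @supp _ X) by exact: d_borelI.
have BAD : d_borel (edist (@dist _ X)) (A `\` @supp _ X) by exact: d_borelD.
have AE : A = (A `&` @supp _ X) `|` (A `\` @supp _ X).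
  by rewrite setDE -setIUr setUCr setIT.
have D0 : mass (A `\` @supp _ X) = 0.
  by apply: conc => //; apply/seteqP; split=> x // -[[]].
rewrite [in RHS]AE (fm_add mX)// ?D0 ?addr0//.
by apply/seteqP; split=> x // -[[_ Sx] [_]].
Qed.

(** The balls of a finite net, each without those of smaller index. *)
Lemma small_partition (X : ambient R) (e : R) : good X -> 0 < e ->
  exists n (P : 'I_n -> set (car X)), [/\
    forall i, d_borel (edist (@dist _ X)) (P i),
    forall i j x, P i x -> P j x -> i = j,
    forall x, @supp _ X x <-> exists i, P i x &
    forall i x y, P i x -> P i y -> dist x y < e].
Proof.
move=> gX e0; have [dM mX _ cS _] := gX; have [_ _ dC dT] := dM.
have pd := edist_pseudo dM; have e2 : 0 < e / 2 by lra.
have [n [c cP]] := d_compact_net pd cS e2.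
pose U (i : 'I_n) := [set x | dist (c i) x < e / 2].
have BU i : d_borel (edist (@dist _ X)) (U i).
  have := @d_open_thick _ _ _ pd [set c i] (e / 2).
  rewrite (_ : [set _ | _] = U i); first exact: d_borel_open.
  apply/seteqP; split=> x /=; first by move=> [_ [->]]; rewrite lte_fin dC.
  by move=> Ux; exists (c i); split=> //; rewrite lte_fin dC.
pose V (i : 'I_n) := [set x | exists2 j, j \in [set j : 'I_n | (j < i)%N]%SET & U j x].
have BV i : d_borel (edist (@dist _ X)) (V i) by exact: d_borel_fin.
pose P (i : 'I_n) := (@supp _ X `&` U i) `\` V i.
exists n, P; split.
- move=> i; apply: d_borelD => //; apply: d_borelI => //.
  exact: borel_supp.
- have h (i j : 'I_n) x : (i < j)%N -> P i x -> ~ P j x.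
    by move=> ij [[_ Ui] _] [_ nV]; apply: nV; exists i; rewrite ?finset.inE.
  move=> i j x Pi Pj; apply/val_inj; case: (ltngtP i j) => // ij.
    by case: (h _ _ _ ij Pi).
  by case: (h _ _ _ ij Pj).
- move=> x; split=> [Sx|[i [[]]]//].
  have [k0 k0x] := cP _ Sx.
  have ex : exists k, [exists i : 'I_n, (i == k :> nat) && `[< U i x >]].
    by exists k0; apply/existsP; exists k0; rewrite eqxx; apply/asboolP.
  have := ex_minnP ex => -[m /existsP[i /andP[/eqP im /asboolP Ui]] mmin].
  exists i; split=> // -[j]; rewrite finset.inE => ji Uj.
  have : (m <= j)%N.
    by apply: mmin; apply/existsP; exists j; rewrite eqxx; apply/asboolP.
  by rewrite -im leqNgt ji.
- move=> i x y [[_ Ux] _] [[_ Uy] _]; have := dT x (c i) y.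
  by rewrite (dC x (c i)); move: Ux Uy; rewrite /U /=; lra.
Qed.

(** The mass condition speaks of closed sets, so it is applied to the closure of a union of pieces.
    A point of the thickened closure is within [c + eta] of a piece: half of [eta] is spent on the
    closure, half on the slack of [thick]. Hence [r] must relate all pieces that close. *)
Lemma half_close_hall (X Y : ambient R) (w : car X -> car Y -> R) (c eta : R)
    (I J : finType) (P : I -> set (car X)) (Q : J -> set (car Y)) (r : I -> J -> bool) :
  good X -> good Y -> cross (@dist _ X) (@dist _ Y) w -> half_close c w -> 0 < eta ->
  (forall i, d_borel (edist (@dist _ X)) (P i)) ->
  (forall i j x, P i x -> P j x -> i = j) ->
  (forall j, d_borel (edist (@dist _ Y)) (Q j)) ->
  (forall i j x, Q i x -> Q j x -> i = j) ->
  (forall y, @supp _ Y y <-> exists j, Q j y) ->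
  (forall i j x y, P i x -> Q j y -> w x y < c + eta -> r i j) ->
  forall S : {set I},
    \sum_(i in S) mass (P i) <= \sum_(j in nbrs r S) mass (Q j) + c.
Proof.
move=> gX gY cw [_ _ hm] eta0 BP tP BQ tQ cQ rP S.
have [dX mX _ _ _] := gX; have [dY mY _ _ _] := gY; have [_ _ dXC _] := dX.
have pX := edist_pseudo dX.
rewrite -(fm_bigcup_fin mX)// -(fm_bigcup_fin mY)//.
set U := [set x | _]; pose C := d_closure (edist (@dist _ X)) U.
have cC : d_closed (edist (@dist _ X)) C by exact: d_closed_closure.
have BU : d_borel (edist (@dist _ X)) U by exact: d_borel_fin.
apply: (le_trans (fm_mono mX BU (d_borel_closed cC) (sub_d_closure pX (A := U)))).
apply: (le_trans (hm _ cC)); rewrite lerD2r.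
have BtC : d_borel (edist (@dist _ Y)) (thick w C c) by exact: borel_thick cw.
rewrite -(mass_supp gY)//; apply: (fm_mono mY); last first.
- move=> y [yC /cQ[j Qj]]; exists j => //; apply/nbrsP.
  have eta2 : 0 < eta / 2 by lra.
  have [a [Ca ay]] := yC _ eta2; have [u [[i iS Pi]]] := Ca _ eta2.
  rewrite lte_fin => au; exists i => //; apply: rP Pi Qj _.
  by have [w1 _ _ _] := cw; have := w1 u a y; rewrite dXC; lra.
- exact: d_borel_fin.
- by apply: d_borelI => //; exact: borel_supp.
Qed.

Definition ambsub (X : ambient R) (S : set (car X)) (n : set (car X) -> R) :=
  Ambient (@dist _ X) (org X) S n.

(* Both supports are cut into finitely many small pieces and [n] is transported by
   [sub_transport]; the new measure has a constant density with respect to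
   [mass Y] on each piece, equal to 1 on the pieces meeting the smaller ball. *)
Lemma ghp_close_sub (X Y : ambient R) (w : car X -> car Y -> R) (c c' : R)
    (S0 : set (car X)) (n : set (car X) -> R) :
  good X -> good Y -> ghp_close c w -> c < c' ->
  good (ambsub S0 n) -> S0 `<=` @supp _ X ->
  (forall A, d_borel (edist (@dist _ X)) A -> n A <= mass A) ->
  exists (S1 : set (car Y)) (n1 : set (car Y) -> R), [/\
    good (ambsub S1 n1),
    S1 `<=` @supp _ Y /\ (forall A, d_borel (edist (@dist _ Y)) A -> n1 A <= mass A),
    @ghp_close _ c' (ambsub S0 n) (ambsub S1 n1) w &
    forall rho, org_ball X rho `&` @supp _ X `<=` S0 ->
      (forall A, d_borel (edist (@dist _ X)) A -> mass (A `&` org_ball X rho) <= n A) ->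
      org_ball Y (rho - 2 * c') `&` @supp _ Y `<=` S1 /\
      (forall A, d_borel (edist (@dist _ Y)) A ->
         mass (A `&` org_ball Y (rho - 2 * c')) <= n1 A)].
Proof.
move=> gX gY [cw h1 h2] cc' g0 S0S nm.
have [dX mX oX _ _] := gX; have [dY mY oY cY _] := gY; have [_ mn o0 _ _] := g0.
rewrite /= in mn o0.
have [dX0 dXE dXC dXT] := dX; have [dY0 dYE dYC dYT] := dY.
have cw' := cross_flip dX dY cw; have [w1 w2 w3 w4] := cw.
have w0 x y : 0 <= w x y by exact: cross_ge0 cw.
have [oo s1 k1] := h1; have [_ s2 k2] := h2.
have c0 : 0 <= c by apply: le_trans (ltW oo).
(* Related pieces contain points at distance below [c + eta] and have diameter at most [eta], so all
   their points are within [c + 3 * eta]; the factor 8 leaves room for the slacks of [thick]. *)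
pose eta := (c' - c) / 8; have eta0 : 0 < eta by rewrite /eta; lra.
have c'E : c' = c + 8 * eta by rewrite /eta; field.
have [p [P [BP tP cP sP]]] := small_partition gX eta0.
have [q [Q [BQ tQ cQ sQ]]] := small_partition gY eta0.
pose r i j := `[< exists x y, [/\ P i x, Q j y & w x y < c + eta] >].
have rP i j x y : P i x -> Q j y -> w x y < c + eta -> r i j.
  by move=> Pi Qj xy; apply/asboolP; exists x, y.
have rlt i j x y : r i j -> P i x -> Q j y -> w x y < c + 3 * eta.
  move=> /asboolP[x' [y' [Px' Qy' xy']]] Px Qy.
  have := w1 x x' y; have := w2 x' y y'.
  by have := sP _ _ _ Px Px'; have := sQ _ _ _ Qy' Qy; lra.
have hall1 := half_close_hall gX gY cw h1 eta0 BP tP BQ tQ cQ rP.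
have hall2 := half_close_hall gY gX cw' h2 eta0 BQ tQ BP tP cP
  (fun j i y x Qy Px => rP i j x y Px Qy).
have nmu i : 0 <= n (P i) <= mass (P i) by rewrite (fm_ge0 mn)// nm.
have nu0 j : 0 <= mass (Q j) by rewrite (fm_ge0 mY).
have [k [k01 kn kn' k1E]] := sub_transport nu0 c0 nmu hall1 hall2.
have kge0 j : 0 <= k j by case/andP: (k01 j).
have kle1 j : k j <= 1 by case/andP: (k01 j).
(* Only points near [S0] are kept, for the Hausdorff condition; every piece related to a piece that
   meets [S0] is kept entirely. *)
pose S1 := thick w S0 (c + 3 * eta) `&` @supp _ Y.
have cS1 : d_closed (edist (@dist _ Y)) S1.
  by apply: d_closedI; [exact: closed_thick cw|exact: good_closed].
have BS1 : d_borel (edist (@dist _ Y)) S1 by exact: d_borel_closed.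
have BQS j : d_borel (edist (@dist _ Y)) (Q j `&` S1) by exact: d_borelI.
pose n1 A := \sum_j k j * mass (A `&` (Q j `&` S1)).
have mn1 : fmeas (edist (@dist _ Y)) n1.
  by apply: fm_lincomb => // j; exact: (fm_restrict mY).
have g1 : good (ambsub S1 n1).
  split=> //=; first split=> //.
  - by move=> del del0; exists (org X); split=> //; lra.
  - apply: (d_compact_closedI cY); exact: closed_thick cw.
  - move=> A BA AS; apply: big1 => j _.
    rewrite (_ : A `&` _ = set0) ?(fm0 mY) ?mulr0//.
    by rewrite setICA AS setI0.
have BS0 : d_borel (edist (@dist _ X)) S0 by exact: d_borel_closed (good_closed g0).
exists S1, n1; split=> //.
- split=> [y []//|A BA].
  have BAS : d_borel (edist (@dist _ Y)) (A `&` @supp _ Y).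
    by apply: d_borelI => //; exact: borel_supp.
  rewrite -(mass_supp gY)// (fm_sum_split mY BAS BQ tQ); last by move=> y [_ /cQ].
  apply: ler_sum => j _; apply: (@le_trans _ _ (mass (A `&` (Q j `&` S1)))).
    by rewrite ler_piMl// (fm_ge0 mY)//; exact: d_borelI.
  apply: (fm_mono mY); [exact: d_borelI|exact: d_borelI|].
  by move=> y [Ay [Qy [_ Sy]]].
- split=> //; split=> /=.
  + exact: lt_trans cc'.
  + move=> x Sx; have [y [Sy xy]] := s1 _ (S0S _ Sx); exists y; split; last lra.
    by split=> // del del0; exists x; split=> //; lra.
  + move=> A cA; have BA := d_borel_closed cA.
    pose I0 := [set i | `[< exists x, [/\ A x, P i x & S0 x] >]]%SET.
    have nS := mass_supp g0 BA; rewrite /= in nS; rewrite -nS.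
    apply: (@le_trans _ _ (\sum_(i in I0) n (P i))).
      rewrite -(fm_bigcup_fin mn)//; apply: (fm_mono mn).
      * exact: d_borelI.
      * exact: d_borel_fin.
      * move=> x [Ax Sx]; have /cP[i Pi] := S0S _ Sx; exists i => //.
        by rewrite finset.inE; apply/asboolP; exists x.
    apply: (le_trans (kn I0)); apply: lerD; last exact: ltW.
    rewrite big_mkcond; apply: ler_sum => j _.
    have BT : d_borel (edist (@dist _ Y)) (thick w A c' `&` (Q j `&` S1)).
      by apply: d_borelI => //; exact: borel_thick cw.
    case: ifPn => [/nbrsP[i]|_]; last by rewrite mulr_ge0// (fm_ge0 mY).
    rewrite finset.inE => /asboolP[x [Ax Px Sx]] rij.
    apply: ler_wpM2l => //; apply: (fm_mono mY) => // y Qy.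
    have xy := rlt _ _ _ _ rij Px Qy; split.
      by move=> del del0; exists x; split=> //; lra.
    split=> //; split; last by apply/cQ; exists j.
    by move=> del del0; exists x; split=> //; lra.
  + exact: lt_trans cc'.
  + move=> y [yS Sy]; have [x [Sx xy]] := yS _ eta0.
    by exists x; split=> //; rewrite /flip; lra.
  + move=> A cA; have BA := d_borel_closed cA.
    pose J0 := [set j | `[< exists y, [/\ A y, Q j y & S1 y] >]]%SET.
    apply: (@le_trans _ _ (\sum_(j in J0) k j * mass (Q j))).
      rewrite [leRHS]big_mkcond; apply: ler_sum => j _.
      case: ifPn => [_|jJ].
        apply: ler_wpM2l => //; apply: (fm_mono mY) => //; first exact: d_borelI.
        by move=> y [_ []].
      rewrite (_ : A `&` _ = set0) ?(fm0 mY) ?mulr0//.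
      apply/seteqP; split=> y // [Ay [Qy Sy]].
      by move: jJ; rewrite finset.inE => /asboolPn; apply; exists y.
    apply: (le_trans (kn' J0)); apply: lerD; last exact: ltW.
    rewrite -(fm_bigcup_fin mn)//; apply: (fm_mono mn).
    * exact: d_borel_fin.
    * exact: borel_thick cw'.
    * move=> x [i /nbrsP[j]]; rewrite finset.inE => /asboolP[y [Ay Qy Sy]] rij Px.
      move=> del del0; exists y; split=> //; rewrite /flip.
      by have := rlt _ _ _ _ rij Px Qy; lra.
- move=> rho ballS ballm.
  (* The detour over the base points costs [w (org X) (org Y)] and [w x y], both below [c']: hence
     the loss [2 * c'] in the radius. *)
  have ballP x y : dist (org Y) y <= rho - 2 * c' -> w x y < c + 3 * eta ->
      dist (org X) x <= rho.
    move=> oy xy; have := w3 (org X) x (org Y); have := w2 x (org Y) y.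
    by rewrite (dYC y); lra.
  have ballS1 : org_ball Y (rho - 2 * c') `&` @supp _ Y `<=` S1.
    move=> y [oy Sy]; split=> //; have [x [Sx xy]] := s2 _ Sy; rewrite /flip in xy.
    move=> del del0; exists x; split; last by lra.
    by apply: ballS; split=> //; apply: ballP oy _; lra.
  have BbY : d_borel (edist (@dist _ Y)) (org_ball Y (rho - 2 * c')).
    by apply: d_borel_closed; exact: closed_cball.
  split=> // A BA.
  have BAb : d_borel (edist (@dist _ Y)) (A `&` org_ball Y (rho - 2 * c')).
    exact: d_borelI.
  have BAbS : d_borel (edist (@dist _ Y)) (A `&` org_ball Y (rho - 2 * c') `&` @supp _ Y).
    by apply: d_borelI => //; exact: borel_supp.
  rewrite -(mass_supp gY)// (fm_sum_split mY BAbS BQ tQ); last by move=> y [_ /cQ].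
  apply: ler_sum => j _.
  have BAQ : d_borel (edist (@dist _ Y)) (A `&` (Q j `&` S1)) by exact: d_borelI.
  have [ex|nex] := pselect (exists y, (A `&` org_ball Y (rho - 2 * c') `&` @supp _ Y `&` Q j) y); last first.
    rewrite (_ : _ `&` Q j = set0) ?(fm0 mY) ?mulr_ge0 ?(fm_ge0 mY)//.
    by apply/seteqP; split=> y // hy; apply: nex; exists y.
  have [y [[[Ay oy] Sy] Qy]] := ex.
  (* The piece [Q j] meets the smaller ball, so all pieces related to it lie in the ball of radius
     [rho], where [n] is the full mass. *)
  rewrite k1E ?mul1r.
    apply: (fm_mono mY) => //; first exact: d_borelI.
    by move=> z [[[Az oz] Sz] Qz]; split=> //; split=> //; exact: ballS1.
  move=> i rij; apply/eqP; rewrite eq_le; case/andP: (nmu i) => _ -> /=.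
  apply: le_trans (ballm _ (BP i)); rewrite setIidl// => x Px.
  apply: ballP oy _; exact: rlt rij Px Qy.
Qed.

End SubTransport.

(** * Gromov-Hausdorff-Prokhorov distances *)

Section Embeddings.
Variable R : realType.

Definition embeds (X : pmm R) (E : ambient R) (i : pt X -> car E) :=
  [/\ isom_emb (@pd _ X) (@dist _ E) i, i (po X) = org E,
    forall x, @supp _ E (i x), forall e, @supp _ E e -> exists x, i x = e &
    forall A, d_borel (edist (@dist _ E)) A -> (mass A)%:E = @pmu _ X (i @^-1` A)].

Section Isom.
Variables (T T' : Type) (d : T -> T -> R) (d' : T' -> T' -> R) (f : T -> T').
Hypothesis fi : isom_emb d d' f.

Lemma isom_preimage_open U : d_open (edist d') U -> d_open (edist d) (f @^-1` U).
Proof.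
move=> oU x /oU[e [e0 eU]]; exists e; split=> // y xy.
by apply: eU; rewrite /edist fi.
Qed.

Lemma isom_preimage_closed U : d_closed (edist d') U -> d_closed (edist d) (f @^-1` U).
Proof. exact: isom_preimage_open. Qed.

Lemma isom_preimage_borel U : d_borel (edist d') U -> d_borel (edist d) (f @^-1` U).
Proof. by apply: d_borel_preimage; exact: isom_preimage_open. Qed.

Lemma isom_closureK A : is_metric d' -> d_closed (edist d) A ->
  f @^-1` (d_closure (edist d') (f @` A)) = A.
Proof.
move=> dM cA; apply/seteqP; split=> x.
  move=> xA; apply: (d_closed_adherent cA) => e /xA[_ [[a Aa <-]]].
  by rewrite /edist fi => xa; exists a.
move=> Ax; apply: (sub_d_closure (edist_pseudo dM)); by exists x.
Qed.

End Isom.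

(** A closed set is pulled back to [X], pushed to [Z] and closed there, since its image need not be
    closed; the slack of [thick] absorbs this closure. *)
Lemma half_close_of_metric (X Y : pmm R) (E F : ambient R) (i : pt X -> car E)
    (j : pt Y -> car F) (Z : Type) (dZ : Z -> Z -> R) (f : pt X -> Z) (g : pt Y -> Z)
    (w : car E -> car F -> R) (c e1 e2 : R) :
  is_metric (@pd _ X) -> is_measure (edist (@pd _ Y)) (@pmu _ Y) ->
  good E -> good F -> embeds i -> embeds j ->
  is_metric dZ -> isom_emb (@pd _ X) dZ f -> isom_emb (@pd _ Y) dZ g ->
  cross (@dist _ E) (@dist _ F) w -> (forall x y, w (i x) (j y) <= dZ (f x) (g y)) ->
  dZ (f (po X)) (g (po Y)) < c -> e1 < c -> e2 < c ->
  range f `<=` d_nbhd (edist dZ) (range g) e1 ->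
  (forall A, d_closed (edist dZ) A ->
    pushf f (@pmu _ X) A <= pushf g (@pmu _ Y) (d_nbhd (edist dZ) A e2) + e2%:E)%E ->
  half_close c w.
Proof.
move=> dX mY gE gF [iE io iS iR im] [jF jo jS jR jm] dZM fi gi cw wle oo e1c e2c hH hP.
have pZ := edist_pseudo dZM; have [dF _ _ _ _] := gF; have [_ _ dZC _] := dZM.
split=> [|e /iR[x <-]|A cA].
- by rewrite -io -jo; apply: le_lt_trans oo.
- have [|_ [[y _ <-]]] := d_nbhd_lt e1c (hH (f x) _); first by exists x.
  by rewrite lte_fin => xy; exists (j y); split=> //; apply: le_lt_trans xy.
- have cA1 := isom_preimage_closed iE cA.
  pose C := d_closure (edist dZ) (f @` (i @^-1` A)).
  have cC : d_closed (edist dZ) C by exact: d_closed_closure.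
  have Bt : d_borel (edist (@dist _ F)) (thick w A c) by exact: borel_thick cw.
  rewrite -lee_fin EFinD im ?jm//; last exact: d_borel_closed.
  rewrite -[X in pmu X](isom_closureK fi dZM cA1).
  apply: (le_trans (hP _ cC)); apply: leeD; last by rewrite lee_fin ltW.
  apply: (measure_mono mY).
  + apply: (isom_preimage_borel gi); apply: d_borel_closed; exact: d_closed_nbhd.
  + exact: (isom_preimage_borel jF).
  + move=> y yC del del0.
    have [z [Cz]] := d_nbhd_lt e2c yC; rewrite lte_fin => yz.
    have [_ [[x Ax <-]]] := Cz _ del0; rewrite lte_fin => zx.
    exists (i x); split=> //; apply: le_lt_trans (wle _ _) _.
    by case: dZM => _ _ _ dZT; have := dZT (f x) z (g y);
      rewrite (dZC (f x) z) (dZC z (g y)); lra.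
Qed.

(** One [delta] pays for the gap between the two copies, the other for a closure and the slack of
    [thick]. *)
Lemma metric_of_half_close (X Y : pmm R) (E F : ambient R) (i : pt X -> car E)
    (j : pt Y -> car F) (Z : Type) (dZ : Z -> Z -> R) (f : pt X -> Z) (g : pt Y -> Z)
    (w : car E -> car F -> R) (c delta : R) :
  is_metric (@pd _ X) -> is_measure (edist (@pd _ Y)) (@pmu _ Y) ->
  good E -> good F -> embeds i -> embeds j ->
  is_metric dZ -> isom_emb (@pd _ X) dZ f -> isom_emb (@pd _ Y) dZ g ->
  cross (@dist _ E) (@dist _ F) w ->
  (forall x y, dZ (f x) (g y) = w (i x) (j y) + delta) -> 0 < delta -> half_close c w ->
  [/\ dZ (f (po X)) (g (po Y)) < c + delta,
    range f `<=` d_nbhd (edist dZ) (range g) (c + delta + delta) &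
    forall A, d_closed (edist dZ) A ->
      (pushf f (@pmu _ X) A <= pushf g (@pmu _ Y)
         (d_nbhd (edist dZ) A (c + delta + delta)) + (c + delta + delta)%:E)%E].
Proof.
move=> dX mY gE gF [iE io iS iR im] [jF jo jS jR jm] dZM fi gi cw wE del0 [oo hs hm].
have [dE _ _ _ _] := gE; have [dF _ _ _ _] := gF; have [_ _ dZC _] := dZM.
have pZ := edist_pseudo dZM; have pE := edist_pseudo dE.
have [_ _ dEC _] := dE.
split=> [|_ [x _ <-]|A cA].
- by rewrite wE io jo; lra.
- have [y' [/jR[y <-] xy]] := hs _ (iS x).
  apply: (d_nbhd_mem (a := g y)); first by exists y.
  by rewrite lee_fin wE; lra.
- have cA1 : d_closed (edist (@pd _ X)) (f @^-1` A) by exact: (isom_preimage_closed fi).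
  pose C := d_closure (edist (@dist _ E)) (i @` (f @^-1` A)).
  have cC : d_closed (edist (@dist _ E)) C by exact: d_closed_closure.
  rewrite /pushf -[X in pmu X](isom_closureK iE dE cA1) -im; last exact: d_borel_closed.
  have Bt : d_borel (edist (@dist _ F)) (thick w C c) by exact: borel_thick cw.
  apply: (@le_trans _ _ (mass (thick w C c) + c)%:E); first by rewrite lee_fin hm.
  rewrite EFinD jm//; apply: leeD; last by rewrite lee_fin; lra.
  apply: (measure_mono mY).
  + exact: (isom_preimage_borel jF).
  + by apply: (isom_preimage_borel gi); apply: d_borel_closed; exact: d_closed_nbhd.
  + move=> y yC; have del2 : 0 < delta / 2 by lra.
    have [z [Cz zy]] := yC _ del2; have [_ [[x Ax <-]]] := Cz _ del2.
    rewrite lte_fin => zx; apply: (d_nbhd_mem (a := f x)) => //.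
    rewrite lee_fin dZC wE; have [w1 _ _ _] := cw.
    by have := w1 (i x) z (j y); rewrite dEC; lra.
Qed.

Section Glue.
Variables (X Y : pmm R) (dX : is_metric (@pd _ X)) (dY : is_metric (@pd _ Y)).
Variables (w : pt X -> pt Y -> R) (cw : cross (@pd _ X) (@pd _ Y) w).
Variables (delta : R) (del0 : 0 < delta).

(* The gap [delta] makes this a genuine metric on the disjoint union, so that no
   quotient is needed. *)
Definition glue (u v : pt X + pt Y) : R :=
  match u, v with
  | inl x, inl x' => @pd _ X x x'
  | inr y, inr y' => @pd _ Y y y'
  | inl x, inr y => w x y + delta
  | inr y, inl x => w x y + delta
  end.

Lemma glue_metric : is_metric glue.
Proof.
have [x0 xE xC xT] := dX; have [y0 yE yC yT] := dY; have [w1 w2 w3 w4] := cw.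
have w0 x y : 0 <= w x y by exact: cross_ge0 cw.
have d0 := del0.
split.
- by move=> [x|y] [x'|y'] //=; rewrite addr_ge0// ltW.
- move=> [x|y] [x'|y'] /=; split.
  + by move=> /xE ->.
  + by move=> [->]; apply/xE.
  + by move=> h; exfalso; have := w0 x y'; lra.
  + by [].
  + by move=> h; exfalso; have := w0 x' y; lra.
  + by [].
  + by move=> /yE ->.
  + by move=> [->]; apply/yE.
- by move=> [x|y] [x'|y'] //=.
- move=> [x|y] [x'|y'] [x''|y''] //=.
  + by have := w1 x x' y''; lra.
  + by have := w3 x x'' y'; lra.
  + by have := w2 x y'' y'; lra.
  + by have := w1 x'' x' y; rewrite (xC x'' x'); lra.
  + by have := w4 x' y y''; lra.
  + by have := w2 x'' y y'; rewrite (yC y' y); lra.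
Qed.

End Glue.

Lemma maxe_ltP (x y : \bar R) c : (maxe x y < c)%E <-> (x < c)%E /\ (y < c)%E.
Proof. by rewrite gt_max; split=> [/andP[]//|[-> ->]]. Qed.

Lemma ereal_inf_ltP (A : set (\bar R)) c :
  (ereal_inf A < c)%E <-> exists2 v, A v & (v < c)%E.
Proof.
split=> [/ereal_inf_lt//|[v Av vc]].
by apply: le_lt_trans vc; exact: ereal_inf_lbound.
Qed.

(** A common space [Z] induces a cross metric, and conversely the disjoint union with [glue] is a
    common space. The carriers [E] and [F] may exceed the images of [X] and [Y], so that subspaces
    can be compared inside one fixed space. *)
Lemma dGHPc_ltP (X Y : pmm R) (E F : ambient R) (i : pt X -> car E) (j : pt Y -> car F)
    (c : R) : c_pmm X -> c_pmm Y -> good E -> good F -> embeds i -> embeds j ->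
  (dGHPc X Y < c%:E)%E <->
  exists c' (w : car E -> car F -> R), c' < c /\ ghp_close c' w.
Proof.
move=> [dX mX _ _] [dY mY _ _] gE gF ei ej.
have [dE _ _ _ _] := gE; have [dF _ _ _ _] := gF.
have [iE io iS iR im] := ei; have [jF jo jS jR jm] := ej.
split.
- move=> /ereal_inf_ltP[_ [Z [dZ [f [g [dZM fi gi ->]]]]]].
  move=> /maxe_ltP[oo /maxe_ltP[]].
  move=> /ereal_inf_ltP[_ [e1 [e10 [h1 h2]] <-] e1c].
  move=> /ereal_inf_ltP[_ [e2 [e20 hP] <-] e2c].
  rewrite !lte_fin in oo e1c e2c.
  pose b := Num.max (dZ (f (po X)) (g (po Y))) (Num.max e1 e2).
  have bc : b < c by rewrite /b !gt_max oo e1c.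
  pose c' := (b + c) / 2.
  have c'c : c' < c by rewrite /c'; lra.
  have bc' : b < c' by rewrite /c'; lra.
  have [oo' [e1c' e2c']] : dZ (f (po X)) (g (po Y)) < c' /\ e1 < c' /\ e2 < c'.
    by move: bc'; rewrite /b !gt_max => /andP[-> /andP[]].
  have [z0 zE zC zT] := dZM; have [dE0 _ dEC dET] := dE; have [dF0 _ dFC dFT] := dF.
  (* The length of the path from [u] to [v] through [x], the space [Z] and [y]; its infimum extends
     the distance of [Z] to all points of [E] and [F]. *)
  pose h u v (p : pt X * pt Y) := dist u (i p.1) + dZ (f p.1) (g p.2) + dist (j p.2) v.
  have h0 u v p : 0 <= h u v p by rewrite /h !addr_ge0.
  pose p0 := (po X, po Y).
  pose w u v := inf (range (h u v)).
  have wle u v x y : w u v <= dist u (i x) + dZ (f x) (g y) + dist (j y) v.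
    exact: (inf_range_le p0 (h0 u v) (x, y)).
  have wxy x y : w (i x) (j y) <= dZ (f x) (g y).
    apply: le_trans (wle _ _ x y) _.
    have x0 : pd x x = 0 by case: dX => _ xE _ _; apply/xE.
    have y0 : pd y y = 0 by case: dY => _ yE _ _; apply/yE.
    by rewrite iE jF x0 y0 add0r addr0.
  have cw : cross (@dist _ E) (@dist _ F) w.
    split.
    + move=> u u' v; rewrite -lerBlDl; apply: (le_inf_range p0) => // -[x y].
      rewrite /h /=; have := wle u v x y; have := dET u u' (i x); lra.
    + move=> u v v'; rewrite -lerBlDr; apply: (le_inf_range p0) => // -[x y].
      rewrite /h /=; have := wle u v x y; have := dFT (j y) v' v; lra.
    + move=> u u' v; rewrite -lerBlDr; apply: (le_inf_range p0) => // -[x y].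
      rewrite lerBlDr -lerBlDl; apply: (le_inf_range p0) => // -[x' y'].
      rewrite /h /=; have := dET u (i x) u'; have := dET (i x) (i x') u'.
      have := zT (f x) (g y) (f x'); have := zT (g y) (g y') (f x').
      have := dFT (j y) v (j y'); rewrite iE jF gi -fi (dEC (i x') u').
      by rewrite (zC (g y') (f x')) (dFC v (j y')) ; lra.
    + move=> u v v'; rewrite -lerBlDr; apply: (le_inf_range p0) => // -[x y].
      rewrite lerBlDr -lerBlDl; apply: (le_inf_range p0) => // -[x' y'].
      rewrite /h /=; have := dFT v (j y) v'; have := dFT (j y) (j y') v'.
      have := zT (g y) (f x) (g y'); have := zT (f x) (f x') (g y').
      have := dET (i x) u (i x'); rewrite iE jF fi -gi (dFC v (j y)).
      by rewrite (zC (g y) (f x)) (dEC (i x) u); lra.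
  have cw' := cross_flip dE dF cw.
  exists c', w; split=> //; split=> //.
  + apply: (half_close_of_metric dX mY gE gF ei ej dZM fi gi cw wxy oo' e1c' e2c' h1).
    by move=> A cA; case: (hP A cA).
  + have wyx y x : flip w (j y) (i x) <= dZ (g y) (f x) by rewrite /flip zC.
    rewrite zC in oo'.
    apply: (half_close_of_metric dY mX gF gE ej ei dZM gi fi cw' wyx oo' e1c' e2c' h2).
    by move=> A cA; case: (hP A cA).
- move=> [c' [w [c'c [cw h1 h2]]]]; apply/ereal_inf_ltP.
  have cw' := cross_flip dE dF cw.
  pose delta := (c - c') / 4; have del0 : 0 < delta by rewrite /delta; lra.
  pose v x y := w (i x) (j y).
  have cv : cross (@pd _ X) (@pd _ Y) v.
    have [w1 w2 w3 w4] := cw; split=> x y z; rewrite /v -?iE -?jF.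
    - exact: w1.
    - exact: w2.
    - exact: w3.
    - exact: w4.
  have dZM := glue_metric dX dY cv del0.
  have fi : isom_emb (@pd _ X) (glue v delta) inl by [].
  have gi : isom_emb (@pd _ Y) (glue v delta) inr by [].
  have [o1 r1 m1] := metric_of_half_close (f := inl) (g := inr) dX mY gE gF ei ej dZM fi gi
     cw (fun _ _ => erefl) del0 h1.
  have [o2 r2 m2] := metric_of_half_close (f := inr) (g := inl) dY mX gF gE ej ei dZM gi fi
     cw' (fun _ _ => erefl) del0 h2.
  have w0 x y : 0 <= w x y by exact: cross_ge0 cw.
  have c'0 : 0 < c' by case: h1 => + _ _; exact: le_lt_trans.
  have e0 : 0 < c' + delta + delta by lra.
  eexists.
    by exists (pt X + pt Y)%type, (glue v delta), inl, inr.
  apply/maxe_ltP; split; first by rewrite lte_fin; apply: lt_trans o1 _; rewrite /delta; lra.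
  apply/maxe_ltP; split; apply/ereal_inf_ltP.
  + exists (c' + delta + delta)%:E; last by rewrite lte_fin /delta; lra.
    by exists (c' + delta + delta).
  + exists (c' + delta + delta)%:E; last by rewrite lte_fin /delta; lra.
    exists (c' + delta + delta) => //; split=> // A cA; split; [exact: m1|exact: m2].
Qed.

End Embeddings.

(** * Subspaces and closed balls as embedded compact spaces *)

Section Subspaces.
Variable R : realType.

Lemma sig_metric (T : Type) (d : T -> T -> R) (S : set T) : is_metric d ->
  is_metric (fun a b : {x | S x} => d (proj1_sig a) (proj1_sig b)).
Proof.
move=> [d0 dE dC dT]; split=> [x y|[x Sx] [y Sy]|x y|x y z].
- exact: d0.
- split=> [/dE /= xy|->]; last by apply/dE.
  by subst y; congr exist; exact: Prop_irrelevance.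
- exact: dC.
- exact: dT.
Qed.

Lemma sig_range_preimage (T : Type) (S A : set T) :
  @proj1_sig T S @` (@proj1_sig T S @^-1` A) = A `&` S.
Proof.
apply/seteqP; split=> [_ [[x Sx] Ax <-]//|x [Ax Sx]].
by exists (exist _ x Sx).
Qed.

(** Open sets of the subspace are traces of unions of ambient balls; the index [J] keeps a centre
    with an admissible radius. *)
Lemma sig_image_open (T : Type) (d : T -> T -> R) (S : set T) U : is_metric d ->
  d_open (edist (fun a b : {x | S x} => d (proj1_sig a) (proj1_sig b))) U ->
  exists V, d_open (edist d) V /\ @proj1_sig T S @` U = V `&` S.
Proof.
move=> dM oU; have pd := edist_pseudo dM.
pose J := {p : {x | S x} * R | forall z, d (proj1_sig p.1) (proj1_sig z) < p.2 -> U z}.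
pose V := \bigcup_(p : J) [set y | exists a, [set proj1_sig (sval p).1] a /\
  (edist d y a < (sval p).2%:E)%E].
exists V; split; first by apply: d_open_bigcup => p; exact: d_open_thick.
apply/seteqP; split=> [_ [[x Sx] Ux <-]|x [[p _ [_ [-> /= xp]]] Sx]].
  split=> //; have [e [e0 eU]] := oU _ Ux.
  have Pe : forall z, d x (proj1_sig z) < e -> U z by move=> z xz; apply: eU.
  exists (exist _ (exist _ x Sx, e) Pe) => //=; exists x; split=> //.
  exact: (pseudoxx pd).
exists (exist _ x Sx) => //; apply: (svalP p); rewrite /=.
by move: xp; rewrite lte_fin; case: dM => _ _ dC _; rewrite dC.
Qed.

Lemma sig_image_borel (T : Type) (d : T -> T -> R) (S : set T) B : is_metric d ->
  d_borel (edist d) S ->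
  d_borel (edist (fun a b : {x | S x} => d (proj1_sig a) (proj1_sig b))) B ->
  d_borel (edist d) (@proj1_sig T S @` B).
Proof.
move=> dM BS BB; apply: (BB [set B | d_borel (edist d) (@proj1_sig T S @` B)]).
split; first split=> [|A BA|F BF] /=.
- by rewrite image_set0; exact: d_borel0.
- rewrite (_ : _ @` _ = S `\` @proj1_sig T S @` A); first exact: d_borelD.
  apply/seteqP; split=> [_ [[x Sx] [_ nAx] <-]|x [Sx nA]].
    split=> //= -[[y Sy] Ay /= yx]; subst y; apply: nAx.
    by rewrite (Prop_irrelevance Sx Sy).
  by exists (exist _ x Sx) => //; split=> // Ax; apply: nA; exists (exist _ x Sx).
- rewrite image_bigcup; exact: d_borel_bigcup.
- move=> U /(sig_image_open dM)[V [oV VE]]; rewrite /= VE.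
  by apply: d_borelI => //; exact: d_borel_open.
Qed.

Definition ambpmm (X : pmm R) (S : set (pt X)) (n : set (pt X) -> R) : ambient R :=
  Ambient (@pd _ X) (po X) S n.
Arguments ambpmm : clear implicits.

(** The subtype is traded for a subset of [X] with the push-forward measure, so that all subspaces
    of [X] share one carrier and one function [w] can serve several of them; [subpmm_c_pmm] is the
    way back. *)
Lemma subpmm_embeds (X : pmm R) (S : set (pt X)) (h : S (po X))
    (nu : set {x | S x} -> \bar R) : is_metric (@pd _ X) -> c_pmm (subpmm h nu) ->
  good (ambpmm X S (fun A => fine (nu (@proj1_sig _ S @^-1` A)))) /\
  @embeds _ (subpmm h nu) (ambpmm X S (fun A => fine (nu (@proj1_sig _ S @^-1` A))))
    (@proj1_sig _ S).
Proof.
move=> dM [sM mnu cS nufin].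
have isoS : isom_emb (@pd _ (subpmm h nu)) (@pd _ X) (@proj1_sig _ S) by [].
have Bpre := isom_preimage_borel isoS.
split.
  split=> //=.
  - exact: (fm_preimage Bpre (fm_of_finite_measure mnu nufin)).
  - apply/(d_compact_isometric (d := edist (@pd _ (subpmm h nu))) (f := @proj1_sig _ S)) => //.
    + exact: edist_pseudo.
    + exact: edist_pseudo.
    + by case.
    + by move=> y Sy; exists (exist _ y Sy).
  - move=> A BA AS; rewrite (_ : _ @^-1` A = set0); first by case: mnu => /= ->.
    apply/seteqP; split=> // -[x Sx] Ax.
    by have : (A `&` S) x by []; rewrite AS.
split=> //=; first by case.
- by move=> x Sx; exists (exist _ x Sx).
- move=> A BA; rewrite -(fine_measure_EFin mnu)//; first exact: Bpre.
  apply: le_lt_trans nufin; apply: (measure_mono mnu) => //; first exact: Bpre.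
  exact: d_borelT.
Qed.

Lemma subpmm_c_pmm (X : pmm R) (S : set (pt X)) (h : S (po X)) (n : set (pt X) -> R)
    (nu : set {x | S x} -> \bar R) : good (ambpmm X S n) ->
  (forall B, d_borel (edist (@pd _ (subpmm h nu))) B ->
     nu B = (n (@proj1_sig _ S @` B))%:E) ->
  c_pmm (subpmm h nu) /\
  @embeds _ (subpmm h nu) (ambpmm X S n) (@proj1_sig _ S).
Proof.
move=> gS nuE; have BS := borel_supp gS; have [dM mn _ cS conc] := gS.
rewrite /= in BS dM mn cS conc.
have sM := sig_metric S dM.
have isoS : isom_emb (@pd _ (subpmm h nu)) (@pd _ X) (@proj1_sig _ S) by [].
have Bim B : d_borel (edist (@pd _ (subpmm h nu))) B ->
  d_borel (edist (@pd _ X)) (@proj1_sig _ S @` B) by exact: sig_image_borel.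
have pinj (x y : {x | S x}) : proj1_sig x = proj1_sig y -> x = y.
  by case: sM => _ sE _ _ xy; apply/sE; rewrite xy; case: dM => _ dE _ _; apply/dE.
have fn : fmeas (edist (@pd _ (subpmm h nu))) (fun B => n (@proj1_sig _ S @` B)).
  have [n0 np ns] := mn; split=> [|B BB|F BF tF].
  - by rewrite image_set0.
  - by apply: np; exact: Bim.
  - rewrite image_bigcup; apply: ns; first by move=> k; exact: Bim.
    apply/trivIsetP => i j _ _ ij; apply/seteqP; split=> // _ [[x Fx <-] [y Fy /pinj yx]].
    have : (F i `&` F j) x by split; [|rewrite -yx].
    by move/trivIsetP: tF => /(_ i j Logic.I Logic.I ij) ->.
have cn B : d_borel (edist (@pd _ (subpmm h nu))) B -> (nu B < +oo)%E.
  by move=> /nuE ->; rewrite ltry.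
split.
  split=> //; first exact: is_measure_ext (measure_of_fm fn) nuE.
    apply/(d_compact_isometric (d' := edist (@pd _ X)) (f := @proj1_sig _ S) (S := S)) => //.
    + exact: edist_pseudo.
    + exact: edist_pseudo.
    + by case.
    + by move=> y Sy; exists (exist _ y Sy).
  by apply: cn; exact: d_borelT.
split=> //=; first by case.
- by move=> x Sx; exists (exist _ x Sx).
- move=> A BA; rewrite nuE; last exact: (isom_preimage_borel isoS).
  by rewrite sig_range_preimage; have /= -> := mass_supp gS BA.
Qed.

Definition ballm (X : pmm R) (r : R) (A : set (pt X)) : R :=
  fine (@pmu _ X (A `&` cball (@pd _ X) (po X) r)).
Arguments ballm : clear implicits.

Definition ballamb (X : pmm R) (r : R) : ambient R :=
  ambpmm X (cball (@pd _ X) (po X) r) (ballm X r).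

Section BoundedlyCompact.
Variables (X : pmm R) (bX : bc_pmm X).
Local Notation B := (d_borel (edist (@pd _ X))).
Local Notation cb r := (cball (@pd _ X) (po X) r).

Lemma borel_cb r : B (cb r).
Proof. by apply: d_borel_closed; apply: closed_cball; case: bX. Qed.

Lemma ballmE r A : B A -> (ballm X r A)%:E = @pmu _ X (A `&` cb r).
Proof.
move=> BA; have [dM mX hb] := bX; have Bb := borel_cb r.
have BAb : B (A `&` cb r) by exact: d_borelI.
rewrite /ballm -(fine_measure_EFin mX)//.
apply: le_lt_trans (proj2 (hb (po X) r)).
by apply: (measure_mono mX) => //; exact: subIsetr.
Qed.

Lemma ballm_fm r : fmeas (edist (@pd _ X)) (ballm X r).
Proof.
have [dM mX hb] := bX; apply: fm_of_measure => //; first exact: borel_cb.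
by case: (hb (po X) r).
Qed.

Lemma ballm_mono r s A : r <= s -> B A -> ballm X r A <= ballm X s A.
Proof.
move=> rs BA; rewrite -lee_fin !ballmE//; have [_ mX _] := bX.
apply: (measure_mono mX); [apply: d_borelI|apply: d_borelI|] => //; try exact: borel_cb.
by move=> x [Ax xr]; split=> //; exact: le_trans rs.
Qed.

Lemma ballm_restrict r s A : r <= s -> B A -> ballm X s (A `&` cb r) = ballm X r A.
Proof.
move=> rs BA; rewrite /ballm -setIA; congr (fine (pmu (_ `&` _))).
by apply: setIidl => x xr; exact: le_trans rs.
Qed.

Lemma ballamb_good r : 0 <= r -> good (ballamb X r).
Proof.
move=> r0; have [dM mX hb] := bX; have [_ dE _ _] := dM; split=> //=.
- exact: ballm_fm.
- by rewrite /cball /= (_ : pd _ _ = 0)//; apply/dE.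
- by case: (hb (po X) r).
- by move=> A BA A0; rewrite /ballm A0; case: mX => ->.
Qed.

Lemma ballset_cball r : 0 <= r -> @ballset _ X r = cb r.
Proof.
move=> r0; apply/seteqP; split=> x; last by right.
by case=> // ->; rewrite /cball /= (_ : pd _ _ = 0)//; case: bX => -[_ dE _ _] _ _; apply/dE.
Qed.

Lemma ballpmm_c_pmm r : 0 <= r ->
  c_pmm (ballpmm r X) /\ @embeds _ (ballpmm r X) (ballamb X r) (@proj1_sig _ _).
Proof.
move=> r0; have gX := ballamb_good r0.
have h := ballset_cball r0.
have sub y : @ballset _ X r y <-> cb r y by rewrite h.
have gX' : good (ambpmm X (@ballset _ X r) (ballm X r)) by rewrite h.
have [|cB eB] := subpmm_c_pmm (h := @ballset_o _ X r)
    (nu := fun A => @pmu _ X [set proj1_sig a | a in A]) gX'.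
  move=> A BA; have BA' : B (@proj1_sig _ (@ballset _ X r) @` A).
    by apply: sig_image_borel BA; [case: bX|exact: borel_supp gX'].
  rewrite ballmE//; congr (pmu _); rewrite setIidl// -h.
  by move=> _ [[x Sx] _ <-].
split=> //; have [e1 e2 e3 e4 e5] := eB; split=> //.
- by move=> x; apply/sub; exact: e3.
- by move=> y /sub; exact: e4.
Qed.

End BoundedlyCompact.

Definition fullamb (X : pmm R) : ambient R := ambpmm X setT (fun A => fine (@pmu _ X A)).

Lemma fullamb_good (X : pmm R) : c_pmm X -> good (fullamb X) /\ @embeds _ X (fullamb X) id.
Proof.
move=> [dM mX cX fX]; split.
  split=> //=; first exact: fm_of_finite_measure.
  by move=> A _; rewrite setIT => ->; case: mX => ->.
split=> //= [x _|A BA]; first by exists x.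
rewrite -(fine_measure_EFin mX)//; apply: le_lt_trans fX.
by apply: (measure_mono mX) => //; exact: d_borelT.
Qed.

Lemma lee_of_lt_EFin (x y : \bar R) :
  (forall e : R, x < e%:E -> y < e%:E)%E -> (y <= x)%E.
Proof.
case: x => [r||] h.
- by apply/lee_addgt0Pr => e e0; apply/ltW/h; rewrite lte_fin ltrDl.
- exact: leey.
- case: y h => [s|/(_ 0)|//]; last by move=> /(_ (ltNyr _)).
  by move=> /(_ s (ltNyr _)); rewrite ltxx.
Qed.

Lemma dGHPc_pseudo : pseudo (@dMc R).
Proof.
have gP (X : Mc R) := fullamb_good (svalP X).
split.
- move=> X e e0; have [gX eX] := gP X.
  apply/(dGHPc_ltP e (svalP X) (svalP X) gX gX eX eX).
  exists (e / 2), (@pd _ (sval X)); split; first by lra.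
  have h : 0 < e / 2 by lra.
  have [dM _ _ _ _] := gX; have [_ dE _ _] := dM.
  apply: ghp_close_same => //.
  + by move=> x _; exists x; rewrite (_ : pd _ _ = 0)//; apply/dE.
  + by move=> x _; exists x; rewrite (_ : pd _ _ = 0)//; apply/dE.
  + by move=> A _; rewrite lerDl ltW.
  + by move=> A _; rewrite lerDl ltW.
- have le X Y (e : R) : (dMc X Y < e%:E -> dMc Y X < e%:E)%E.
    have [gX eX] := gP X; have [gY eY] := gP Y.
    move=> /(dGHPc_ltP e (svalP X) (svalP Y) gX gY eX eY)[c [w [ce h]]].
    apply/(dGHPc_ltP e (svalP Y) (svalP X) gY gX eY eX).
    by exists c, (flip w); split=> //; exact: ghp_close_flip.
  have le' (X Y : Mc R) : (dMc X Y <= dMc Y X)%E by apply: lee_of_lt_EFin => e; exact: le.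
  by move=> X Y; apply/eqP; rewrite eq_le !le'.
- move=> X Y Z a b; have [gX eX] := gP X; have [gY eY] := gP Y; have [gZ eZ] := gP Z.
  move=> /(dGHPc_ltP a (svalP X) (svalP Y) gX gY eX eY)[c [w [ca h]]].
  move=> /(dGHPc_ltP b (svalP Y) (svalP Z) gY gZ eY eZ)[c' [w' [cb h']]].
  apply/(dGHPc_ltP _ (svalP X) (svalP Z) gX gZ eX eZ).
  exists (c + c'), (cross_comp w w'); split; first exact: ltrD.
  exact: ghp_close_comp h h'.
Qed.


Lemma aGHP_ltP (X Y : pmm R) (e r c : R) : bc_pmm X -> bc_pmm Y -> 0 <= r ->
  (aGHP e r X Y < c%:E)%E <->
  exists (S : set (pt Y)) (n : set (pt Y) -> R) (c' : R) (w : pt X -> pt Y -> R),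
    [/\ c' < c /\ good (ambpmm Y S n), cball (@pd _ Y) (po Y) (r - e) `<=` S,
      forall A, d_borel (edist (@pd _ Y)) A ->
        (@pmu _ Y (A `&` cball (@pd _ Y) (po Y) (r - e)) <= (n A)%:E)%E,
      forall A, d_borel (edist (@pd _ Y)) A -> ((n A)%:E <= @pmu _ Y A)%E &
      @ghp_close _ c' (ballamb X r) (ambpmm Y S n) w].
Proof.
move=> bX bY r0; have [dMY mY _] := bY.
have gX := ballamb_good bX r0; have [cX eX] := ballpmm_c_pmm bX r0.
split.
- move=> /ereal_inf_ltP[_ [S [h [nu [cS ballS low up ->]]]]].
  have [gS eS] := subpmm_embeds dMY cS.
  move=> /(dGHPc_ltP c cX cS gX gS eX eS)[c' [w [c'c cw]]].
  have BS := borel_supp gS; rewrite /= in BS.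
  have isoS : isom_emb (@pd _ (subpmm h nu)) (@pd _ Y) (@proj1_sig _ S) by [].
  have [_ _ _ _ nE] := eS.
  exists S, (fun A => fine (nu (@proj1_sig _ S @^-1` A))), c', w; split=> // A BA.
  + rewrite -[(fine _)%:E]/((mass (a := ambpmm Y S (fun A => fine (nu (@proj1_sig _ S @^-1` A)))) A)%:E).
    rewrite nE//; apply: le_trans (low _ _); last exact: (isom_preimage_borel isoS).
    by rewrite sig_range_preimage -setIA (setIidr ballS).
  + rewrite -[(fine _)%:E]/((mass (a := ambpmm Y S (fun A => fine (nu (@proj1_sig _ S @^-1` A)))) A)%:E).
    rewrite nE//; apply: le_trans (up _ _) _; first exact: (isom_preimage_borel isoS).
    rewrite sig_range_preimage; apply: (measure_mono mY) => //; exact: d_borelI.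
- move=> [S [n [c' [w [[c'c gS] ballS low up cw]]]]]; apply/ereal_inf_ltP.
  have h : S (po Y) by case: gS.
  pose nu (B : set {y | S y}) := (n (@proj1_sig _ S @` B))%:E.
  have [|cS eS] := subpmm_c_pmm (h := h) (nu := nu) gS; first by [].
  have BS := borel_supp gS; rewrite /= in BS.
  exists (dGHPc (ballpmm r X) (subpmm h nu)).
    exists S, h, nu; split=> // A BA; [apply: low|apply: up];
      exact: sig_image_borel BA.
  by apply/(dGHPc_ltP c cX cS gX gS eX eS); exists c', w.
Qed.

End Subspaces.

(** * Approximation at two radii and the triangle inequality for [dGHP] *)

Section GHP.
Variable R : realType.
Local Notation cb X r := (cball (@pd _ X) (po X) r).
Local Notation borel X := (d_borel (edist (@pd _ X))).

(* a(r - rho, r; X, Y) < c iff [approx r rho c' X Y] for some c' < c. *)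
Definition approx (r rho c : R) (X Y : pmm R) :=
  exists (S : set (pt Y)) (n : set (pt Y) -> R) (w : pt X -> pt Y -> R),
    [/\ good (ambpmm S n), cb Y rho `<=` S,
      forall A, borel Y A -> (@pmu _ Y (A `&` cb Y rho) <= (n A)%:E)%E,
      forall A, borel Y A -> ((n A)%:E <= @pmu _ Y A)%E &
      @ghp_close _ c (ballamb X r) (ambpmm S n) w].

Lemma aGHP_approx (X Y : pmm R) (e r c : R) : bc_pmm X -> bc_pmm Y -> 0 <= r ->
  (aGHP e r X Y < c%:E)%E <-> exists2 c', c' < c & approx r (r - e) c' X Y.
Proof.
move=> bX bY r0; split.
  move=> /(aGHP_ltP e c bX bY r0)[S [n [c' [w [[c'c gS] h1 h2 h3 h4]]]]].
  by exists c' => //; exists S, n, w.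
move=> [c' c'c [S [n [w [gS h1 h2 h3 h4]]]]].
by apply/(aGHP_ltP e c bX bY r0); exists S, n, c', w.
Qed.

Lemma ghp_close_supp_bound (X : pmm R) (E : ambient R) (r c : R) (w : pt X -> car E -> R) :
  good E -> @ghp_close _ c (ballamb X r) E w ->
  forall y, @supp _ E y -> dist (org E) y <= r + 2 * c.
Proof.
move=> gE [[w1 _ _ w4] [oo _ _] [_ hs _]] y /hs[x [/= xr]]; rewrite /flip => xy.
have := w4 (po X) (org E) y; have := w1 (po X) x y; move: oo xr.
by rewrite /cball /=; lra.
Qed.

Lemma approx_of_ghp_close (X Y : pmm R) (r c : R) (w : pt X -> pt Y -> R) :
  bc_pmm Y -> 0 <= r -> @ghp_close _ c (ballamb X r) (ballamb Y r) w -> approx r r c X Y.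
Proof.
move=> bY r0 cw; exists (cb Y r), (@ballm _ Y r), w; split=> //.
- exact: ballamb_good.
- by move=> A BA; rewrite ballmE.
- move=> A BA; rewrite ballmE//; have [_ mY _] := bY.
  by apply: (measure_mono mY) => //; apply: d_borelI => //; exact: borel_cb.
Qed.

(** The ball of radius [s] is a subspace of that of radius [r], and [ghp_close_sub] carries it into
    [S]. The result contains what [S] has in common with the ball of radius [s - 2 * c'], hence the
    ball of radius [sigma], which lies in [S] as [sigma <= rho]. *)
Lemma approx_shrink (X Y : pmm R) (r s rho sigma c c' : R) : bc_pmm X -> bc_pmm Y ->
  0 <= s -> s <= r -> approx r rho c X Y -> c < c' -> sigma <= rho ->
  sigma <= s - 2 * c' -> approx s sigma c' X Y.
Proof.
move=> bX bY s0 sr [S [n [w [gS h1 h2 h3 cw]]]] cc' sigrho sigs.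
have gX := ballamb_good bX (le_trans s0 sr); have gX' := ballamb_good bX s0.
have [_ mY _] := bY.
have [|A BA|S1 [n1 [gS1 [S1S n1n] cw1 ball]]] :=
    ghp_close_sub (X := ballamb X r) (Y := ambpmm S n) (S0 := cb X s) (n := @ballm _ X s) gX gS cw cc' gX'.
- by move=> x xs; exact: le_trans sr.
- exact: ballm_mono.
- have [|A BA|b1 b2] := ball s.
  + by move=> x [].
  + rewrite -(ballm_restrict sr BA); exact: lexx.
  have sub a b : a <= b -> cb Y a `<=` cb Y b by move=> ab y ya; exact: le_trans ab.
  exists S1, n1, w; split=> //.
  + move=> y ys; apply: b1; split; first exact: sub sigs _ ys.
    by apply: h1; exact: sub sigrho _ ys.
  + move=> A BA; have BAs : borel Y (A `&` cb Y sigma).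
      by apply: d_borelI => //; exact: borel_cb.
    rewrite -(setIidl (sub _ _ sigrho)) setIA.
    apply: (le_trans (h2 _ BAs)); rewrite lee_fin.
    apply: le_trans (b2 A BA); have [_ mn _ _ _] := gS; apply: (fm_mono mn) => //.
      by apply: d_borelI => //; exact: borel_cb.
    by apply: setIS; exact: sub.
  + by move=> A BA; apply: le_trans (h3 A BA); rewrite lee_fin n1n.
Qed.

(** The subspace of [Y] found for [X] lies within distance [s + 2 * c1] of the base point, hence in
    the ball of radius [t] that is compared with [Z], and can be carried on to [Z]. *)
Lemma approx_trans (X Y Z : pmm R) (s sigma c1 t tau c2 c2' upsilon : R) :
  bc_pmm X -> bc_pmm Y -> bc_pmm Z -> 0 <= s -> 0 <= t ->
  approx s sigma c1 X Y -> approx t tau c2 Y Z -> c2 < c2' -> s + 2 * c1 <= t ->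
  upsilon <= tau -> upsilon <= sigma - 2 * c2' ->
  approx s upsilon (c1 + c2') X Z.
Proof.
move=> bX bY bZ s0 t0 [S [n [w [gS h1 h2 h3 cw]]]] [T [m [v [gT k1 k2 k3 cv]]]].
move=> cc st ut us; have gX := ballamb_good bX s0; have gY := ballamb_good bY t0.
have [_ mY _] := bY; have [_ mZ _] := bZ.
have St : S `<=` cb Y t.
  by move=> y Sy; apply: le_trans st; exact: ghp_close_supp_bound gS cw _ Sy.
have BS := borel_supp gS; rewrite /= in BS.
have nle A : borel Y A -> n A <= @ballm _ Y t A.
  move=> BA; have /= <- := mass_supp gS BA; have BAS : borel Y (A `&` S) by exact: d_borelI.
  rewrite -lee_fin ballmE//; apply: (le_trans (h3 _ BAS)).
  apply: (measure_mono mY) => //; first by apply: d_borelI => //; exact: borel_cb.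
  exact: setIS.
have [S1 [n1 [gS1 [S1S n1n] cw1 ball]]] :=
  ghp_close_sub (X := ballamb Y t) (Y := ambpmm T m) (S0 := S) (n := n) gY gT cv cc gS St nle.
have [|A BA|b1 b2] := ball sigma.
- by move=> y [/h1].
- rewrite /= -lee_fin ballmE//; last by apply: d_borelI => //; exact: borel_cb.
  apply: le_trans (h2 A BA); apply: (measure_mono mY); last exact: subIsetl.
    by repeat (apply: d_borelI => //); exact: borel_cb.
  by apply: d_borelI => //; exact: borel_cb.
have sub a b : a <= b -> cb Z a `<=` cb Z b by move=> ab y ya; exact: le_trans ab.
exists S1, n1, (cross_comp w v); split=> //.
- move=> z zu; apply: b1; split; first exact: sub us _ zu.
  by apply: k1; exact: sub ut _ zu.
- move=> A BA; have BAs : borel Z (A `&` cb Z upsilon).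
    by apply: d_borelI => //; exact: borel_cb.
  rewrite -(setIidl (sub _ _ ut)) setIA.
  apply: (le_trans (k2 _ BAs)); rewrite lee_fin.
  apply: le_trans (b2 A BA); have [_ mm _ _ _] := gT; apply: (fm_mono mm) => //.
    by apply: d_borelI => //; exact: borel_cb.
  by apply: setIS; exact: sub.
- by move=> A BA; apply: le_trans (k3 A BA); rewrite lee_fin n1n.
- exact: (ghp_close_comp (Y := ambpmm S n)).
Qed.

(** The first alternative comes from the cap of [dGHP] at 1. *)
Lemma dGHP_ltP (X Y : pmm R) a : dGHP X Y < a <->
  1 < a \/ exists e, [/\ 0 < e <= 1, e < a, (aGHP e e^-1 X Y < (e / 2)%:E)%E &
    (aGHP e e^-1 Y X < (e / 2)%:E)%E].
Proof.
rewrite /dGHP; set A := [set _ | _ in _].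
have A0 : (0%:E <= ereal_inf A)%E.
  by apply: le_ereal_inf_tmp => _ [e [/andP[e0 _] _] <-]; rewrite lee_fin ltW.
have fE : (fine (mine 1%E (ereal_inf A)))%:E = mine 1%E (ereal_inf A).
  rewrite fineK// ge0_fin_numE; last by rewrite le_min A0 lee_fin ler01.
  by rewrite gt_min ltry.
rewrite -[X in is_true X <-> _]lte_fin fE gt_min lte_fin; split.
  move=> /orP[->|]; first by left.
  move=> /ereal_inf_ltP[_ [e [e01 /maxe_ltP[h1 h2]] <-] ea]; right.
  by exists e; rewrite -lte_fin.
move=> [->//|[e [e01 ea h1 h2]]]; apply/orP; right.
by apply/ereal_inf_ltP; exists e%:E => //; exists e => //; split=> //; apply/maxe_ltP.
Qed.

Lemma dGHP_approxP (X Y : pmm R) a : bc_pmm X -> bc_pmm Y -> a <= 1 ->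
  dGHP X Y < a <-> exists e c c', [/\ 0 < e, e < a, c < e / 2 /\ c' < e / 2,
    approx e^-1 (e^-1 - e) c X Y & approx e^-1 (e^-1 - e) c' Y X].
Proof.
move=> bX bY a1; split.
  move=> /dGHP_ltP[|[e [/andP[e0 e1] ea]]]; first by rewrite ltNge a1.
  have e0' : 0 <= e^-1 by rewrite invr_ge0 ltW.
  move=> /(aGHP_approx _ _ bX bY e0')[c ce h] /(aGHP_approx _ _ bY bX e0')[c' c'e h'].
  by exists e, c, c'.
move=> [e [c [c' [e0 ea [ce c'e] h h']]]]; apply/dGHP_ltP; right; exists e.
have e0' : 0 <= e^-1 by rewrite invr_ge0 ltW.
split=> //; first by rewrite e0 (le_trans (ltW ea)).
- by apply/(aGHP_approx _ _ bX bY e0'); exists c.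
- by apply/(aGHP_approx _ _ bY bX e0'); exists c'.
Qed.

(** Makes the radii [1 / e] compatible with the triangle inequality: the ball of radius
    [1 / (a + b)], enlarged by the slack [a], still fits in that of radius [1 / b]. *)
Lemma invD_add_le (a b : R) : 0 < a -> 0 < b -> a + b <= 1 -> (a + b)^-1 + a <= b^-1.
Proof.
move=> a0 b0 ab; have s0 : 0 < a + b by rewrite addr_gt0.
rewrite -subr_ge0 (_ : _ - _ = a * (1 - b * (a + b)) / (b * (a + b))).
  rewrite divr_ge0//; [apply: mulr_ge0; first exact: ltW|by rewrite mulr_ge0 ?ltW].
  by rewrite subr_ge0 mulr_ile1// ltW//; lra.
by field; rewrite !gt_eqF.
Qed.

(** Each step loses twice its closeness in radius, and the thresholds [a / 2] and [b / 2] keep the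
    losses below [a] and [b]. The midpoints [c1'] and [c2'] allow for the strict increase in
    closeness that each transport costs. *)
Lemma approx_trans_GHP (X Y Z : pmm R) (a b c1 c2 : R) :
  bc_pmm X -> bc_pmm Y -> bc_pmm Z -> 0 < a -> 0 < b -> a + b <= 1 ->
  c1 < a / 2 -> c2 < b / 2 ->
  approx a^-1 (a^-1 - a) c1 X Y -> approx b^-1 (b^-1 - b) c2 Y Z ->
  exists2 c, c < (a + b) / 2 & approx (a + b)^-1 ((a + b)^-1 - (a + b)) c X Z.
Proof.
move=> bX bY bZ a0 b0 ab c1a c2b h1 h2.
pose s := (a + b)^-1; have s0 : 0 <= s by rewrite invr_ge0 addr_ge0// ltW.
have sb : s + a <= b^-1 by exact: invD_add_le.
have sa : s + b <= a^-1 by rewrite /s (addrC a); apply: invD_add_le => //; rewrite addrC.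
pose c1' := (c1 + a / 2) / 2; pose c2' := (c2 + b / 2) / 2.
have [c1c1 c1a'] : c1 < c1' /\ c1' < a / 2 by rewrite /c1'; lra.
have [c2c2 c2b'] : c2 < c2' /\ c2' < b / 2 by rewrite /c2'; lra.
exists (c1' + c2'); first by lra.
have h1' : approx s (s - a) c1' X Y.
  by apply: (approx_shrink bX bY s0 _ h1 c1c1); lra.
have b0' : 0 <= b^-1 by rewrite invr_ge0 ltW.
by apply: (approx_trans bX bY bZ s0 b0' h1' h2 c2c2); rewrite -/s; lra.
Qed.

Lemma dGHP_sym (X Y : pmm R) : dGHP X Y = dGHP Y X.
Proof. by rewrite /dGHP; under eq_fun do rewrite maxC. Qed.

(** Closeness of the larger balls is lowered to radius [1 / e] by [approx_shrink]; the radius lost,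
    [2 * c'], stays below the permitted [e]. *)
Lemma dGHPc_ball_dGHP (X Y : pmm R) (r e a : R) : bc_pmm X -> bc_pmm Y ->
  0 < e -> e < a -> e^-1 <= r ->
  (dGHPc (ballpmm r X) (ballpmm r Y) < (e / 2)%:E)%E -> dGHP X Y < a.
Proof.
move=> bX bY e0 ea er; have e0' : 0 <= e^-1 by rewrite invr_ge0 ltW.
have r0 : 0 <= r by exact: le_trans er.
have [gX gY] := (ballamb_good bX r0, ballamb_good bY r0).
have [[cX eX] [cY eY]] := (ballpmm_c_pmm bX r0, ballpmm_c_pmm bY r0).
move=> /(dGHPc_ltP _ cX cY gX gY eX eY)[c [w [ce cw]]].
have [a1|a1] := ltP 1 a; first by apply/dGHP_ltP; left.
have cw' := ghp_close_flip gX gY cw.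
have h := approx_of_ghp_close bY r0 cw; have h' := approx_of_ghp_close bX r0 cw'.
pose c' := (c + e / 2) / 2; have [cc' c'e] : c < c' /\ c' < e / 2 by rewrite /c'; lra.
apply/(dGHP_approxP bX bY a1); exists e, c', c'; split=> //.
- by apply: (approx_shrink bX bY e0' er h cc'); lra.
- by apply: (approx_shrink bY bX e0' er h' cc'); lra.
Qed.

Lemma dGHP_pseudo : pseudo (@dMstar R).
Proof.
split.
- move=> X e e0; rewrite lte_fin; have bX := svalP X; rewrite /= in bX.
  have e20 : 0 < e / 2 by lra.
  have r0 : 0 <= (e / 2)^-1 by rewrite invr_ge0 ltW.
  have [cX _] := ballpmm_c_pmm bX r0.
  apply: (dGHPc_ball_dGHP bX bX e20 _ (lexx _)); first by lra.
  have [h _ _] := @dGHPc_pseudo R.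
  apply: (h (exist _ _ cX)); by lra.
- by move=> X Y; rewrite /dMstar dGHP_sym.
- move=> X Y Z a b; rewrite !lte_fin => xy yz.
  have [bX bY bZ] := And3 (svalP X) (svalP Y) (svalP Z); rewrite /= in bX bY bZ.
  have [ab|ab] := ltP 1 (a + b); first by apply/dGHP_ltP; left.
  have pos (X' Y' : pmm R) u : dGHP X' Y' < u -> 0 < u.
    by move=> /dGHP_ltP[|[e [/andP[e0 _] eu _ _]]]; [exact: lt_trans|exact: lt_trans eu].
  have [a0 b0] := (pos _ _ _ xy, pos _ _ _ yz).
  have a1 : a <= 1 by lra.
  have b1 : b <= 1 by lra.
  move: xy => /(dGHP_approxP bX bY a1)[e [c [c' [e0 ea [ce c'e] h h']]]].
  move: yz => /(dGHP_approxP bY bZ b1)[f [g [g' [f0 fb [gf g'f] k k']]]].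
  have ef1 : e + f <= 1 by lra.
  have fe1 : f + e <= 1 by lra.
  have [u ue hu] := approx_trans_GHP bX bY bZ e0 f0 ef1 ce gf h k.
  have [v ve hv] := approx_trans_GHP bZ bY bX f0 e0 fe1 g'f c'e k' h'.
  rewrite (addrC f) in hv ve.
  by apply/(dGHP_approxP bX bZ ab); exists (e + f), u, v; split=> //; lra.
Qed.

End GHP.

(** * Continuity radii *)

Section Radii.
Variable R : realType.
Local Notation cb X r := (cball (@pd _ X) (po X) r).
Local Notation borel X := (d_borel (edist (@pd _ X))).

Lemma natSinv_lt (e : R) : 0 < e -> exists n : nat, n.+1%:R^-1 < e.
Proof.
move=> e0; exists (Num.trunc e^-1).
by rewrite invf_plt ?posrE ?ltr0n// truncnS_gt.
Qed.

Lemma natSinv_gt0 (n : nat) : 0 < n.+1%:R^-1 :> R.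
Proof. by rewrite invr_gt0 ltr0n. Qed.

Lemma natSinv_anti (m n : nat) : (m <= n)%N -> n.+1%:R^-1 <= m.+1%:R^-1 :> R.
Proof. by move=> mn; rewrite lef_pV2 ?posrE ?ltr0n// ler_nat ltnS. Qed.

(** Whatever lies between the balls of radius [s] and [u] is close to the ball of radius [t] once
    these two are close: the mass of a Borel set varies by at most the total mass of the shell
    between them. *)
Lemma ghp_close_sandwich (X : pmm R) (S : set (pt X)) (n : set (pt X) -> R) (s t u h : R) :
  bc_pmm X -> 0 <= t -> s <= t -> t <= u -> 0 < h ->
  (forall x, cb X u x -> exists y, cb X s y /\ @pd _ X x y < h) ->
  @ballm _ X u setT < @ballm _ X s setT + h ->
  good (ambpmm S n) -> cb X s `<=` S -> S `<=` cb X u ->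
  (forall A, borel X A -> (@pmu _ X (A `&` cb X s) <= (n A)%:E)%E) ->
  (forall A, borel X A -> ((n A)%:E <= @pmu _ X A)%E) ->
  @ghp_close _ h (ambpmm S n) (ballamb X t) (@pd _ X).
Proof.
move=> bX t0 st tu h0 hH hm gS sS Su low up.
have su : s <= u by exact: le_trans tu.
have [_ mX _] := bX; have BS := borel_supp gS; rewrite /= in BS.
have lowm A : borel X A -> @ballm _ X s A <= n A.
  by move=> BA; rewrite -lee_fin ballmE//; exact: low.
have upm A : borel X A -> n A <= @ballm _ X u A.
  move=> BA; have /= <- := mass_supp gS BA; have BAS : borel X (A `&` S) by exact: d_borelI.
  rewrite -lee_fin ballmE//; apply: (le_trans (up _ BAS)).
  apply: (measure_mono mX) => //; first by apply: d_borelI => //; exact: borel_cb.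
  exact: setIS.
have gap A : borel X A -> @ballm _ X u A <= @ballm _ X s A + h.
  move=> BA; have BT : borel X setT by exact: d_borelT.
  have Bs : borel X (cb X s) by exact: borel_cb.
  have BAs : borel X (A `&` cb X s) by exact: d_borelI.
  have BD : borel X (~` cb X s) by exact: d_borelC.
  have BAD : borel X (A `&` ~` cb X s) by exact: d_borelI.
  have mu := ballm_fm bX u.
  have e1 : @ballm _ X u A = @ballm _ X s A + @ballm _ X u (A `&` ~` cb X s).
    rewrite -(ballm_restrict su BA) -(fm_add mu)//.
      by rewrite -setIUr setUCr setIT.
    by rewrite setIACA setICr setI0.
  have e2 : @ballm _ X u setT = @ballm _ X s setT + @ballm _ X u (~` cb X s).
    rewrite -(ballm_restrict su BT) -(fm_add mu)//.
    - by rewrite setTI setUCr.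
    - by rewrite setTI.
    - by rewrite setTI setICr.
  have : @ballm _ X u (A `&` ~` cb X s) <= @ballm _ X u (~` cb X s).
    by apply: (fm_mono mu) => //; exact: subIsetr.
  by lra.
apply: ghp_close_same => //.
- exact: ballamb_good.
- move=> x /Su /hH[y [ys xy]]; exists y; split=> //; exact: le_trans st.
- move=> x xt; have [|y [ys xy]] := hH x; first exact: le_trans tu.
  by exists y; split=> //; exact: sS.
- move=> A /d_borel_closed BA; have := upm A BA; have := gap A BA.
  by have := ballm_mono bX st BA; lra.
- move=> A /d_borel_closed BA; have := lowm A BA; have := gap A BA.
  by have := ballm_mono bX tu BA; lra.
Qed.

Section OneSpace.
Variables (X : pmm R) (bX : bc_pmm X).

Let dM : is_metric (@pd _ X). Proof. by case: bX. Qed.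

Lemma pd_tri x y : @pd _ X (po X) y <= @pd _ X (po X) x + @pd _ X x y.
Proof. by case: dM. Qed.

Lemma pd_tri' x y : @pd _ X (po X) x <= @pd _ X (po X) y + @pd _ X x y.
Proof. by case: dM => _ _ dC dT; rewrite (dC x y). Qed.

Lemma pdxx x : @pd _ X x x = 0.
Proof. by case: dM => _ dE _ _; apply/dE. Qed.

Lemma uniform_cb (r : R) (Q : R -> pt X -> Prop) :
  (forall e e' x, e' <= e -> Q e x -> Q e' x) ->
  (forall x, cb X r x -> exists e, 0 < e /\ forall y, @pd _ X x y < e -> Q e y) ->
  exists e, 0 < e /\ forall x, cb X r x -> Q e x.
Proof.
move=> Qm QK; have [_ _ /(_ (po X) r)[cK _]] := bX.
exact: (d_compact_uniform (edist_pseudo dM) cK Qm QK).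
Qed.

Lemma ballm_right (t h : R) : 0 < h ->
  exists eta, 0 < eta /\ @ballm _ X (t + eta) setT < @ballm _ X t setT + h.
Proof.
move=> h0; have mu := ballm_fm bX (t + 1).
pose F (n : nat) := cb X (t + n.+1%:R^-1).
have BF n : borel X (F n) by exact: borel_cb.
have [|n] := fm_dec mu BF _ h0.
  by move=> n x; rewrite /F /cball /= => /le_trans; apply; rewrite lerD2l natSinv_anti.
have -> : \bigcap_n F n = cb X t.
  apply/seteqP; split=> [x Fx|x xt k _]; last first.
    by rewrite /F /cball /=; apply: le_trans xt _; rewrite lerDl invr_ge0 ler0n.
  rewrite /cball /= leNgt; apply/negP => tx.
  have [|k kx] := @natSinv_lt (@pd _ X (po X) x - t); first by rewrite subr_gt0.
  by have := Fx k Logic.I; rewrite /F /cball /= -lerBlDl leNgt kx.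
move=> hn; exists n.+1%:R^-1; split; first exact: natSinv_gt0.
have n1 : t + n.+1%:R^-1 <= t + 1.
  by rewrite lerD2l invf_le1 ?ltr0n// ler1n.
have t1 : t <= t + 1 by lra.
have BT : borel X setT by exact: d_borelT.
by rewrite -(ballm_restrict n1 BT) -(ballm_restrict t1 BT) !setTI.
Qed.

(** A point beyond radius [t] leaves the ball of radius [t + e] for small [e], together with its
    neighbours; a point of the ball is the witness for its neighbours. Compactness of the ball of
    radius [t + 1] makes [e] uniform. *)
Lemma hausdorff_right (t h : R) : 0 < h ->
  exists eta, 0 < eta /\ forall x, cb X (t + eta) x -> exists y, cb X t y /\ @pd _ X x y < h.
Proof.
move=> h0.
have [e e' x ee' Qx|x xt1|e [e0 eP]] := @uniform_cb (t + 1)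
    (fun e x => cb X (t + e) x -> exists y, cb X t y /\ @pd _ X x y < h).
- by move=> xt; apply: Qx; rewrite /cball /=; apply: le_trans xt _; rewrite lerD2l.
- have [xt|xt] := leP (@pd _ X (po X) x) t.
    exists h; split=> // y xy _; exists x; split=> //.
    by case: dM => _ _ dC _; rewrite dC.
  exists ((@pd _ X (po X) x - t) / 2); split; first by lra.
  by move=> y xy; rewrite /cball /= => yt; have := pd_tri' x y; lra.
- exists (Num.min e 1); split; first by rewrite lt_min e0 ltr01.
  have [m1 m2] : Num.min e 1 <= e /\ Num.min e 1 <= 1 by rewrite !ge_min !lexx orbT.
  move=> x; rewrite /cball /= => xt; apply: eP; rewrite /cball /=; lra.
Qed.

(** Valid at every radius, since a closed ball is the intersection of the larger ones; left
    continuity is what may fail. *)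
Lemma ball_right (t h : R) : 0 <= t -> 0 < h -> exists eta, 0 < eta /\
  forall s, t <= s -> s <= t + eta ->
  (dGHPc (ballpmm s X) (ballpmm t X) < h%:E)%E.
Proof.
move=> t0 h0; have h20 : 0 < h / 2 by lra.
have [a [a0 aP]] := ballm_right t h20; have [b [b0 bP]] := hausdorff_right t h20.
exists (Num.min a b); split; first by rewrite lt_min a0.
move=> s ts sab.
have [sa sb] : s <= t + a /\ s <= t + b.
  by move: sab; have := ge_min a a b; have := ge_min b a b; rewrite !lexx orbT /=; lra.
have s0 : 0 <= s by exact: le_trans ts.
have [gs gt] := (ballamb_good bX s0, ballamb_good bX t0).
have [[cs es] [ct et]] := (ballpmm_c_pmm bX s0, ballpmm_c_pmm bX t0).
apply/(dGHPc_ltP h cs ct gs gt es et).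
exists (h / 2), (@pd _ X); split; first by lra.
apply: (ghp_close_sandwich (s := t) (u := s)) => //.
- by move=> x xs; apply: bP; exact: le_trans sb.
- by apply: le_lt_trans aP; apply: ballm_mono => //; exact: d_borelT.
- by move=> x xt; exact: le_trans ts.
- by move=> A BA; rewrite -ballmE// lee_fin; exact: ballm_mono.
- move=> A BA; rewrite ballmE//; have [_ mX _] := bX.
  by apply: (measure_mono mX) => //; apply: d_borelI => //; exact: borel_cb.
Qed.

Definition sphere (r : R) : set (pt X) := [set x | @pd _ X (po X) x = r].

Lemma open_oball r : d_open (edist (@pd _ X)) (oball (@pd _ X) (po X) r).
Proof.
move=> x; rewrite /oball /= => xr.
exists (r - @pd _ X (po X) x); split; first by rewrite subr_gt0.
by move=> y; rewrite lte_fin => xy; have := pd_tri x y; lra.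
Qed.

Lemma borel_oball r : borel X (oball (@pd _ X) (po X) r).
Proof. by apply: d_borel_open; exact: open_oball. Qed.

Lemma cball_sphere r : cb X r `\` oball (@pd _ X) (po X) r = sphere r.
Proof.
apply/seteqP; split=> x; rewrite /cball /oball /sphere /=.
  by move=> [xr /negP]; rewrite -leNgt => rx; apply/eqP; rewrite eq_le xr.
by move=> ->; split=> //; rewrite ltxx.
Qed.

Lemma closed_sphere r : d_closed (edist (@pd _ X)) (sphere r).
Proof.
rewrite -cball_sphere setDE; apply: d_closedI; first exact: closed_cball.
by apply: d_openC; exact: open_oball.
Qed.

Lemma borel_sphere r : borel X (sphere r).
Proof. by apply: d_borel_closed; exact: closed_sphere. Qed.

(* Jumps of size [h] of the closed balls at radius [r], in the Hausdorff sense and in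
   mass. *)
Definition hjump (r h : R) := exists x, sphere r x /\
  forall y, @pd _ X (po X) y < r -> h <= @pd _ X x y.
Definition mjump (r h : R) := h <= @ballm _ X r (sphere r).
Definition jump (r h : R) := hjump r h \/ mjump r h.

Lemma jump_anti r h h' : h' <= h -> jump r h -> jump r h'.
Proof.
move=> hh' [[x [xr hx]]|hr]; [left|right].
  by exists x; split=> // y /hx; exact: le_trans.
exact: le_trans hr.
Qed.

Lemma no_jump_cont_radius (r : R) : 0 < r ->
  (forall n : nat, ~ jump r n.+1%:R^-1) -> cont_radius r X.
Proof.
move=> r0 nj; split=> //.
- apply/seteqP; split=> x xr.
    rewrite /cball /= leNgt; apply/negP => rx.
    have [|y] := xr (@pd _ X (po X) x - r); first by rewrite subr_gt0.
    by rewrite /oball /= lte_fin => -[yr xy]; have := pd_tri' x y; lra.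
  move=> e e0; have [xr'|xr'] := ltP (@pd _ X (po X) x) r.
    by exists x; split=> //; rewrite /edist pdxx lte_fin.
  have [n ne] := natSinv_lt e0; apply: contrapT => h; apply: (nj n); left.
  exists x; split; first by apply/eqP; rewrite eq_le xr' andbT.
  move=> y yr; rewrite leNgt; apply/negP => xy; apply: h; exists y; split=> //.
  by rewrite lte_fin; exact: lt_trans ne.
- have BS := borel_sphere r.
  rewrite cball_sphere -[sphere r](_ : sphere r `&` cb X r = _); last first.
    by apply: setIidl => x; rewrite /sphere /cball /= => ->.
  rewrite -ballmE//; congr EFin; apply/eqP; rewrite eq_le.
  rewrite (fm_ge0 (ballm_fm bX r))// andbT leNgt; apply/negP => pos.
  have [n ne] := natSinv_lt pos; apply: (nj n); right; exact: ltW.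
Qed.

(** Jumps in mass sit on disjoint spheres inside a ball of finite mass. For Hausdorff jumps, the
    witness at a radius keeps distance [h] from all points of smaller radius, so the witnesses are
    [h]-separated in a compact ball. *)
Lemma no_infinite_jumps (r_ : nat -> R) (h M : R) : injective r_ -> 0 < h ->
  (forall n, r_ n <= M) -> ~ (forall n, exists2 k, (n <= k)%N & jump (r_ k) h).
Proof.
move=> ri h0 rM hj.
have sub (P : nat -> Prop) : (forall n, exists2 k, (n <= k)%N & P k) ->
    exists f : nat -> nat, injective f /\ forall n, P (f n).
  move=> hP; have [g gP] := choice (fun n => let: ex_intro2 k nk Pk := hP n in
    ex_intro (fun k => (n <= k)%N /\ P k) k (conj nk Pk)).
  pose f := fix f n := if n is n'.+1 then g (f n').+1 else g 0%N.
  have fS n : (f n < f n.+1)%N by case: (gP (f n).+1).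
  have fm : {homo f : m n / (m < n)%N} by apply: homo_ltn => // ? ? ?; exact: ltn_trans.
  exists f; split; last by case=> [|n]; [case: (gP 0%N)|case: (gP (f n).+1)].
  by move=> m n fmn; case: (ltngtP m n) => // /fm; rewrite fmn ltnn.
have [_ _ /(_ (po X) M)[cK _]] := bX.
have [[N hN]|hh] := pselect (exists N, forall k, (N <= k)%N -> ~ hjump (r_ k) h).
- have [|f [fi fP]] := sub (fun k => mjump (r_ k) h).
    move=> n; have [k nk [hk|mk]] := hj (maxn n N); last first.
      by exists k => //; exact: leq_trans (leq_maxl _ _) nk.
    by case: (hN k) => //; exact: leq_trans (leq_maxr _ _) nk.
  have mu := ballm_fm bX M.
  (* One sphere more than the total mass divided by [h] allows. *)
  pose N1 := Num.trunc (@ballm _ X M setT / h).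
  pose P (i : 'I_N1.+1) := sphere (r_ (f i)).
  have BP i : borel X (P i) by exact: borel_sphere.
  have tP (i j : 'I_N1.+1) x : P i x -> P j x -> i = j.
    by rewrite /P /sphere /= => -> /ri /fi ij; exact: val_inj.
  have := fm_bigcup_fin mu [set: 'I_N1.+1]%SET BP tP.
  set V := [set _ | _] => VE.
  have : ballm M V <= @ballm _ X M setT.
    by apply: (fm_mono mu) => //; [exact: d_borel_fin|exact: d_borelT].
  rewrite VE leNgt => /negP; apply.
  apply: (@lt_le_trans _ _ (\sum_(i in [set: 'I_N1.+1]%SET) h)).
    rewrite sumr_const finset.cardsT card_ord -mulr_natr mulrC -ltr_pdivrMr//.
    exact: truncnS_gt.
  apply: ler_sum => i _; apply: le_trans (fP i) _.
  by apply: ballm_mono => //; exact: borel_sphere.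
- have [|f [fi fP]] := sub (fun k => hjump (r_ k) h).
    move=> n; apply: contrapT => nk; apply: hh; exists n => k kn hk.
    by apply: nk; exists k.
  have [x xP] := choice fP.
  apply: (d_compact_no_separated (edist_pseudo dM) (x := x) cK h0).
    by move=> n; case: (xP n); rewrite /sphere /cball /= => ->.
  have sep i j : r_ (f i) < r_ (f j) -> (h%:E <= edist (@pd _ X) (x j) (x i))%E.
    move=> ij; rewrite lee_fin; case: (xP j) => _; apply.
    by case: (xP i); rewrite /sphere /= => ->.
  move=> i j ij; case: (ltgtP (r_ (f i)) (r_ (f j))) => [/sep|/sep//|/ri/fi ij'].
    by rewrite (pseudo_sym (edist_pseudo dM)).
  by rewrite ij' eqxx in ij.
Qed.

End OneSpace.

(** An interval is uncountable, here because countable sets have Lebesgue measure zero; so some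
    [Q k] holds at infinitely many of its points. *)
Lemma interval_sequence (Q : nat -> R -> Prop) (a b : R) : a < b ->
  (forall r, a < r -> r < b -> exists k, Q k r) ->
  exists k (r_ : nat -> R), injective r_ /\
    forall n, [/\ a < r_ n, r_ n < b & Q k (r_ n)].
Proof.
move=> ab hQ; pose S k := [set r : R | [/\ a < r, r < b & Q k r]].
have [[k infk]|fin] := pselect (exists k, infinite_set (S k)).
  move/infiniteP/ppcard_leP: infk => [f]; exists k, f; split.
    by move=> m n /(@inj _ _ _ f); apply; rewrite inE.
  by move=> n; exact: (@funS _ _ _ _ f n Logic.I).
have : countable [set` `]a, b[ ].
  have -> : [set` `]a, b[ ] = \bigcup_k S k.
    apply/seteqP; split=> r /=; rewrite in_itv /=.
      by move=> /andP[ar rb]; have [k Qk] := hQ r ar rb; exists k.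
    by move=> [k _ [-> ->]].
  apply: bigcup_countable => // k _; apply: finite_set_countable.
  by apply: contrapT => infk; apply: fin; exists k.
move=> /countable_lebesgue_measure0; rewrite lebesgue_measure_itv /= lte_fin ab.
by move=> /eqP; rewrite -EFinD eqe subr_eq0 => /eqP ba; rewrite ba ltxx in ab.
Qed.

Lemma cont_radius_dense (X : pmm R) (a b : R) : bc_pmm X -> 0 <= a -> a < b ->
  exists r, [/\ a < r, r < b & cont_radius r X].
Proof.
move=> bX a0 ab; apply: contrapT => nr.
have [|k [r_ [ri rP]]] :=
    @interval_sequence (fun k r => jump X r k.+1%:R^-1) a b ab.
  move=> r ar rb; apply: contrapT => nk; apply: nr; exists r; split=> //.
  apply: no_jump_cont_radius => //; first exact: le_lt_trans ar.
  by move=> n jn; apply: nk; exists n.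
apply: (no_infinite_jumps bX ri (natSinv_gt0 k) (M := b)).
  by move=> n; case: (rP n) => _ /ltW.
by move=> n; exists n => //; case: (rP n).
Qed.

End Radii.

(** * Continuity of the ball map at continuity radii; closedness of mass jumps *)

Section Continuity.
Variable R : realType.
Local Notation cb X r := (cball (@pd _ X) (po X) r).
Local Notation borel X := (d_borel (edist (@pd _ X))).

Lemma ballm_left (X : pmm R) (t h : R) : bc_pmm X ->
  @pmu _ X (cb X t `\` oball (@pd _ X) (po X) t) = 0%E -> 0 < h ->
  exists eta, 0 < eta /\ @ballm _ X t setT < @ballm _ X (t - eta) setT + h.
Proof.
move=> bX mt h0; have mu := ballm_fm bX t.
have BT : borel X setT by exact: d_borelT.
pose F (n : nat) := cb X (t - n.+1%:R^-1).
have BF n : borel X (F n) by exact: borel_cb.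
have [|n] := fm_inc mu BF _ h0.
  move=> n x; rewrite /F /cball /= => /le_trans; apply.
  by rewrite lerD2l lerN2 natSinv_anti.
have -> : \bigcup_n F n = oball (@pd _ X) (po X) t.
  apply/seteqP; split=> x.
    move=> [k _]; rewrite /F /cball /oball /= => h1; apply: le_lt_trans h1 _.
    by rewrite gtrBl natSinv_gt0.
  rewrite /oball /= => xt; have [|k kx] := @natSinv_lt _ (t - @pd _ X (po X) x).
    by rewrite subr_gt0.
  by exists k => //; rewrite /F /cball /= lerBrDr -lerBrDl ltW.
have -> : @ballm _ X t (oball (@pd _ X) (po X) t) = @ballm _ X t setT.
  have Bo := borel_oball bX t; have Bs := borel_sphere bX t.
  have BD : borel X (~` oball (@pd _ X) (po X) t) by exact: d_borelC.
  have := fm_add mu Bo BD (setICr _); rewrite setUCr => ->.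
  suff -> : @ballm _ X t (~` oball (@pd _ X) (po X) t) = 0 by rewrite addr0.
  by rewrite /ballm setIC -setDE mt.
move=> hn; exists n.+1%:R^-1; split; first exact: natSinv_gt0.
have tn : t - n.+1%:R^-1 <= t by rewrite gerBl invr_ge0 ler0n.
by rewrite -(ballm_restrict tn BT) setTI.
Qed.

(** The closure condition supplies points of strictly smaller radius near each point of the sphere;
    the rest is the compactness argument of [hausdorff_right]. *)
Lemma hausdorff_cont (X : pmm R) (t h : R) : bc_pmm X ->
  d_closure (edist (@pd _ X)) (oball (@pd _ X) (po X) t) = cb X t -> 0 < h ->
  exists eta, 0 < eta /\ forall x, cb X (t + eta) x ->
    exists y, cb X (t - eta) y /\ @pd _ X x y < h.
Proof.
move=> bX ct h0; have [[_ _ dC dT] _ _] := bX.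
have [e e' x ee' Qx|x xt1|e [e0 eP]] := @uniform_cb _ X bX (t + 1)
    (fun e x => cb X (t + e) x -> exists y, cb X (t - e) y /\ @pd _ X x y < h).
- move=> xt; have [|y [ye xy]] := Qx.
    by rewrite /cball /=; apply: le_trans xt _; rewrite lerD2l.
  exists y; split=> //; rewrite /cball /=; apply: le_trans ye _.
  by rewrite lerD2l lerN2.
- have [xt|xt] := leP (@pd _ X (po X) x) t; last first.
    exists ((@pd _ X (po X) x - t) / 2); split; first by lra.
    by move=> y xy; rewrite /cball /= => yt; have := pd_tri' bX x y; lra.
  have : cb X t x by []; rewrite -ct => /(_ (h / 2))[|y]; first by lra.
  rewrite lte_fin => -[yt xy]; rewrite /oball /= in yt.
  exists (Num.min (h / 2) (t - @pd _ X (po X) y)); split.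
    by rewrite lt_min subr_gt0 yt andbT; lra.
  move=> z; rewrite lt_min => /andP[xz _] _; exists y; split.
    by rewrite /cball /= lerBrDl -lerBrDr ge_min lexx orbT.
  by have := dT z x y; rewrite (dC z x); lra.
- exists (Num.min e 1); split; first by rewrite lt_min e0 ltr01.
  have [m1 m2] : Num.min e 1 <= e /\ Num.min e 1 <= 1 by rewrite !ge_min !lexx orbT.
  move=> x; rewrite /cball /= => xt.
  have [||y [ye xy]] := eP x; rewrite /cball /= in xt *; [lra|lra|].
  exists y; split=> //; rewrite /cball /= in ye *; lra.
Qed.

(** The bound on [eta * (r + 1)] makes [1 / e] at least [r + 1], so the comparison covers the ball
    of radius [r] with a margin. *)
Lemma dGHP_near (X X' : pmm R) (r eta : R) : bc_pmm X -> bc_pmm X' -> 0 <= r ->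
  0 < eta -> eta <= 1 -> eta * (r + 1) <= 1 -> dGHP X' X < eta ->
  exists e c, [/\ 0 < e, e < eta, c < e / 2, r + 1 <= e^-1 &
    approx e^-1 (e^-1 - e) c X' X].
Proof.
move=> bX bX' r0 eta0 eta1 etar /(dGHP_approxP bX' bX eta1)[e [c [_ [e0 ee [ce _] h _]]]].
exists e, c; split=> //; rewrite -(ler_pM2l e0) divff ?gt_eqF//.
by apply: le_trans etar; apply: ler_wpM2r; [lra|exact: ltW].
Qed.

Lemma small_radius (r : R) : 0 <= r ->
  exists eta, [/\ 0 < eta, eta <= 1 & eta * (r + 1) <= 1].
Proof.
move=> r0; have r1 : 0 < r + 1 by lra.
exists (r + 1)^-1; split; first by rewrite invr_gt0.
- by rewrite invf_le1//; lra.
- by rewrite mulVf// gt_eqF.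
Qed.

(** Shrinking the approximation to radius [t] gives a subspace of [X] between the balls of radius
    [t - e] and [t + e]; at a continuity radius of [X] any such subspace is close to the ball of
    radius [t]. *)
Lemma ball_cont (X : pmm R) (t h : R) : bc_pmm X -> cont_radius t X -> 0 < h ->
  exists eta, 0 < eta /\ forall X', bc_pmm X' -> dGHP X' X < eta ->
    (dGHPc (ballpmm t X') (ballpmm t X) < h%:E)%E.
Proof.
move=> bX [t0 ct mt] h0; have tge0 := ltW t0; have h20 : 0 < h / 2 by lra.
have h40 : 0 < h / 4 by lra.
have [a1 [a10 a1P]] := ballm_right bX t h40.
have [a2 [a20 a2P]] := ballm_left bX mt h40.
have [a3 [a30 a3P]] := hausdorff_cont bX ct h20.
have [a4 [a40 a41 a4t]] := small_radius tge0.
pose eta := Num.min (Num.min a1 a2) (Num.min (Num.min a3 a4) h).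
have : eta <= eta by [].
rewrite {2}/eta !le_min => /andP[/andP[n1 n2] /andP[/andP[n3 n4] n5]].
have eta0 : 0 < eta by rewrite /eta !lt_min a10 a20 a30 a40.
exists eta; split=> // X' bX' X'X.
have [||e [c [e0 ee ce te h1]]] := dGHP_near bX bX' tge0 eta0 _ _ X'X.
- by lra.
- by apply: le_trans a4t; apply: ler_wpM2r => //; lra.
pose c' := (c + e / 2) / 2; have [cc' c'e] : c < c' /\ c' < e / 2 by rewrite /c'; lra.
have h2 : approx t (t - e) c' X' X by apply: (approx_shrink bX' bX tge0 _ h1 cc'); lra.
have [S [n [w [gS k1 k2 k3 cw]]]] := h2.
have [gt' gt] := (ballamb_good bX' tge0, ballamb_good bX tge0).
have [[ct' et'] [ct1 et]] := (ballpmm_c_pmm bX' tge0, ballpmm_c_pmm bX tge0).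
apply/(dGHPc_ltP h ct' ct1 gt' gt et' et).
exists (c' + h / 2), (cross_comp w (@pd _ X)); split; first by lra.
apply: (ghp_close_comp (Y := ambpmm S n)) => //.
apply: (ghp_close_sandwich (s := t - e) (u := t + e)) => //; try lra.
- move=> x xt; have [|y [yt xy]] := a3P x.
    by rewrite /cball /=; apply: le_trans xt _; lra.
  by exists y; split=> //; rewrite /cball /= in yt *; lra.
- have BT : borel X setT by exact: d_borelT.
  have e1 : t + e <= t + a1 by lra.
  have e2 : t - a2 <= t - e by lra.
  by have := ballm_mono bX e1 BT; have := ballm_mono bX e2 BT; lra.
- move=> x Sx; rewrite /cball /=.
  by have := ghp_close_supp_bound gS cw Sx; rewrite /=; lra.
Qed.

Lemma closed_dMstar (P : Mstar R -> Prop) :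
  (forall X : Mstar R, ~ P X -> exists eta, 0 < eta /\ forall X' : Mstar R,
     dGHP (sval X') (sval X) < eta -> ~ P X') -> d_closed (@dMstar R) P.
Proof.
move=> hP X /hP[eta [eta0 h]]; exists eta; split=> // X'.
by rewrite lte_fin /= dGHP_sym => /h.
Qed.

(** If the sphere of [X] has mass below [h], so has a thin shell around it. The sphere of a nearby
    space is carried into that shell, and its mass exceeds that of the shell by at most [c]. *)
Lemma closed_mjump (r h : R) : 0 < r ->
  d_closed (@dMstar R) [set X | mjump (sval X) r h].
Proof.
move=> r0; apply: closed_dMstar => X; rewrite /mjump /= => /negP; rewrite -ltNge => mh.
have bX := svalP X; rewrite /= in bX; set X0 := sval X in bX mh *.
have mu := ballm_fm bX (r + 1).
pose F (n : nat) := cb X0 (r + n.+1%:R^-1) `\` oball (@pd _ X0) (po X0) (r - n.+1%:R^-1).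
have BF n : borel X0 (F n).
  by apply: d_borelD; [exact: borel_cb|exact: borel_oball].
(* Half of the room below [h] goes to the shell, half to the error [c]. *)
pose gap := (h - @ballm _ X0 r (sphere (X := X0) r)) / 2.
have gap0 : 0 < gap by rewrite /gap; lra.
have r1 : r <= r + 1 by lra.
have sph1 : @ballm _ X0 (r + 1) (sphere (X := X0) r) = @ballm _ X0 r (sphere (X := X0) r).
  rewrite -(ballm_restrict r1 (borel_sphere bX r)); congr ballm.
  by rewrite setIidl// => x; rewrite /sphere /cball /= => ->.
have [|n] := fm_dec mu BF _ gap0.
  move=> n x [h1 h2]; rewrite /F /cball /oball /= in h1 h2 *.
  have a := natSinv_anti R (leqnSn n); split.
    by apply: le_trans h1 _; rewrite lerD2l.
  by move=> h3; apply: h2; apply: lt_le_trans h3 _; rewrite lerD2l lerN2.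
have -> : \bigcap_n F n = sphere (X := X0) r.
  apply/seteqP; split=> x; last first.
    rewrite /sphere /= => xr k _; rewrite /F /cball /oball /= xr; split.
      by rewrite lerDl invr_ge0 ler0n.
    by apply/negP; rewrite -leNgt gerBl invr_ge0 ler0n.
  move=> Fx; apply: contrapT => /eqP; rewrite neq_lt => /orP[xr|xr].
    have [|k kx] := @natSinv_lt _ (r - @pd _ X0 (po X0) x); first by rewrite subr_gt0.
    have [_] := Fx k Logic.I; rewrite /oball /=; apply.
    by rewrite ltrBrDr -ltrBrDl.
  have [|k kx] := @natSinv_lt _ (@pd _ X0 (po X0) x - r); first by rewrite subr_gt0.
  by have [] := Fx k Logic.I; rewrite /cball /= -lerBlDl leNgt kx.
rewrite sph1 => mF; pose u : R := n.+1%:R^-1; have u0 : 0 < u by exact: natSinv_gt0.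
have u1 : u <= 1 by rewrite /u invf_le1 ?ltr0n// ler1n.
have [a4 [a40 a41 a4t]] := small_radius (ltW r0).
pose eta := Num.min (Num.min a4 u) gap.
have : eta <= eta by [].
rewrite {2}/eta !le_min => /andP[/andP[n4 nu] ngap].
have eta0 : 0 < eta by rewrite /eta !lt_min a40 u0.
exists eta; split=> // X' X'X; have bX' := svalP X'; rewrite /= in bX'.
have [||e [c [e0 ee ce re [S [m [w [gS k1 k2 k3 [cw [oo s1 m1] _]]]]]]]] :=
  dGHP_near bX bX' (ltW r0) eta0 _ _ X'X.
- by lra.
- by apply: le_trans a4t; apply: ler_wpM2r => //; lra.
set X1 := sval X' in bX' X'X w cw oo s1 m1 *.
have rr : r <= e^-1 by lra.
have sph2 : @ballm _ X1 e^-1 (sphere (X := X1) r) = @ballm _ X1 r (sphere (X := X1) r).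
  rewrite -(ballm_restrict rr (borel_sphere bX' r)); congr ballm.
  by rewrite setIidl// => x; rewrite /sphere /cball /= => ->.
have cS : d_closed (edist (@pd _ X1)) (sphere (X := X1) r) by exact: closed_sphere.
have := m1 _ cS; rewrite /= sph2 => m2; apply/negP; rewrite -ltNge.
have dM : is_metric (@pd _ X0) by case: bX.
have Bt : borel X0 (thick w (sphere (X := X1) r) c) by exact: borel_thick cw.
have Bt1 : borel X0 (F n `&` cb X0 (r + 1)).
  by apply: d_borelI => //; exact: borel_cb.
suff tF : thick w (sphere (X := X1) r) c `<=` F n.
  have m3 : m (thick w (sphere (X := X1) r) c) <= @ballm _ X0 (r + 1) (F n).
    rewrite -lee_fin ballmE//; apply: (le_trans (k3 _ Bt)).
    have [_ mX _] := bX; apply: (measure_mono mX) => // y /tF Fy; split=> //.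
    by case: Fy => + _; rewrite /cball /= => /le_trans; apply; rewrite lerD2l.
  by apply: le_lt_trans m2 _; rewrite /gap in mF ngap; lra.
have [w1 w2 w3 w4] := cw.
have bnd y : thick w (sphere (X := X1) r) c y ->
    r - 2 * c <= @pd _ X0 (po X0) y <= r + 2 * c.
  move=> ty; apply/andP; split; apply/ler_addgt0Pr => del del0;
    have [a [ar ay]] := ty _ del0; rewrite /sphere /= in ar.
    have := w3 (po X1) a y; have := w2 (po X1) y (po X0).
    by move: oo ar; rewrite /= => oo ->; lra.
  have := w4 (po X1) (po X0) y; have := w1 (po X1) a y.
  by move: oo ar; rewrite /= => oo ->; lra.
move=> y /bnd/andP[y1 y2]; rewrite /F /cball /oball /= -/u; split; first lra.
by apply/negP; rewrite -leNgt; lra.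
Qed.
End Continuity.

(** * Closedness of Hausdorff jumps; continuity radii of laws; measurability of the ball map *)

Section Laws.
Variable R : realType.
Local Notation cb X r := (cball (@pd _ X) (po X) r).

(** Without a jump, each point of the sphere of [X] has a partner of smaller radius closer than [h];
    by compactness this holds on a thin shell with a uniform margin. A sphere point of a nearby
    space is moved into the shell, to its partner, and back. *)
Lemma closed_hjump (r h : R) : 0 < r ->
  d_closed (@dMstar R) [set X | hjump (sval X) r h].
Proof.
move=> r0; apply: closed_dMstar => X; rewrite /= => nj.
have bX := svalP X; rewrite /= in bX; set X0 := sval X in bX nj *.
have [[_ _ dC dT] _ _] := bX.
have near x : @pd _ X0 (po X0) x = r ->
    exists y, @pd _ X0 (po X0) y < r /\ @pd _ X0 x y < h.
  move=> xr; apply: contrapT => ny; apply: nj; exists x; split=> // y yr.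
  by rewrite leNgt; apply/negP => xy; apply: ny; exists y.
have [e e' x ee' Qx|x xt1|a [a0 aP]] := @uniform_cb _ X0 bX (r + 1)
    (fun e x => r - e <= @pd _ X0 (po X0) x -> @pd _ X0 (po X0) x <= r + e ->
      exists y, @pd _ X0 (po X0) y <= r - e /\ @pd _ X0 x y <= h - e).
- move=> xl xu; have [||y [yr xy]] := Qx; [lra|lra|].
  by exists y; split; lra.
- have [xr|xr|xr] := ltgtP (@pd _ X0 (po X0) x) r.
  + exists ((r - @pd _ X0 (po X0) x) / 2); split; first by lra.
    by move=> y xy; have := pd_tri bX x y; lra.
  + exists ((@pd _ X0 (po X0) x - r) / 2); split; first by lra.
    by move=> y xy; have := pd_tri' bX x y; lra.
  + have [y [yr xy]] := near x xr.
    pose e := Num.min (r - @pd _ X0 (po X0) y) ((h - @pd _ X0 x y) / 2).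
    have : e <= e by []; rewrite {2}/e le_min => /andP[e1 e2].
    exists e; split; first by rewrite lt_min; apply/andP; split; lra.
    move=> z xz _ _; exists y; split; first by lra.
    by have := dT z x y; rewrite (dC z x); lra.
have [a4 [a40 a41 a4t]] := small_radius (ltW r0).
pose eta := Num.min a4 a; have : eta <= eta by [].
rewrite {2}/eta !le_min => /andP[n4 na].
have eta0 : 0 < eta by rewrite /eta !lt_min a40.
exists eta; split=> // X' X'X; have bX' := svalP X'; rewrite /= in bX'.
have [||e [c [e0 ee ce re [S [m [w [gS k1 k2 k3 [cw [oo s1 _] [_ s2 _]]]]]]]]] :=
  dGHP_near bX bX' (ltW r0) eta0 _ _ X'X.
- by lra.
- by apply: le_trans a4t; apply: ler_wpM2r => //; lra.
set X1 := sval X' in bX' X'X w cw oo s1 s2 *.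
rewrite /= in oo s1 s2; rewrite /flip in s2.
have [w1 w2 w3 w4] := cw; rewrite /= in w1 w2 w3 w4.
move=> [x' [x'r hx']]; rewrite /sphere /= in x'r.
have [|x [Sx x'x]] := s1 x'; first by rewrite /cball /= x'r; lra.
have xu : @pd _ X0 (po X0) x <= r + 2 * c.
  have := w4 (po X1) (po X0) x; have := w1 (po X1) x' x.
  by move: oo x'r => oo ->; lra.
have xl : r - 2 * c <= @pd _ X0 (po X0) x.
  have := w3 (po X1) x' x; have := w2 (po X1) x (po X0).
  by move: oo x'r => oo ->; lra.
have [|||y [yr xy]] := aP x; [by rewrite /cball /=; lra|lra|lra|].
have Sy : S y by apply: k1; rewrite /cball /=; lra.
have [y' [_ y'y]] := s2 y Sy.
have y'r : @pd _ X1 (po X1) y' < r.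
  have := w3 (po X1) y' y; have := w2 (po X1) y (po X0); move: oo yr; lra.
have := hx' y' y'r; rewrite leNgt => /negP; apply.
have := w3 x' y' y; have := w2 x' y x; lra.
Qed.

Lemma closed_jump (r h : R) : 0 < r -> d_closed (@dMstar R) [set X | jump (sval X) r h].
Proof.
move=> r0.
have -> : [set X : Mstar R | jump (sval X) r h] =
    [set X | hjump (sval X) r h] `|` [set X | mjump (sval X) r h] by [].
by apply: d_closedU; [exact: closed_hjump|exact: closed_mjump].
Qed.

Lemma law_fm (m : set (Mstar R) -> \bar R) : law m ->
  fmeas (@dMstar R) (fun A => fine (m A)).
Proof. by move=> [mm m1]; apply: fm_of_finite_measure => //; rewrite m1 ltry. Qed.

Lemma law_EFin (m : set (Mstar R) -> \bar R) A : law m ->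
  d_borel (@dMstar R) A -> m A = (fine (m A))%:E.
Proof.
move=> [mm m1] BA; apply: (fine_measure_EFin mm BA).
apply: (@le_lt_trans _ _ (m setT)); last by rewrite m1 ltry.
by apply: (measure_mono mm) => //; exact: d_borelT.
Qed.

Lemma cont_radius_law_dense (m : set (Mstar R) -> \bar R) (a b : R) : law m ->
  0 <= a -> a < b -> exists r, [/\ a < r, r < b & cont_radius_law r m].
Proof.
move=> lm a0 ab; apply: contrapT => nr; have fm := law_fm lm.
pose J (k : nat) (r : R) := [set X : Mstar R | jump (sval X) r k.+1%:R^-1].
have BJ k r : 0 < r -> d_borel (@dMstar R) (J k r).
  by move=> r0; apply: d_borel_closed; exact: closed_jump.
have [|k [r_ [ri rP]]] :=
    @interval_sequence _ (fun k r => k.+1%:R^-1 < fine (m (J k r))) a b ab.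
  move=> r ar rb; apply: contrapT => nk; apply: nr; exists r; split=> //.
  have r0 : 0 < r by exact: le_lt_trans ar.
  split=> //; exists (\bigcup_k J k r); split.
    by apply: d_borel_bigcup => k; exact: BJ.
  split; last first.
    move=> X nX; apply: no_jump_cont_radius => //; first exact: svalP X.
    by move=> n jn; apply: nX; exists n.
  rewrite (law_EFin lm); last by apply: d_borel_bigcup => k; exact: BJ.
  congr EFin; apply: (fm_null_bigcup fm) => k; first exact: BJ.
  apply/eqP; rewrite eq_le (fm_ge0 fm) ?andbT; last exact: BJ.
  rewrite leNgt; apply/negP => pos; have [n npos] := natSinv_lt pos.
  (* Jumps of one size are jumps of every smaller size, so a single index can serve as jump size and
     as lower bound of the probability. *)
  apply: nk; exists (maxn k n).
  apply: (@le_lt_trans _ _ n.+1%:R^-1); first by rewrite natSinv_anti// leq_maxr.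
  apply: lt_le_trans npos _; apply: (fm_mono fm); [exact: BJ|exact: BJ|].
  by move=> X; apply: jump_anti; rewrite natSinv_anti// leq_maxl.
have r0 n : 0 < r_ n by case: (rP n) => ar _ _; exact: le_lt_trans ar.
(* Tails of the upper limit of the jump events: their intersection is empty by [no_infinite_jumps],
   while each keeps probability above [k.+1%:R^-1]. *)
pose G n := \bigcup_j J k (r_ (n + j)%N).
have BG n : d_borel (@dMstar R) (G n) by apply: d_borel_bigcup => j; exact: BJ.
have [|n] := fm_dec fm BG _ (natSinv_gt0 R k).
  move=> n X [j _ Xj]; exists j.+1 => //; by rewrite addnS -addSn.
have -> : \bigcap_n G n = set0.
  apply/seteqP; split=> // X GX.
  apply: (no_infinite_jumps (svalP X) ri (natSinv_gt0 R k) (M := b)).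
    by move=> i; case: (rP i) => _ /ltW.
  by move=> i; have [j _ Xj] := GX i Logic.I; exists (i + j)%N => //; exact: leq_addr.
rewrite (fm0 fm) add0r ltNge => /negP; apply.
case: (rP n) => _ _ /ltW /le_trans; apply; apply: (fm_mono fm); [exact: BJ|exact: BG|].
by move=> X Xn; exists 0%N; rewrite ?addn0.
Qed.

Definition ballMc (r : R) (r0 : 0 <= r) (X : Mstar R) : Mc R :=
  exist _ (ballpmm r (sval X)) (proj1 (ballpmm_c_pmm (svalP X) r0)).

Lemma law_ballE (r : R) (r0 : 0 <= r) (m : set (Mstar R) -> \bar R) A :
  law_ball r m A = m (ballMc r0 @^-1` A).
Proof.
rewrite /law_ball; congr m; apply/seteqP; split=> X /=.
  move=> [[Y cY] [AY /= YX]]; subst Y; rewrite /ballMc.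
  by rewrite (Prop_irrelevance (proj1 _) cY).
by move=> AX; exists (ballMc r0 X).
Qed.

(* By right continuity, [ballMc r X] lies in an open set iff for some [k], [l] all
   balls of radius in ]r, r + 1/l[ keep distance 1/k from its complement; the
   set of such [X] is closed, because continuity radii are dense. *)
Lemma borel_ball_preimage (r : R) (r0 : 0 <= r) F : d_closed (@dMc R) F ->
  d_borel (@dMstar R) (ballMc r0 @^-1` F).
Proof.
move=> cF; have pM := @dGHPc_pseudo R.
pose Fk (k : nat) := [set Y : Mc R | forall Z, F Z -> (k.+1%:R^-1%:E <= dMc Y Z)%E].
pose C k (l : nat) := [set X : Mstar R | forall t (t0 : 0 <= t), r < t ->
  t < r + l.+1%:R^-1 -> Fk k (ballMc t0 X)].
have right (X : Mstar R) t (t0 : 0 <= t) e : 0 < e -> exists eta, 0 < eta /\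
    forall s (s0 : 0 <= s), t <= s -> s <= t + eta ->
    (dMc (ballMc s0 X) (ballMc t0 X) < e%:E)%E.
  move=> e0; have [eta [eta0 h]] := ball_right (svalP X) t0 e0.
  by exists eta; split=> // s s0 ts st; exact: h.
(* A violation at [t] persists at slightly larger radii; one of these is a continuity radius of [X],
   where the ball map is continuous, so the violation passes to all [X'] near [X]. *)
have cC k l : d_closed (@dMstar R) (C k l).
  apply: closed_dMstar => X /existsNP[t /existsNP[t0 /not_implyP[rt /not_implyP[tl]]]].
  move=> /existsNP[Z /not_implyP[FZ /negP]]; rewrite -ltNge => /lte_EFin_between[e' e'k tZ].
  pose h := k.+1%:R^-1 - e'; have h0 : 0 < h by rewrite subr_gt0.
  have h20 : 0 < h / 2 by rewrite divr_gt0.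
  have [eta [eta0 hR]] := right X t t0 _ h20.
  have [|s [ts st cs]] := @cont_radius_dense _ (sval X) t
      (Num.min (t + eta) (r + l.+1%:R^-1)) (svalP X) t0.
    by rewrite lt_min tl andbT ltrDl.
  move: st; rewrite lt_min => /andP[st sl].
  have s0 : 0 <= s by apply: le_trans t0 (ltW ts).
  have [eta' [eta'0 hC]] := ball_cont (svalP X) cs h20.
  exists eta'; split=> // X' X'X CX'.
  have := CX' s s0 (lt_trans rt ts) sl Z FZ; rewrite leNgt => /negP; apply.
  have -> : k.+1%:R^-1 = h / 2 + (h / 2 + e') :> R by rewrite /h; field.
  apply: (pseudo_trans pM (y := ballMc s0 X)); first exact: hC (svalP X') X'X.
  by apply: (pseudo_trans pM) tZ; apply: hR; exact: ltW.
have -> : ballMc r0 @^-1` F = ~` (\bigcup_k \bigcup_l C k l).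
  apply/seteqP; split=> X.
    move=> FX [k _ [l _ CX]].
    have [eta [eta0 hR]] := right X r r0 _ (natSinv_gt0 R k).
    pose u := Num.min eta l.+1%:R^-1 / 2.
    have m0 : 0 < Num.min eta l.+1%:R^-1 by rewrite lt_min eta0 natSinv_gt0.
    have [m1 m2] : Num.min eta l.+1%:R^-1 <= eta /\ Num.min eta l.+1%:R^-1 <= l.+1%:R^-1.
      by rewrite !ge_min !lexx orbT.
    have u0 : 0 < u by rewrite divr_gt0.
    have u1 : u < Num.min eta l.+1%:R^-1 by rewrite /u; lra.
    have t0 : 0 <= r + u by rewrite addr_ge0// ltW.
    have := CX (r + u) t0; rewrite ltrDl ltrD2l => /(_ u0 (lt_le_trans u1 m2)).
    move=> /(_ _ FX); rewrite leNgt => /negP; apply.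
    apply: hR; first by rewrite lerDl ltW.
    by rewrite lerD2l; apply: le_trans (ltW u1) m1.
  move=> nC; apply: contrapT => /cF[e [e0 eF]]; apply: nC.
  have e20 : 0 < e / 2 by rewrite divr_gt0.
  have [k ke] := natSinv_lt e20.
  have [eta [eta0 hR]] := right X r r0 _ e20; have [l le] := natSinv_lt eta0.
  exists k => //; exists l => // t t0 rt tl Z FZ; rewrite leNgt; apply/negP => tZ.
  apply: (eF Z) => //; rewrite (splitr e).
  apply: (pseudo_trans pM (y := ballMc t0 X)).
    rewrite (pseudo_sym pM); apply: hR; first exact: ltW.
    by apply: ltW; apply: lt_trans tl _; rewrite ltrD2l.
  by apply: lt_trans tZ _; rewrite lte_fin.
apply: d_borelC; apply: d_borel_bigcup => k; apply: d_borel_bigcup => l.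
exact: d_borel_closed.
Qed.

End Laws.

(** * Weak convergence *)

Section Convergence.
Variable R : realType.

Lemma cvge0_ltP (u : nat -> \bar R) : (forall n, (0 <= u n)%E) ->
  (u @ \oo --> 0%E) <->
  forall e : R, 0 < e -> exists N, forall n, (N <= n)%N -> (u n < e%:E)%E.
Proof.
move=> u0; split=> [/fine_cvgP[[N1 _ fu] /cvgrPdist_lt cu] e e0|h].
  have [N2 _ hN] := cu e e0; exists (maxn N1 N2) => n; rewrite geq_max => /andP[n1 n2].
  have := hN n n2; rewrite /= sub0r normrN => /ltr_normlP[_ ue].
  by rewrite -(fineK (fu n n1)) lte_fin.
have fin n (e : R) : (u n < e%:E)%E -> u n \is a fin_num.
  by move=> ue; rewrite ge0_fin_numE//; apply: lt_trans ue (ltry _).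
apply/fine_cvgP; split.
  by have [N hN] := h 1 ltr01; exists N => // n /hN /fin.
apply/cvgrPdist_lt => e e0; have [N hN] := h e e0; exists N => // n /hN ue /=.
rewrite sub0r normrN ger0_norm ?fine_ge0//.
by rewrite -lte_fin fineK//; exact: fin ue.
Qed.

Section Prokhorov.
Variables (T : Type) (d : T -> T -> \bar R).

Lemma prokhorov_ltP (m1 m2 : set T -> \bar R) (a : R) :
  (prokhorov d m1 m2 < a%:E)%E <-> exists e, [/\ 0 < e, e < a &
    forall A, d_closed d A -> (m1 A <= m2 (d_nbhd d A e) + e%:E /\
      m2 A <= m1 (d_nbhd d A e) + e%:E)%E].
Proof.
split=> [/ereal_inf_ltP[_ [e [e0 h] <-]]|[e [e0 ea h]]].
  by rewrite lte_fin => ea; exists e.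
by apply/ereal_inf_ltP; exists e%:E => //; exists e.
Qed.

Lemma prokhorov_ge0 (m1 m2 : set T -> \bar R) : (0 <= prokhorov d m1 m2)%E.
Proof.
by apply: le_ereal_inf_tmp => _ [e [e0 _] <-]; rewrite lee_fin ltW.
Qed.

End Prokhorov.

Let pM := @dGHP_pseudo R.
Let pMc := @dGHPc_pseudo R.

Lemma law_mono (m : set (Mstar R) -> \bar R) A A' : law m ->
  d_borel (@dMstar R) A -> d_borel (@dMstar R) A' -> A `<=` A' -> (m A <= m A')%E.
Proof. by move=> [mm _]; exact: measure_mono. Qed.

(** Two errors of [e / 4], one from the neighbourhood and one from the closure, keep the balls
    within [e / 2], which brings [dGHP] below [2 * e]. *)
Lemma ball_prokhorov_bound (m1 m2 : set (Mstar R) -> \bar R) (r e c : R) (r0 : 0 <= r) A :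
  law m1 -> law m2 -> 0 < e -> e^-1 <= r -> 0 < c -> c < e / 4 ->
  (forall B, d_closed (@dMc R) B ->
    (law_ball r m1 B <= law_ball r m2 (d_nbhd (@dMc R) B c) + c%:E)%E) ->
  d_closed (@dMstar R) A ->
  (m1 A <= m2 (d_nbhd (@dMstar R) A (2 * e)) + (2 * e)%:E)%E.
Proof.
move=> l1 l2 e0 er c0 ce hc cA.
pose B := d_closure (@dMc R) (ballMc r0 @` A).
have cB : d_closed (@dMc R) B by exact: d_closed_closure.
have cBc : d_closed (@dMc R) (d_nbhd (@dMc R) B c) by exact: d_closed_nbhd.
have cAe : d_closed (@dMstar R) (d_nbhd (@dMstar R) A (2 * e)) by exact: d_closed_nbhd.
apply: (@le_trans _ _ (m1 (ballMc r0 @^-1` B))).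
  apply: law_mono => //; [exact: d_borel_closed|exact: borel_ball_preimage|].
  by move=> X AX; apply: (sub_d_closure pMc); exists X.
rewrite -law_ballE; apply: (le_trans (hc _ cB)).
apply: leeD; last by rewrite lee_fin; lra.
rewrite law_ballE; apply: law_mono => //.
- exact: borel_ball_preimage.
- exact: d_borel_closed.
- move=> X XB; have [Z [BZ XZ]] := d_nbhd_lt ce XB.
  have e40 : 0 < e / 4 by lra.
  have [_ [[Y AY <-] ZY]] := BZ _ e40.
  apply: (d_nbhd_mem AY); rewrite lee_fin; apply: ltW.
  apply: (dGHPc_ball_dGHP (svalP X) (svalP Y) e0 _ er); first by lra.
  have -> : e / 2 = e / 4 + e / 4 by lra.
  exact: (pseudo_trans pMc XZ ZY).
Qed.

Lemma wconv_of_balls (mn : nat -> set (Mstar R) -> \bar R) (m : set (Mstar R) -> \bar R)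
    (D : set R) : (forall n, law (mn n)) -> law m -> D `<=` [set r | 0 <= r] ->
  (forall M, exists r, D r /\ M < r) -> (forall r, D r -> wconv_ball r mn m) ->
  wconv mn m.
Proof.
move=> ln lm D0 Dunb Dconv; apply/cvge0_ltP => [n|e e0]; first exact: prokhorov_ge0.
pose f := e / 3; have f0 : 0 < f by rewrite /f; lra.
have [r [Dr fr]] := Dunb f^-1; have r0 : 0 <= r by exact: D0.
have f40 : 0 < f / 4 by lra.
have [|N hN] := (cvge0_ltP _).1 (Dconv r Dr) (f / 4) f40.
  by move=> n; exact: prokhorov_ge0.
exists N => n /hN /prokhorov_ltP[c [c0 cf hc]]; apply/prokhorov_ltP.
exists (2 * f); split; [lra|by rewrite /f; lra|move=> A cA; split].
- by apply: (ball_prokhorov_bound r0 (ln n) lm f0 (ltW fr) c0 cf) => // B /hc[].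
- by apply: (ball_prokhorov_bound r0 lm (ln n) f0 (ltW fr) c0 cf) => // B /hc[].
Qed.

(** Two neighbours are compared with each other, not with [X]: in this form the set is open by the
    triangle inequality. *)
Definition oscillation (r : R) (r0 : 0 <= r) (e delta : R) : set (Mstar R) :=
  [set X | exists Y Y', [/\ (dMstar X Y < delta%:E)%E, (dMstar X Y' < delta%:E)%E &
     (e%:E <= dMc (ballMc r0 Y) (ballMc r0 Y'))%E]].

Lemma open_oscillation (r : R) (r0 : 0 <= r) (e delta : R) :
  d_open (@dMstar R) (oscillation r0 e delta).
Proof.
move=> X [Y [Y' [/lte_EFin_between[a ad XY] /lte_EFin_between[a' a'd XY'] h]]].
exists (Num.min (delta - a) (delta - a')); split; first by rewrite lt_min !subr_gt0 ad.
move=> X' XX'; have [m1 m2] := (ge_min (delta - a) (delta - a) (delta - a'),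
  ge_min (delta - a') (delta - a) (delta - a')).
rewrite !lexx orbT in m1 m2; exists Y, Y'; split=> //.
- rewrite -(subrK a delta); apply: (pseudo_trans pM) XY.
  by rewrite (pseudo_sym pM); apply: lt_le_trans XX' _; rewrite lee_fin.
- rewrite -(subrK a' delta); apply: (pseudo_trans pM) XY'.
  by rewrite (pseudo_sym pM); apply: lt_le_trans XX' _; rewrite lee_fin.
Qed.

(** The sets decrease with [delta], and a point in all of them is a discontinuity of the ball map,
    hence lies in the null set [N]. *)
Lemma oscillation_small (r : R) (r0 : 0 <= r) (e eta : R) (m : set (Mstar R) -> \bar R) :
  law m -> cont_radius_law r m -> 0 < e -> 0 < eta ->
  exists delta, 0 < delta /\ (m (oscillation r0 e delta) < eta%:E)%E.
Proof.
move=> lm [_ [N [BN [mN hN]]]] e0 eta0; have fm := law_fm lm.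
pose D n := oscillation r0 e n.+1%:R^-1.
have BD n : d_borel (@dMstar R) (D n) by apply: d_borel_open; exact: open_oscillation.
have [|n] := fm_dec fm BD _ eta0.
  move=> n X [Y [Y' [XY XY' h]]]; exists Y, Y'; split=> //.
    by apply: lt_le_trans XY _; rewrite lee_fin natSinv_anti.
  by apply: lt_le_trans XY' _; rewrite lee_fin natSinv_anti.
have -> : fine (m (\bigcap_n D n)) = 0.
  apply/eqP; rewrite eq_le (fm_ge0 fm) ?andbT; last exact: d_borel_bigcap.
  have -> : 0 = fine (m N) by rewrite mN.
  apply: (fm_mono fm) => //; first exact: d_borel_bigcap.
  move=> X DX; apply: contrapT => /hN cX; have e20 : 0 < e / 2 by lra.
  have [zeta [zeta0 hz]] := ball_cont (svalP X) cX e20.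
  have [k kz] := natSinv_lt zeta0; have [Y [Y' [XY XY' h]]] := DX k Logic.I.
  have near (W : Mstar R) : (dMstar X W < k.+1%:R^-1%:E)%E ->
      (dMc (ballMc r0 W) (ballMc r0 X) < (e / 2)%:E)%E.
    move=> XW; apply: hz (svalP W) _; rewrite dGHP_sym; apply: lt_trans kz.
    by move: XW; rewrite lte_fin.
  move: h; rewrite leNgt => /negP; apply; rewrite (splitr e).
  by apply: (pseudo_trans pMc (near Y XY)); rewrite (pseudo_sym pMc); exact: near.
rewrite add0r => hn; exists n.+1%:R^-1; split; first exact: natSinv_gt0.
by rewrite (law_EFin lm (BD n)) lte_fin.
Qed.

(** Preimages of closed sets need not be closed, so their closures are tested. The set [D] is known
    to be small for the limit law [m] only, so it is discarded on the side of [m]: after the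
    Prokhorov inequality in one direction, before it in the other. *)
Lemma wconv_ball_of_wconv (mn : nat -> set (Mstar R) -> \bar R)
    (m : set (Mstar R) -> \bar R) (r : R) : (forall n, law (mn n)) -> law m ->
  wconv mn m -> cont_radius_law r m -> wconv_ball r mn m.
Proof.
move=> ln lm cm cr; have [rpos _] := cr; have r0 := ltW rpos.
apply/cvge0_ltP => [n|e e0]; first exact: prokhorov_ge0.
pose f := e / 3; have f0 : 0 < f by rewrite /f; lra.
have [delta [delta0 hd]] := oscillation_small r0 lm cr f0 f0.
pose D := oscillation r0 f delta.
have BD : d_borel (@dMstar R) D by apply: d_borel_open; exact: open_oscillation.
(* The [c]-neighbourhood and the closure together must stay within [delta]. *)
pose a := Num.min f (delta / 4); have a0 : 0 < a by rewrite lt_min f0; lra.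
have : a <= a by [].
rewrite {2}/a le_min => /andP[af ad].
have [|N hN] := (cvge0_ltP _).1 cm a a0; first by move=> n; exact: prokhorov_ge0.
exists N => n /hN /prokhorov_ltP[c [c0 ca hc]]; apply/prokhorov_ltP.
have Bpre (A : set (Mc R)) u : d_borel (@dMstar R) (ballMc r0 @^-1` d_nbhd (@dMc R) A u).
  by apply: borel_ball_preimage; exact: d_closed_nbhd.
have Bnb A u : d_borel (@dMstar R) (d_nbhd (@dMstar R) A u).
  by apply: d_borel_closed; exact: d_closed_nbhd.
have near A (S : set (Mstar R)) X : S `<=` ballMc r0 @^-1` A ->
    d_nbhd (@dMstar R) (d_closure (@dMstar R) S) c X ->
    exists Y, [/\ S Y, A (ballMc r0 Y) & (dMstar X Y < delta%:E)%E].
  move=> SA XS; have d40 : 0 < delta / 4 by lra.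
  have ca' : c < delta / 2 by lra.
  have [Z [ZS XZ]] := d_nbhd_lt ca' XS; have [Y [SY ZY]] := ZS _ d40.
  exists Y; split=> //; first exact: SA.
  have -> : delta = delta / 2 + delta / 2 by lra.
  apply: (pseudo_trans pM) XZ _; apply: lt_trans ZY _; rewrite lte_fin; lra.
have cS S : d_closed (@dMstar R) (d_closure (@dMstar R) S) by exact: d_closed_closure.
exists (2 * f); split; [lra|by rewrite /f; lra|move=> A cA].
have f2 : f < 2 * f by lra.
have inA (Y X : Mstar R) : A (ballMc r0 Y) -> ~ (f%:E <= dMc (ballMc r0 X) (ballMc r0 Y))%E ->
    d_nbhd (@dMc R) A (2 * f) (ballMc r0 X).
  move=> AY /negP; rewrite -ltNge => XY; apply: (d_nbhd_mem AY); apply: ltW.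
  by apply: lt_trans XY _; rewrite lte_fin.
have BA := borel_ball_preimage r0 cA.
rewrite !law_ballE; split.
- pose S := ballMc r0 @^-1` A.
  apply: (@le_trans _ _ (mn n (d_closure (@dMstar R) S))).
    by apply: law_mono => //; [exact: d_borel_closed|exact: sub_d_closure].
  apply: (le_trans (proj1 (hc _ (cS S)))).
  apply: (@le_trans _ _ (m (ballMc r0 @^-1` d_nbhd (@dMc R) A (2 * f)) + f%:E + c%:E)%E).
    apply: leeD => //.
    apply: (@le_trans _ _ (m (ballMc r0 @^-1` d_nbhd (@dMc R) A (2 * f) `|` D))).
      apply: law_mono => //; first exact: d_borelU.
      move=> X /(near A S X (@subset_refl _ _))[Y [_ AY XY]].
      have [XD|XD] := pselect (D X); [by right|left; apply: inA AY _ => h; apply: XD].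
      by exists X, Y; split=> //; exact: (pseudoxx pM).
    have fm := law_fm lm; have BU := d_borelU (Bpre A (2 * f)) BD.
    rewrite (law_EFin lm BU) (law_EFin lm (Bpre A (2 * f))) -EFinD lee_fin.
    apply: (le_trans (fm_subadd fm (Bpre A (2 * f)) BD)); rewrite lerD2l ltW//.
    by move: hd; rewrite (law_EFin lm BD) lte_fin.
  by rewrite -addeA; apply: leeD => //; rewrite -EFinD lee_fin; lra.
(* Removing [D] first puts the reference point [Y] outside [D]; the oscillation is then centred at
   [Y] instead of [X]. *)
- pose S := ballMc r0 @^-1` A `\` D.
  have BS : d_borel (@dMstar R) S by exact: d_borelD.
  have fm := law_fm lm.
  apply: (@le_trans _ _ (m S + f%:E)%E).
    rewrite (law_EFin lm BA) (law_EFin lm BS) -EFinD lee_fin.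
    have -> : ballMc r0 @^-1` A = S `|` (ballMc r0 @^-1` A `&` D).
      by rewrite /S setDE -setIUr setUC setUCr setIT.
    have BAD : d_borel (@dMstar R) (ballMc r0 @^-1` A `&` D) by exact: d_borelI.
    apply: (le_trans (fm_subadd fm BS BAD)); rewrite lerD2l.
    apply: (@le_trans _ _ (fine (m D))); first by apply: (fm_mono fm) => //; exact: subIsetr.
    by apply: ltW; move: hd; rewrite (law_EFin lm BD) lte_fin.
  have -> : 2 * f = f + f by lra.
  rewrite EFinD addeA; apply: leeD => //.
  apply: (@le_trans _ _ (m (d_closure (@dMstar R) S))).
    by apply: law_mono => //; [exact: d_borel_closed|exact: sub_d_closure].
  apply: (le_trans (proj2 (hc _ (cS S)))); apply: leeD; last by rewrite lee_fin; lra.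
  have -> : f + f = 2 * f by lra.
  apply: law_mono => // X /(near A S X (@subDsetl _ _ _))[Y [[_ YD] AY XY]].
  apply: inA AY _ => h; apply: YD; exists X, Y; split=> //.
  + by rewrite (pseudo_sym pM).
  + exact: (pseudoxx pM).
Qed.

End Convergence.

Theorem theorem3p30 (R : realType) (mu_ : nat -> set (Mstar R) -> \bar R)
    (mu : set (Mstar R) -> \bar R) :
  (forall n, law (mu_ n)) -> law mu ->
  [/\ (wconv mu_ mu <-> forall r : R, cont_radius_law r mu -> wconv_ball r mu_ mu),
      (wconv mu_ mu <->
         exists I : set R, I `<=` [set r | 0 <= r] /\
           (forall M : R, exists r, I r /\ M < r) /\
           forall r, I r -> wconv_ball r mu_ mu) &
      ((forall r : R, cont_radius_law r mu -> wconv_ball r mu_ mu) <->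
         exists I : set R, I `<=` [set r | 0 <= r] /\
           (forall M : R, exists r, I r /\ M < r) /\
           forall r, I r -> wconv_ball r mu_ mu)].
Proof.
move=> ln lm.
have i_ii : wconv mu_ mu -> forall r, cont_radius_law r mu -> wconv_ball r mu_ mu.
  by move=> cm r; exact: wconv_ball_of_wconv.
have ii_iii : (forall r, cont_radius_law r mu -> wconv_ball r mu_ mu) ->
    exists I : set R, I `<=` [set r | 0 <= r] /\
      (forall M : R, exists r, I r /\ M < r) /\ forall r, I r -> wconv_ball r mu_ mu.
  move=> h; exists [set r | cont_radius_law r mu]; split.
    by move=> r [/ltW].
  (* Density of continuity radii is available on the half-line from 0, hence the absolute value. *)
  split=> // M; have M0 : 0 <= `|M| by [].
  have [|r [Mr _ cr]] := cont_radius_law_dense lm M0 (b := `|M| + 1).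
    by rewrite ltrDl.
  by exists r; split=> //; apply: le_lt_trans Mr; exact: ler_norm.
have iii_i : (exists I : set R, I `<=` [set r | 0 <= r] /\
      (forall M : R, exists r, I r /\ M < r) /\ forall r, I r -> wconv_ball r mu_ mu) ->
    wconv mu_ mu.
  by move=> [D [D0 [Dunb Dconv]]]; exact: (wconv_of_balls ln lm D0 Dunb Dconv).
by split; split=> h; auto.
Qed.
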